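(* Let $x_0\in M$, let $Y:\mathbb R^n\to\Gamma(TM)$ be a linear map and let $\mathbf Z\in WG_p(\mathbb R^n)$. There is a unique solution $\mathbf X\in WG_p(M)$ (possibly up to explosion time) of the RDE $$d\mathbf X_t=Y_{d\mathbf Z_t}(x_t)\quad\text{with } x(0)=x_0.$$ Moreover, either $\mathbf X$ exists on all of $[0,T]$, or there exists $\tau\in[0,T]$ such that $\mathbf X$ exists on $[0,\tau)$ and the closure in $M$ of $\{x(t):0\le t<\tau\}$ is not compact.
   Context: Fix $T>0$, $p\in[2,3)$ and a control $\omega$, i.e. a continuous superadditive function $\omega:\{(s,t):0\le s\le t\le T\}\to[0,\infty)$ vanishing on the diagonal and positive off it. For a finite-dimensional normed space $W$, $WG_p(W)=WG_p([0,T],W)$ is the set of pairs $\mathbf X=(x,\mathbb X)$ of continuous maps $x:[0,T]\to W$ (the trace) and $\mathbb X:\{0\le s\le t\le T\}\to W\otimes W$ such that, with $x_{s,t}=x_t-x_s$: $\mathbb X_{s,t}=\mathbb X_{s,u}+\mathbb X_{u,t}+x_{s,u}\otimes x_{u,t}$ for $s\le u\le t$; $\sup_{s<t}|x_{s,t}|/\omega(s,t)^{1/p}<\infty$ and $\sup_{s<t}|\mathbb X_{s,t}|/\omega(s,t)^{2/p}<\infty$; and the symmetric part of $\mathbb X_{s,t}$ equals $\frac12 x_{s,t}\otimes x_{s,t}$. Other compact intervals are treated in the same way. For continuous $g,h$ on $\{s\le t\}$, $g_{s,t}\simeq h_{s,t}$ means: there are $\delta>0$ and $C$ with $|g_{s,t}-h_{s,t}|\le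 C\,\omega(s,t)^{3/p}$ whenever $|t-s|\le\delta$. For bilinear $B$ and a tensor $A$, $B(a,b)|_{a\otimes b=A}$ denotes $\hat B(A)$, where $\hat B$ is the linear map on the tensor product with $\hat B(a\otimes b)=B(a,b)$. $E=\mathbb R^N$ and $M\subset E$ is an embedded submanifold of dimension $d$ (locally the zero set of a smooth map $F:U\to\mathbb R^{N-d}$, $U\subset E$ open, with surjective differential); $\tau_mM=\mathrm{Nul}(F'(m))\cong T_mM$. $\Gamma(TM)$ is the set of smooth $Y:M\to E$ with $Y(m)\in\tau_mM$. For a smooth one-form $\alpha:E\to\mathrm{Hom}(E,W)$ and $\mathbf X\in WG_p(E)$, $\int\alpha(d\mathbf X)$ is the unique $\mathbf V=(v,\mathbb V)\in WG_p(W)$ with $v_0=0$, $v_{s,t}\simeq\alpha(x_s)x_{s,t}+\alpha'(x_s)\mathbb X_{s,t}$ and $\mathbb V_{s,t}\simeq[\alpha(x_s)\otimes\alpha(x_s)]\mathbb X_{s,t}$, where $\alpha'(x)[v\otimes w]=(\partial_v\alpha)(x)w$. $WG_p(M)$ is the set of $\mathbf X\in WG_p(E)$ whose trace lies in $M$ and such that $\int\tilde\alpha(d\mathbf X)\equiv0$ for every finite-dimensional $W$ and every smooth $W$-valued one-form $\tilde\alpha$ on $E$ with $\tilde\alpha|_{TM}\equiv0$. RDE on $M$: $\mathbf X=(x,\mathbb X)\in WG_p(M)$ solves $d\mathbf X_t=Y_{d\mathbf Z_t}(x_t)$, $x(0)=x_0$, where $\mathbf Z=(z,\mathbb Z)$,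 if $x(0)=x_0$, $$x_{s,t}\simeq Y_{z_{s,t}}(x_s)+(\partial_{Y_a}Y_b)(x_s)|_{a\otimes b=\mathbb Z_{s,t}},\qquad \mathbb X_{s,t}\simeq Y_a(x_s)\otimes Y_b(x_s)|_{a\otimes b=\mathbb Z_{s,t}}.$$ A solution on $[0,\tau)$ is one whose restriction to $[0,T_0]$ is a solution in $WG_p([0,T_0],M)$ for each $T_0<\tau$. *)

(* Defs.v *)
From mathcomp Require Import all_boot all_order all_algebra.
From mathcomp Require Import all_classical all_reals all_analysis.

Set Implicit Arguments.
Unset Strict Implicit.
Unset Printing Implicit Defensive.

Import Order.TTheory GRing.Theory Num.Theory.
Import numFieldNormedType.Exports.

Local Open Scope classical_set_scope.
Local Open Scope ring_scope.

(** * Tensors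

    A finite-dimensional space is taken in coordinates as ['rV[R]_n] and its
    tensor square as ['M[R]_n], so that [(a (x) b) i j = a_i b_j]. *)

Definition tens (R : realType) (n : nat) (a b : 'rV[R]_n) : 'M[R]_n :=
  a^T *m b.

(* [tlift B A] is [B(a,b)|_{a (x) b = A}]. *)
Definition tlift (R : realType) (n : nat) (V : lmodType R)
    (B : 'rV[R]_n -> 'rV[R]_n -> V) (A : 'M[R]_n) : V :=
  \sum_(i < n) \sum_(j < n) A i j *: B (delta_mx 0 i) (delta_mx 0 j).

Lemma tlift_tens (R : realType) (n : nat) (V : lmodType R)
    (B : 'rV[R]_n -> 'rV[R]_n -> V)
    (Bl : forall b, linear (B ^~ b)) (Br : forall a, linear (B a))
    (a b : 'rV[R]_n) :
  tlift B (tens a b) = B a b.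
Proof.
have sumlin (f : 'rV[R]_n -> V) (c : 'rV[R]_n) : linear f ->
    f c = \sum_(i < n) c 0 i *: f (delta_mx 0 i).
  move=> fl.
  have f0 : f 0 = 0 by have := fl (-1) 0 0; rewrite scaler0 addr0 scaleN1r addNr.
  rewrite {1}(row_sum_delta c); elim/big_rec2: _ => // i v u _ <-.
  exact: fl.
rewrite /tlift (sumlin (B ^~ b) a (Bl b)); apply: eq_bigr => i _.
rewrite (sumlin (B (delta_mx 0 i)) b (Br _)) scaler_sumr.
apply: eq_bigr => j _; rewrite scalerA; congr (_ *: _).
by rewrite /tens mxE big_ord1 mxE.
Qed.

(** * Smooth maps and embedded submanifolds *)

(* On an open [U] of a finite-dimensional space, [f] is C^(k+1) iff it is
   differentiable on [U] and all its directional derivatives are C^k. *)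
Fixpoint Ck (R : realType) (V W : normedModType R) (k : nat) (U : set V)
    (f : V -> W) : Prop :=
  match k with
  | 0 => forall x, U x -> {for x, continuous f}
  | k'.+1 => (forall x, U x -> differentiable f x) /\
             (forall v, Ck k' U (fun x => 'D_v f x))
  end.

Definition smooth_on (R : realType) (V W : normedModType R) (U : set V)
    (f : V -> W) : Prop := forall k, Ck k U f.

Definition local_equation (R : realType) (N d : nat) (M : set 'rV[R]_N)
    (m : 'rV[R]_N) (U : set 'rV[R]_N) (F : 'rV[R]_N -> 'rV[R]_(N - d)) : Prop :=
  [/\ open U, U m, smooth_on U F,
      (forall x, U x -> forall w, exists v, 'd F x v = w) &
      M `&` U = [set x | U x /\ F x = 0]].

(* [(d <= N)%N] because the subtraction in [local_equation] is truncated. *)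
Definition submanifold (R : realType) (N d : nat) (M : set 'rV[R]_N) : Prop :=
  (d <= N)%N /\ forall m, M m -> exists U F, local_equation (d := d) M m U F.

(* The null space of [F'(m)] does not depend on the local equation [F]. *)
Definition tangent (R : realType) (N d : nat) (M : set 'rV[R]_N)
    (m : 'rV[R]_N) : set 'rV[R]_N :=
  [set v | exists U F, local_equation (d := d) M m U F /\ 'd F m v = 0].

(* Maps defined on [M] are total functions whose values off [M] are
   irrelevant; smoothness on [M] is the existence of local smooth extensions. *)
Definition local_extension (R : realType) (N : nat) (W : normedModType R)
    (M : set 'rV[R]_N) (f : 'rV[R]_N -> W) (m : 'rV[R]_N)
    (g : 'rV[R]_N -> W) : Prop :=
  exists U : set 'rV[R]_N, [/\ open U, U m, smooth_on U g &
    forall x, M x -> U x -> g x = f x].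

Definition vector_field (R : realType) (N d : nat) (M : set 'rV[R]_N)
    (Y : 'rV[R]_N -> 'rV[R]_N) : Prop :=
  (forall m, M m -> exists g, local_extension M Y m g) /\
  (forall m, M m -> tangent d M m (Y m)).

(* Linearity of [a |-> Y a] is only required on [M], where fields live. *)
Definition linear_vector_fields (R : realType) (n N d : nat)
    (M : set 'rV[R]_N) (Y : 'rV[R]_n -> 'rV[R]_N -> 'rV[R]_N) : Prop :=
  (forall a, vector_field d M (Y a)) /\
  (forall m, M m -> linear (fun a => Y a m)).

(* The derivative at [m] of a smooth map on [M] along a tangent vector [v]:
   that of any local smooth extension, the choice of which is immaterial. *)
Definition tderiv (R : realType) (N : nat) (W : normedModType R)
    (M : set 'rV[R]_N) (f : 'rV[R]_N -> W) (v m : 'rV[R]_N) : W :=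
  'D_v (xget f [set g | local_extension M f m g]) m.

(** * Rough paths *)

Definition simplex (R : realType) (T : R) : set (R * R) :=
  [set st | [/\ 0 <= st.1, st.1 <= st.2 & st.2 <= T]].

Definition control (R : realType) (T : R) (omega : R -> R -> R) : Prop :=
  [/\ {within simplex T, continuous (fun st : R * R => omega st.1 st.2)},
      (forall s u t, 0 <= s -> s <= u -> u <= t -> t <= T ->
         omega s u + omega u t <= omega s t),
      (forall t, 0 <= t <= T -> omega t t = 0) &
      (forall s t, 0 <= s -> s < t -> t <= T -> 0 < omega s t)].

(* Only the values of [trace] on [0, T] and of [level2] on [simplex T] matter
   for a rough path on [0, T]. *)
Record rpath (R : realType) (n : nat) := RPath {
  trace : R -> 'rV[R]_n;
  level2 : R -> R -> 'M[R]_n }.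

Definition eq_rpath (R : realType) (n : nat) (T : R) (X X' : rpath R n) : Prop :=
  (forall t, 0 <= t <= T -> trace X t = trace X' t) /\
  (forall s t, 0 <= s -> s <= t -> t <= T -> level2 X s t = level2 X' s t).

Definition rpath0 (R : realType) (n : nat) : rpath R n :=
  RPath (fun=> 0) (fun _ _ => 0).

Definition incr (R : realType) (n : nat) (X : rpath R n) (s t : R) : 'rV[R]_n :=
  trace X t - trace X s.

Definition WG (R : realType) (n : nat) (omega : R -> R -> R) (p T : R)
    (X : rpath R n) : Prop :=
  [/\ {within `[0, T], continuous (trace X)} /\
      {within simplex T, continuous (fun st : R * R => level2 X st.1 st.2)},
      (forall s u t, 0 <= s -> s <= u -> u <= t -> t <= T ->
         level2 X s t = level2 X s u + level2 X u t
                        + tens (incr X s u) (incr X u t)),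
      (exists C, forall s t, 0 <= s -> s < t -> t <= T ->
         `|incr X s t| / omega s t `^ (1 / p) <= C),
      (exists C, forall s t, 0 <= s -> s < t -> t <= T ->
         `|level2 X s t| / omega s t `^ (2 / p) <= C) &
      (forall s t, 0 <= s -> s <= t -> t <= T ->
         2^-1 *: (level2 X s t + (level2 X s t)^T)
         = 2^-1 *: tens (incr X s t) (incr X s t))].

Definition approx (R : realType) (V : normedModType R) (omega : R -> R -> R)
    (p T : R) (g h : R -> R -> V) : Prop :=
  exists delta C : R, 0 < delta /\
    forall s t, 0 <= s -> s <= t -> t <= T -> `|t - s| <= delta ->
      `|g s t - h s t| <= C * omega s t `^ (3 / p).

(* A one-form with values in ['rV[R]_k] is a matrix-valued map acting on row
   vectors from the right: [alpha(x)v] is [v *m alpha x]. *)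
Definition rough_integral (R : realType) (n k : nat) (omega : R -> R -> R)
    (p T : R) (alpha : 'rV[R]_n -> 'M[R]_(n, k)) (X : rpath R n)
    (V : rpath R k) : Prop :=
  [/\ WG omega p T V, trace V 0 = 0,
      approx omega p T (incr V) (fun s t =>
        incr X s t *m alpha (trace X s) +
        tlift (fun v w => w *m 'D_v alpha (trace X s)) (level2 X s t)) &
      approx omega p T (level2 V) (fun s t =>
        tlift (fun v w => tens (v *m alpha (trace X s)) (w *m alpha (trace X s)))
          (level2 X s t))].

Definition WGM (R : realType) (N d : nat) (omega : R -> R -> R) (p T : R)
    (M : set 'rV[R]_N) (X : rpath R N) : Prop :=
  [/\ WG omega p T X, (forall t, 0 <= t <= T -> M (trace X t)) &
      forall (k : nat) (alpha : 'rV[R]_N -> 'M[R]_(N, k)),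
        smooth_on setT alpha ->
        (forall m v, M m -> tangent d M m v -> v *m alpha m = 0) ->
        rough_integral omega p T alpha X (rpath0 R k)].

(** * Rough differential equations on a submanifold *)

Definition rde_solution (R : realType) (n N d : nat) (omega : R -> R -> R)
    (p : R) (M : set 'rV[R]_N) (Y : 'rV[R]_n -> 'rV[R]_N -> 'rV[R]_N)
    (Z : rpath R n) (x0 : 'rV[R]_N) (T : R) (X : rpath R N) : Prop :=
  [/\ WGM d omega p T M X, trace X 0 = x0,
      approx omega p T (incr X) (fun s t =>
        Y (incr Z s t) (trace X s) +
        tlift (fun a b => tderiv M (Y b) (Y a (trace X s)) (trace X s))
          (level2 Z s t)) &
      approx omega p T (level2 X) (fun s t =>
        tlift (fun a b => tens (Y a (trace X s)) (Y b (trace X s)))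
          (level2 Z s t))].

Definition rde_solution_before (R : realType) (n N d : nat)
    (omega : R -> R -> R) (p : R) (M : set 'rV[R]_N)
    (Y : 'rV[R]_n -> 'rV[R]_N -> 'rV[R]_N) (Z : rpath R n) (x0 : 'rV[R]_N)
    (tau : R) (X : rpath R N) : Prop :=
  forall T0, 0 <= T0 < tau -> rde_solution d omega p M Y Z x0 T0 X.

(* The closure in [M] of [A `<=` M] is the trace on [M] of its closure in the
   ambient space, and its compactness is the same in [M] as in that space. *)
Definition explodes (R : realType) (N : nat) (M : set 'rV[R]_N) (tau : R)
    (X : rpath R N) : Prop :=
  ~ compact (closure [set trace X t | t in `[0, tau[] `&` M).

(* Main.v *)
Require Import Defs.
From mathcomp Require Import all_boot all_order all_algebra.
From mathcomp Require Import all_classical all_reals all_analysis.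
From mathcomp Require Import ring lra zify.
Set Implicit Arguments.
Unset Strict Implicit.
Unset Printing Implicit Defensive.
Import Order.TTheory GRing.Theory Num.Theory.
Import numFieldNormedType.Exports.
Local Open Scope classical_set_scope.
Local Open Scope ring_scope.

(** A solution is determined by its trace, and the trace is recognised by a
    local expansion: it is a continuous path [x] in [M] with
    [x t - x s = davie_incr s t (x s) + O(omega(s,t)^(3/p))], where [davie_incr]
    is the second-order Taylor increment of the equation. Such a path is called
    a [davie_path]; everything is reduced to these.

    Local existence. Near a point of [M] the fields extend smoothly to the
    ambient space, and by Chen's relation and Taylor's formula two steps
    [x |-> x + davie_incr s t x] over adjacent intervals differ from one step
    over their union by [O(omega(s,t)^(3/p))] ([step_compose],
    [step_remainder_le]). A step leaves [M], but not by more than that: if [F] is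
    a local equation of [M], the terms of order one and two of [F (x + davie_incr s t x)] cancel,
    because [F'(Y_a) = 0] on [M] and because the symmetric part of the driver
    is half the square of its increment ([step_near_manifold]); so a step can
    be pushed back to [M] at the same cost ([local_correction]). As [3/p > 1],
    paths which follow the corrected scheme over finite sets of times do so
    with a uniform constant (Davie's induction, [discrete_davie]), and
    compactness gives a path which follows it for all times
    ([davie_existence]).

    Uniqueness. The defect of additivity of the difference of two Davie errors
    is controlled by the distance of the paths and, with a small factor, by
    that difference itself. Halving an interval gains [2 * 2^(-3/p) < 1], so on
    a short interval two paths from one point coincide ([local_unique]), and
    then on every interval ([davie_path_unique]).

    Second level. Along a [davie_path] the second level of the solution is
    obtained by sewing its expected second-order part ([path_lift]). It is
    unique, and its symmetric part is the right one, because an additive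
    function of order [omega^(3/p)] is zero ([additive_small_eq0]). The lift
    belongs to [WGM]: a one-form [alpha] which vanishes on tangent vectors
    satisfies [alpha(Y_b) = 0] on [M], and the derivative of this identity along
    [Y_a] says that the germ of the rough integral of [alpha] vanishes
    ([one_form_cancel]).

    Maximality. The length of the interval of local existence is uniform for
    starting data near a given time and a given point of [M], so that a path
    with a cluster point in [M] at time [tau] extends past [tau]
    ([path_extend]). Let [tau] be the supremum of the times reached. If [tau] is
    reached, then it is [T]. Otherwise the trace has no cluster point in [M] at
    time [tau], which is explosion ([solution_explodes]). *)

(** * Matrix norms and the mean value inequality *)

Lemma mx_entry_le (R : realType) (m n : nat) (A : 'M[R]_(m, n)) i j :
  `|A i j| <= `|A|.
Proof.
rewrite [leRHS]/Num.Def.normr /= mx_normrE.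
exact: (le_bigmax _ (fun ij => `|A ij.1 ij.2|) (i, j)).
Qed.

Lemma mx_norm_le (R : realType) (m n : nat) (A : 'M[R]_(m, n)) C :
  0 <= C -> (forall i j, `|A i j| <= C) -> `|A| <= C.
Proof.
move=> C0 AC; rewrite [leLHS]/Num.Def.normr /= mx_normrE.
by apply: bigmax_le => // -[i j] _ /=.
Qed.

(** The norm of a matrix is its largest entry, so the scalar mean value theorem
    can be used entry by entry. *)
Lemma mvt_mx (R : realType) (m n : nat) (g dg : R -> 'M[R]_(m, n)) C :
  (forall t : R, 0 <= t <= 1 -> is_derive t 1 g (dg t)) ->
  (forall t : R, 0 <= t <= 1 -> `|dg t| <= C) -> `|g 1 - g 0| <= C.
Proof.
move=> dgP dgC.
have C0 : 0 <= C.
  by apply: le_trans (dgC 0 _); rewrite ?normr_ge0// lexx ler01.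
apply: mx_norm_le => // i j.
have dgij (t : R) : 0 <= t <= 1 -> is_derive t 1 (fun t => g t i j) (dg t i j).
  move=> /dgP[dt <-]; split; first exact: (derivable_mxP _ _ _).1.
  by rewrite derive_mx // mxE.
have [||c c01] := @MVT_segment R (fun t => g t i j) (fun t => dg t i j) 0 1 ler01.
- by move=> t; rewrite in_itv /= => /andP[/ltW t0 /ltW t1]; apply/dgij/andP.
- apply: derivable_within_continuous => t; rewrite in_itv /= => t01.
  by have [] := dgij t t01.
rewrite subr0 mulr1 !mxE => ->; apply: le_trans (mx_entry_le _ _ _) (dgC _ _).
by move: c01; rewrite in_itv.
Qed.

Lemma is_derive_line (R : realType) (V W : normedModType R) (f : V -> W)
    (x h : V) (t : R) :
  differentiable f (x + t *: h) ->
  is_derive t 1 (fun s : R => f (x + s *: h)) ('D_h f (x + t *: h)).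
Proof.
move=> df; set l := fun s : R => x + s *: h.
have dl : is_diff t l (fun s : R => s *: h).
  apply: is_diff_eq; rewrite /= ?add0r //.
have dfl : differentiable (f \o l) t by apply: differentiable_comp.
split; first exact/diff_derivable.
rewrite deriveE // diff_comp //= deriveE //.
by rewrite diff_val scale1r.
Qed.

(** * Differentiability and maps of class C^k *)

Lemma near_norm (R : realType) (V : normedModType R) (x : V) (P : V -> Prop) :
  (\forall y \near x, P y) <->
  exists d : R, 0 < d /\ forall y, `|y - x| < d -> P y.
Proof.
split.
  move=> /nbhs_ballP[d /= d0 dP]; exists d; split => // y yx; apply: dP.
  by rewrite -ball_normE /= distrC.
move=> [d [d0 dP]]; apply/nbhs_ballP; exists d => //= y.
by rewrite -ball_normE /= distrC; exact: dP.
Qed.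

Lemma differentiable_eps (R : realType) (V W : normedModType R) (f : V -> W)
    (x : V) (e : R) : differentiable f x -> 0 < e ->
  exists d : R, 0 < d /\ forall y, `|y - x| < d ->
    `|f y - f x - 'd f x (y - x)| <= e * `|y - x|.
Proof.
move=> /diff_locally/eqaddoP H e0.
have /near_norm[d [d0 dP]] := H e e0; exists d; split => // y yx.
have := dP (y - x); rewrite subr0 => /(_ yx).
by rewrite !fctE /= subrK opprD addrA.
Qed.

Lemma eps_differentiable (R : realType) (V W : normedModType R) (f : V -> W)
    (L : {linear V -> W}) (x : V) : continuous L ->
  (forall e : R, 0 < e -> exists d : R, 0 < d /\ forall y, `|y - x| < d ->
    `|f y - f x - L (y - x)| <= e * `|y - x|) ->
  differentiable f x.
Proof.
move=> cL H.
have key : f \o shift x = cst (f x) + L +o_ 0 id.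
  apply/eqaddoP => e e0; have [d [d0 dP]] := H e e0; apply/near_norm.
  exists d; split => // h; rewrite subr0 => hd.
  by have := dP (h + x); rewrite addrK opprD addrA; apply.
apply/diff_locallyP; have -> := diff_unique cL key.
by split.
Qed.

Lemma near_eq_differentiable (R : realType) (V W : normedModType R)
    (f g : V -> W) (x : V) :
  (\forall x \near x, f x = g x) -> differentiable f x -> differentiable g x.
Proof.
move=> fg df; have gx : f x = g x by have := nbhs_singleton fg.
have /near_norm[d1 [d10 d1P]] := fg.
apply: (@eps_differentiable _ _ _ _ ('d f x)); first exact: diff_continuous.
move=> e e0; have [d [d0 dP]] := differentiable_eps df e0.
exists (Num.min d d1); split; first by rewrite lt_min d0.
by move=> y; rewrite lt_min => /andP[yd yd1]; rewrite -gx -d1P //; exact: dP.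
Qed.

Section Ck.
Context (R : realType) (V : normedModType R) (U : set V).
Hypothesis Uo : open U.

Lemma Ck_continuous (W : normedModType R) k (f : V -> W) :
  Ck k U f -> forall x, U x -> {for x, continuous f}.
Proof.
case: k => [//|k] [df _] x Ux; exact: differentiable_continuous (df x Ux).
Qed.

Lemma Ck_le (W : normedModType R) k (f : V -> W) : Ck k.+1 U f -> Ck k U f.
Proof.
elim: k f => [|k IH] f [df dfv]; first exact: (@Ck_continuous _ 1).
by split => // v; apply: IH; exact: dfv.
Qed.

Lemma Ck_eq (W : normedModType R) k (f g : V -> W) :
  (forall x, U x -> f x = g x) -> Ck k U f -> Ck k U g.
Proof.
elim: k f g => [|k IH] f g fg.
  move=> cf x Ux; rewrite /prop_for /continuous_at -(fg x Ux).
  apply: cvg_trans (cf x Ux); apply: near_eq_cvg.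
  by near do apply: fg; exact: open_nbhs_nbhs.
have nfg x : U x -> \forall y \near x, f y = g y.
  by move=> Ux; near do apply: fg; exact: open_nbhs_nbhs.
move=> [df dfv]; split => [x Ux|v].
  exact: near_eq_differentiable (nfg x Ux) (df x Ux).
apply: IH (dfv v) => x Ux; exact/near_eq_derive/nfg.
Unshelve. all: by end_near. Qed.

Lemma Ck_D (W : normedModType R) k (f g : V -> W) :
  Ck k U f -> Ck k U g -> Ck k U (fun x => f x + g x).
Proof.
elim: k f g => [|k IH] f g.
  by move=> cf cg x Ux; apply: cvgD; [exact: cf|exact: cg].
move=> [df dfv] [dg dgv]; split => [x Ux|v].
  by apply: differentiableD; [exact: df|exact: dg].
apply: (Ck_eq _ (IH _ _ (dfv v) (dgv v))) => x Ux.
by rewrite deriveD //; apply: diff_derivable; [exact: df|exact: dg].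
Qed.

Lemma Ck_cst (W : normedModType R) k (c : W) : Ck k U (fun=> c).
Proof.
elim: k c => [|k IH] c; first by move=> x _; exact: cvg_cst.
split => [x _|v]; first exact: differentiable_cst.
by apply: Ck_eq (IH 0) => x _; rewrite derive_cst.
Qed.

Lemma Ck_sum (W : normedModType R) k n (f : 'I_n -> V -> W) :
  (forall i, Ck k U (f i)) -> Ck k U (fun x => \sum_i f i x).
Proof.
move=> fC; elim: (index_enum _) => [|i r IH].
  by rewrite (_ : (fun _ => _) = fun=> 0); [exact: Ck_cst|
    apply/funext => x; rewrite big_nil].
rewrite (_ : (fun _ => _) = fun x => f i x + \sum_(j <- r) f j x).
  exact: Ck_D.
by apply/funext => x; rewrite big_cons.
Qed.

(** Leibniz' rule leaves one factor undifferentiated, hence the use of [Ck_le]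
    in the induction. *)
Lemma Ck_M k (f g : V -> R) :
  Ck k U f -> Ck k U g -> Ck k U (fun x => f x * g x).
Proof.
elim: k f g => [|k IH] f g.
  by move=> cf cg x Ux; apply: cvgM; [exact: cf|exact: cg].
move=> Cf Cg; have [df dfv] := Cf; have [dg dgv] := Cg; split => [x Ux|v].
  by apply: differentiableM; [exact: df|exact: dg].
apply: (Ck_eq _ (Ck_D (IH _ _ (Ck_le Cf) (dgv v)) (IH _ _ (Ck_le Cg) (dfv v)))).
by move=> x Ux; rewrite deriveM //; apply: diff_derivable; [exact: df|exact: dg].
Qed.

Lemma Ck_scale (W : normedModType R) k (f : V -> R) (w : W) :
  Ck k U f -> Ck k U (fun x => f x *: w).
Proof.
elim: k f => [|k IH] f; first by move=> cf x Ux; apply: cvgZr_tmp; exact: cf.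
move=> [df dfv]; split => [x Ux|v]; first by apply: differentiableZl; exact: df.
apply: (Ck_eq _ (IH _ (dfv v))) => x Ux.
rewrite [RHS]deriveE; last by apply: differentiableZl; exact: df.
by rewrite diffZl ?deriveE //; exact: df.
Qed.

Lemma Ck_coord k m n (f : V -> 'M[R]_(m, n)) i j :
  Ck k U f -> Ck k U (fun x => f x i j).
Proof.
elim: k f => [|k IH] f.
  move=> cf x Ux; apply: (@cvg_comp _ _ _ f (fun A : 'M[R]_(m, n) => A i j)).
    exact: cf. exact: coord_continuous.
move=> [df dfv]; split => [x Ux|v].
  apply: (@differentiable_comp _ _ _ _ f (fun A : 'M[R]_(m, n) => A i j)).
    exact: df.
  exact: differentiable_coord.
apply: (Ck_eq _ (IH _ (dfv v))) => x Ux.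
by rewrite derive_mx ?mxE //; apply: diff_derivable; exact: df.
Qed.

End Ck.

(** * Uniform bounds on closed balls *)

Definition cball (R : realType) (V : normedModType R) (x0 : V) (r : R) : set V :=
  [set x | `|x - x0| <= r].

Lemma cball_convex (R : realType) (V : normedModType R) (x0 : V) (r : R) x h (t : R) :
  0 <= t <= 1 -> cball x0 r x -> cball x0 r (x + h) -> cball x0 r (x + t *: h).
Proof.
move=> /andP[t0 t1]; rewrite /cball /= => xr xhr.
have -> : x + t *: h - x0 = (1 - t) *: (x - x0) + t *: (x + h - x0).
  by rewrite [x + h - x0]addrAC [t *: (_ + h)]scalerDr addrA -scalerDl subrK
    scale1r addrAC.
apply: le_trans (ler_normD _ _) _.
rewrite !normrZ (ger0_norm t0) ger0_norm ?subr_ge0//.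
have -> : r = (1 - t) * r + t * r by ring.
by apply: lerD; apply: ler_wpM2l; rewrite // subr_ge0.
Qed.

Lemma derive_coordE (R : realType) (N : nat) (W : normedModType R)
    (f : 'rV[R]_N -> W) (v x : 'rV[R]_N) : differentiable f x ->
  'D_v f x = \sum_k v 0 k *: 'D_(delta_mx 0 k) f x.
Proof.
move=> df; rewrite deriveE // {1}(row_sum_delta v) linear_sum.
by apply: eq_bigr => k _; rewrite linearZ deriveE.
Qed.

Lemma derive_lincomb (R : realType) (V W : normedModType R) (n : nat)
    (c : 'I_n -> R) (g : 'I_n -> V -> W) (x : V) :
  (forall k, differentiable (g k) x) ->
  differentiable (fun y => \sum_k c k *: g k y) x /\
  forall w, 'D_w (fun y => \sum_k c k *: g k y) x = \sum_k c k *: 'D_w (g k) x.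
Proof.
move=> dg.
have -> : (fun y => \sum_k c k *: g k y) = \sum_k (c k *: g k).
  by apply/funext => y; rewrite fct_sumE.
split; first by apply: differentiable_sum => k; exact: differentiableZ.
move=> w; rewrite derive_sum; last first.
  by move=> k; apply/derivableZ/diff_derivable.
by apply: eq_bigr => k _; rewrite deriveZ //; exact: diff_derivable.
Qed.

(** Merges finitely many local estimates, usually one for each basis vector,
    into one with a common constant [C] and a common radius [r]. *)
Lemma fin_unif (R : realType) (n : nat) (P : 'I_n -> R -> R -> Prop) :
  (forall i C C' r r', C <= C' -> 0 < r' <= r -> P i C r -> P i C' r') ->
  (forall i, exists C r, 0 < r /\ P i C r) ->
  exists C r, [/\ 0 <= C, 0 < r & forall i, P i C r].
Proof.
move=> mono /choice[C /choice[r rP]].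
exists (\sum_i `|C i|), (\big[Order.min/1]_i r i); split.
- by apply: sumr_ge0.
- by elim/big_ind: _ => // [x y x0 y0|i _]; [rewrite lt_min x0|case: (rP i)].
move=> i; apply: mono (rP i).2.
  by rewrite (le_trans (ler_norm _)) // (bigD1 i) //= lerDl sumr_ge0.
rewrite bigmin_le_cond // andbT.
by elim/big_ind: _ => // [x y x0 y0|j _]; [rewrite lt_min x0|case: (rP j)].
Qed.

Section smooth_bounds.
Context (R : realType) (N : nat) (U : set 'rV[R]_N) (x0 : 'rV[R]_N).
Hypotheses (Uo : open U) (Ux0 : U x0).

Lemma smooth_D (W : normedModType R) (f : 'rV[R]_N -> W) v :
  smooth_on U f -> smooth_on U (fun x => 'D_v f x).
Proof. by move=> sf k; have [_] := sf k.+1; apply. Qed.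

Lemma smooth_differentiable (W : normedModType R) (f : 'rV[R]_N -> W) x :
  smooth_on U f -> U x -> differentiable f x.
Proof. by move=> sf; have [+ _] := sf 1; apply. Qed.

Lemma open_cball : exists r : R, 0 < r /\ forall x, cball x0 r x -> U x.
Proof.
have /near_norm[d [d0 dU]] : \forall x \near x0, U x by exact: open_nbhs_nbhs.
exists (d / 2); split; first by rewrite divr_gt0.
move=> x xr; apply: dU; apply: le_lt_trans xr _.
by rewrite ltr_pdivrMr // ltr_pMr // ltr1n.
Qed.

Lemma smooth_bounded (W : normedModType R) (f : 'rV[R]_N -> W) :
  smooth_on U f ->
  exists C r, 0 < r /\ forall x, cball x0 r x -> U x /\ `|f x| <= C.
Proof.
move=> sf; have [r1 [r10 r1U]] := open_cball.
have := sf 0 x0 Ux0; move=> /cvgrPdist_le/(_ 1 ltr01)/near_norm[d [d0 dP]].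
exists (`|f x0| + 1), (Num.min r1 (d / 2)); split.
  by rewrite lt_min r10 divr_gt0.
move=> x; rewrite /cball /= le_min => /andP[xr1 xd]; split; first exact: r1U.
rewrite -[f x](subrKC (f x0)) (le_trans (ler_normD _ _)) // lerD2l distrC dP //.
by apply: le_lt_trans xd _; rewrite ltr_pdivrMr // ltr_pMr // ltr1n.
Qed.

Lemma row_entry_sum (v : 'rV[R]_N) (W : normedModType R) (w : 'I_N -> W) C :
  (forall k, `|w k| <= C) -> `|\sum_k v 0 k *: w k| <= N%:R * C * `|v|.
Proof.
move=> wC; apply: le_trans (ler_norm_sum _ _ _) _.
apply: (@le_trans _ _ (\sum_(k < N) C * `|v|)).
  apply: ler_sum => k _; rewrite normrZ mulrC ler_pM //.
  exact: mx_entry_le.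
by rewrite sumr_const card_ord -[_ *+ N]mulr_natl mulrA.
Qed.

Lemma smooth_D_bounded (W : normedModType R) (f : 'rV[R]_N -> W) :
  smooth_on U f -> exists C r, [/\ 0 <= C, 0 < r & forall x v, cball x0 r x ->
    [/\ U x, `|f x| <= C & `|'D_v f x| <= C * `|v|]].
Proof.
move=> sf; have [C0 [r0 [r00 P0]]] := smooth_bounded sf.
have [||C [r [C00 r0' P]]] := @fin_unif R N (fun k C r => forall x, cball x0 r x ->
   `|'D_(delta_mx 0 k) f x| <= C).
- move=> k C C' r r' CC' /andP[_ rr'] P x xr; apply: le_trans CC'.
  by apply: P; exact: le_trans rr'.
- move=> k; have [C [r [r0' P]]] := smooth_bounded (smooth_D (delta_mx 0 k) sf).
  by exists C, r; split => // x /P[].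
exists (Num.max C0 (N%:R * C)), (Num.min r0 r); split.
- by rewrite le_max mulr_ge0 ?orbT.
- by rewrite lt_min r00.
move=> x v; rewrite /cball /= le_min => /andP[xr0 xr].
have [Ux fx] := P0 _ xr0; split => //; first by rewrite le_max fx.
rewrite (derive_coordE _ (smooth_differentiable sf Ux)).
apply: le_trans (row_entry_sum _ (fun k => P k x xr)) _.
by rewrite ler_wpM2r // le_max lexx orbT.
Qed.

End smooth_bounds.

(** The class C^{1,1} on a ball, with one constant for the map, its derivative and
    the Lipschitz modulus of the derivative. This is all that is retained of
    smoothness in the estimates on the scheme. *)
Definition C11 (R : realType) (N m n : nat) (f : 'rV[R]_N -> 'M[R]_(m, n))
    (x0 : 'rV[R]_N) (r C : R) : Prop :=
  forall x, cball x0 r x -> [/\ differentiable f x, `|f x| <= C,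
    forall v, `|'D_v f x| <= C * `|v| &
    forall y v, cball x0 r y -> `|'D_v f x - 'D_v f y| <= C * `|v| * `|x - y|].

Lemma cball_lipschitz (R : realType) (N m n : nat) (f : 'rV[R]_N -> 'M[R]_(m, n))
    (x0 : 'rV[R]_N) (r C : R) x y :
  (forall x v, cball x0 r x -> differentiable f x /\ `|'D_v f x| <= C * `|v|) ->
  cball x0 r x -> cball x0 r y -> `|f x - f y| <= C * `|x - y|.
Proof.
move=> fC xr yr.
have xy : y + (x - y) = x by rewrite addrC subrK.
have := @mvt_mx R m n (fun t => f (y + t *: (x - y)))
  (fun t => 'D_(x - y) f (y + t *: (x - y))) (C * `|x - y|).
rewrite scale1r scale0r addr0 xy; apply => t t01.
- apply: is_derive_line; have [] // := fC (y + t *: (x - y)) 0.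
  by apply: cball_convex; rewrite ?xy.
by have [] // := fC (y + t *: (x - y)) (x - y); apply: cball_convex; rewrite ?xy.
Qed.

Lemma C11W (R : realType) (N m n : nat) (f : 'rV[R]_N -> 'M[R]_(m, n))
    (x0 : 'rV[R]_N) (r r' C C' : R) :
  C <= C' -> r' <= r -> C11 f x0 r C -> C11 f x0 r' C'.
Proof.
move=> CC' rr' fC x xr; have xr' : cball x0 r x by exact: le_trans rr'.
have [df fx Df DDf] := fC x xr'; split => //; first exact: le_trans CC'.
  by move=> v; rewrite (le_trans (Df v)) // ler_wpM2r.
move=> y v yr; have yr' : cball x0 r y by exact: le_trans rr'.
by rewrite (le_trans (DDf y v yr')) // !ler_wpM2r.
Qed.

Section smooth_C11.
Context (R : realType) (N m n : nat) (U : set 'rV[R]_N) (x0 : 'rV[R]_N).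
Hypotheses (Uo : open U) (Ux0 : U x0).

(** ['D_v f x] is a combination of partial derivatives; these are smooth, so they
    are bounded near [x0], and Lipschitz because their own derivatives are. *)
Lemma smooth_C11 (f : 'rV[R]_N -> 'M[R]_(m, n)) :
  smooth_on U f -> exists C r, [/\ 0 <= C, 0 < r,
    (forall x, cball x0 r x -> U x) & C11 f x0 r C].
Proof.
move=> sf; have [C0 [r0 [C00 r00 P0]]] := smooth_D_bounded Uo Ux0 sf.
have [||C [r [C0' r0' P]]] := @fin_unif R N (fun k C r => forall x v,
   cball x0 r x -> `|'D_v (fun y => 'D_(delta_mx 0 k) f y) x| <= C * `|v|).
- move=> k C C' r r' CC' /andP[_ rr'] P x v xr.
  apply: (@le_trans _ _ (C * `|v|)); last by rewrite ler_wpM2r.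
  by apply: P; exact: le_trans rr'.
- move=> k; have [C [r [C0' r0' P]]] :=
    smooth_D_bounded Uo Ux0 (smooth_D (delta_mx 0 k) sf).
  by exists C, r; split => // x v xr; have [] := P x v xr.
exists (Num.max C0 (N%:R * C)), (Num.min r0 r); split.
- by rewrite le_max C00.
- by rewrite lt_min r00.
- by move=> x; rewrite /cball /= le_min => /andP[xr0 xr]; have [] := P0 x 0 xr0.
apply: (@C11W _ _ _ _ _ _ (Num.min r0 r) _ (Num.max C0 (N%:R * C))) => //.
move=> x; rewrite /cball /= le_min => /andP[xr0 xr].
have [Ux fx _] := P0 x 0 xr0; split.
- exact: smooth_differentiable sf Ux.
- by rewrite le_max fx.
- move=> v; have [_ _ Dv] := P0 x v xr0; apply: le_trans Dv _.
  by rewrite ler_wpM2r // le_max lexx.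
have lipk k z w : cball x0 (Num.min r0 r) z ->
    differentiable (fun z => 'D_(delta_mx 0 k) f z) z /\
    `|'D_w (fun z => 'D_(delta_mx 0 k) f z) z| <= C * `|w|.
  rewrite /cball /= le_min => /andP[zr0 zr]; split; last exact: P.
  have [Uz _ _] := P0 z 0 zr0.
  exact: smooth_differentiable (smooth_D _ sf) Uz.
move=> y v; rewrite le_min => /andP[yr0 yr]; have [Uy _ _] := P0 y 0 yr0.
rewrite !(derive_coordE v (smooth_differentiable sf _)) // -sumrB.
under eq_bigr do rewrite -scalerBr.
have := @row_entry_sum R N v _
  (fun k => 'D_(delta_mx 0 k) f x - 'D_(delta_mx 0 k) f y) (C * `|x - y|).
move=> H; apply: le_trans (H _) _ => [k|].
  apply: (@cball_lipschitz R N m n (fun z =>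
    'D_(delta_mx 0 k) f z) x0 (Num.min r0 r)).
  + exact: lipk.
  + by rewrite /cball /= le_min xr0.
  + by rewrite /cball /= le_min yr0.
have -> : N%:R * (C * `|x - y|) * `|v| = N%:R * C * `|v| * `|x - y| by ring.
by rewrite !ler_wpM2r // le_max lexx orbT.
Qed.

Lemma smooth_C11D (f : 'rV[R]_N -> 'M[R]_(m, n)) :
  smooth_on U f -> exists C r, [/\ 0 <= C, 0 < r,
    (forall x, cball x0 r x -> U x), C11 f x0 r C &
    forall v, C11 (fun x => 'D_v f x) x0 r (C * `|v|)].
Proof.
move=> sf; have [C0 [r0 [C00 r00 U0 P0]]] := smooth_C11 sf.
have [||C [r [C0' r0' P]]] := @fin_unif R N (fun k C r =>
   C11 (fun y => 'D_(delta_mx 0 k) f y) x0 r C).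
- by move=> k C C' r r' CC' /andP[_ rr']; exact: C11W.
- move=> k; have [C [r [C0' r0' _ P]]] := smooth_C11 (smooth_D (delta_mx 0 k) sf).
  by exists C, r.
exists (Num.max C0 (N%:R * C)), (Num.min r0 r); split.
- by rewrite le_max C00.
- by rewrite lt_min r00.
- by move=> x; rewrite /cball /= le_min => /andP[xr0 xr]; exact: U0.
- by apply: C11W P0; rewrite ?le_max ?lexx // ge_min lexx.
move=> v; set D := fun k x => 'D_(delta_mx 0 k) f x.
have DE x : U x -> \forall y \near x, \sum_k v 0 k *: D k y = 'D_v f y.
  move=> Ux; near do rewrite -(derive_coordE _ (smooth_differentiable sf _)) //.
  exact: open_nbhs_nbhs.
apply: (@C11W _ _ _ _ _ _ (Num.min r0 r) _ (N%:R * C * `|v|)) => //.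
  by rewrite ler_wpM2r // le_max lexx orbT.
move=> x; rewrite /cball /= le_min => /andP[xr0 xr].
have dD z k : cball x0 r z -> differentiable (D k) z by move=> /(P k)[].
have DDE z w : cball x0 r0 z -> cball x0 r z ->
    'D_w (fun y => 'D_v f y) z = \sum_k v 0 k *: 'D_w (D k) z.
  move=> /U0 Uz zr; rewrite -(near_eq_derive _ (DE _ Uz)).
  by have [_ ->] := derive_lincomb (fun k => v 0 k) (fun k => dD z k zr).
split.
- apply: near_eq_differentiable (DE _ (U0 _ xr0)) _.
  by have [] := derive_lincomb (fun k => v 0 k) (fun k => dD x k xr).
- rewrite -(nbhs_singleton (DE _ (U0 _ xr0))).
  by apply: row_entry_sum => k; case: (P k _ xr).
- move=> w; rewrite DDE // mulrAC.
  have := @row_entry_sum R N v _ (fun k => 'D_w (D k) x) (C * `|w|).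
  by rewrite mulrA; apply => k; case: (P k _ xr).
move=> y w; rewrite le_min => /andP[yr0 yr].
rewrite (DDE _ _ xr0 xr) (DDE _ _ yr0 yr) -sumrB.
under eq_bigr do rewrite -scalerBr.
have := @row_entry_sum R N v _ (fun k => 'D_w (D k) x - 'D_w (D k) y)
  (C * `|w| * `|x - y|).
move=> H; apply: le_trans (H _) _ => [k|]; first by case: (P k _ xr) => _ _ _; apply.
suff -> : N%:R * (C * `|w| * `|x - y|) * `|v| =
  N%:R * C * `|v| * `|w| * `|x - y| by [].
ring.
Unshelve. all: by end_near. Qed.

End smooth_C11.

(** * Taylor estimates and symmetry of second derivatives *)

Lemma deriveBdir (R : realType) (V W : normedModType R) (f : V -> W) x h k :
  differentiable f x -> 'D_(h - k) f x = 'D_h f x - 'D_k f x.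
Proof. by move=> df; rewrite !deriveE // linearB. Qed.

Lemma deriveZdir (R : realType) (V W : normedModType R) (f : V -> W) x (t : R) k :
  differentiable f x -> 'D_(t *: k) f x = t *: 'D_k f x.
Proof. by move=> df; rewrite !deriveE // linearZ. Qed.

Lemma is_derive_scale1 (R : realType) (V : normedModType R) (t : R) (v : V) :
  is_derive t 1 (fun s : R => s *: v) v.
Proof.
have df : differentiable (fun s : R => s *: v) t by [].
split; first exact: diff_derivable.
by rewrite deriveE // diff_val scale1r.
Qed.

Lemma is_derive_Zl (R : realType) (V : normedModType R) (phi : R ->
  R) (t d : R) (v : V) :
  is_derive t 1 phi d -> is_derive t 1 (fun s : R => phi s *: v) (d *: v).
Proof.
move=> [/derivable1_diffP dphi <-].
have df : differentiable (fun s : R => phi s *: v) t by exact: differentiableZl.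
split; first exact: diff_derivable.
by rewrite deriveE // diffZl // deriveE.
Qed.

Lemma is_derive_sub (R : realType) (V : normedModType R) (g k : R -> V) (t : R) u v :
  is_derive t 1 g u -> is_derive t 1 k v ->
  is_derive t 1 (fun s => g s - k s) (u - v).
Proof. by move=> dg dk; exact: is_deriveB. Qed.

Section C11_estimates.
Context (R : realType) (N m n : nat) (f : 'rV[R]_N -> 'M[R]_(m, n)).
Context (x0 : 'rV[R]_N) (r C : R).
Local Notation B := (cball x0 r).

Lemma C11_ge0 : 0 <= r -> C11 f x0 r C -> 0 <= C.
Proof.
move=> r0 /(_ x0); rewrite /cball /= subrr normr0 => /(_ r0)[_ + _ _].
exact: le_trans.
Qed.

Lemma C11_lip x y : C11 f x0 r C -> B x -> B y -> `|f x - f y| <= C * `|x - y|.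
Proof. by move=> fC; apply: cball_lipschitz => z v /fC[]. Qed.

Lemma is_derive_segment x h (t : R) : (forall z, B z -> differentiable f z) ->
  B x -> B (x + h) -> 0 <= t <= 1 ->
  is_derive t 1 (fun s : R => f (x + s *: h)) ('D_h f (x + t *: h)).
Proof. by move=> df xr xhr t01; apply/is_derive_line/df/cball_convex. Qed.

(** Mean value theorem for [t |-> f (x + t h) - t 'D_h f x], whose derivative is
    of order [C |h|^2]. *)
Lemma C11_taylor x h : C11 f x0 r C -> B x -> B (x + h) ->
  `|f (x + h) - f x - 'D_h f x| <= C * `|h| ^+ 2.
Proof.
move=> fC xr xhr; have dfB z : B z -> differentiable f z by move=> /fC[].
have C0 : 0 <= C by apply: C11_ge0 => //; exact: le_trans xr.
pose psi t := f (x + t *: h) - t *: 'D_h f x.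
have -> : f (x + h) - f x - 'D_h f x = psi 1 - psi 0.
  by rewrite /psi !scale1r !scale0r addr0 subr0 addrAC.
apply: (mvt_mx (dg := fun t => 'D_h f (x + t *: h) - 'D_h f x)) => t t01.
  by apply: is_derive_sub; [exact: is_derive_segment|exact: is_derive_scale1].
have [_ _ _ /(_ x h xr)] := fC _ (cball_convex t01 xr xhr).
move=> H; apply: (le_trans H); rewrite addrAC subrr add0r normrZ.
case/andP: t01 => t0 t1; rewrite expr2 !mulrA ler_wpM2r //.
by rewrite (ger0_norm t0) ler_piMr // mulr_ge0.
Qed.

(** A double difference is bounded by the mismatch of the two increments plus a
    product of an increment and the distance between the two base segments. *)
Lemma C11_ddiff x y h k : C11 f x0 r C ->
  B x -> B (x + h) -> B y -> B (y + k) ->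
  `|f (x + h) - f x - (f (y + k) - f y)| <=
  C * (`|h - k| + (`|x - y| + `|h - k|) * `|k|).
Proof.
move=> fC xr xhr yr ykr; have dfB z : B z -> differentiable f z by move=> /fC[].
have C0 : 0 <= C by apply: C11_ge0 => //; exact: le_trans xr.
pose psi t := f (x + t *: h) - f (y + t *: k).
have -> : f (x + h) - f x - (f (y + k) - f y) = psi 1 - psi 0.
  rewrite /psi !scale1r !scale0r !addr0.
  by move: (f _) (f _) (f _) (f _) => a b c d; apply/matrixP => i j; rewrite !mxE;
    ring.
apply: (mvt_mx (dg := fun t => 'D_h f (x + t *: h) - 'D_k f (y + t *: k))) => t t01.
  by apply: is_derive_sub; exact: is_derive_segment.
have xt := cball_convex t01 xr xhr; have yt := cball_convex t01 yr ykr.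
have -> : 'D_h f (x + t *: h) - 'D_k f (y + t *: k) =
    'D_(h - k) f (x + t *: h) + ('D_k f (x + t *: h) - 'D_k f (y + t *: k)).
  by rewrite (deriveBdir _ _ (dfB _ xt)) addrA subrK.
apply: le_trans (ler_normD _ _) _; rewrite mulrDr; apply: lerD.
  by have [_ _ + _] := fC _ xt; apply.
have [_ _ _ /(_ _ k yt) H] := fC _ xt; apply: le_trans H _.
rewrite -mulrA ler_wpM2l // mulrC ler_wpM2r //.
have -> : x + t *: h - (y + t *: k) = (x - y) + t *: (h - k).
  by rewrite opprD addrACA scalerBr.
apply: le_trans (ler_normD _ _) _; rewrite lerD2l normrZ.
by case/andP: t01 => t0 t1; rewrite (ger0_norm t0) ler_piMl.
Qed.

End C11_estimates.

Section C11D_estimates.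
Context (R : realType) (N m n : nat) (f : 'rV[R]_N -> 'M[R]_(m, n)).
Context (x0 : 'rV[R]_N) (r C : R).
Local Notation B := (cball x0 r).
Hypotheses (fC : C11 f x0 r C).
Hypotheses (DC : forall v, C11 (fun x => 'D_v f x) x0 r (C * `|v|)).

(** The analogue of [C11_ddiff] for first-order Taylor remainders. Each term has
    one more increment as a factor, which makes [step_remainder_diff] a bound of third
    order. *)
Lemma C11D_rem_diff x y h k : B x -> B (x + h) -> B y -> B (y + k) ->
  `|(f (x + h) - f x - 'D_h f x) - (f (y + k) - f y - 'D_k f y)| <=
  C * `|h| * `|h - k| + C * `|k| * (`|h - k| + (`|x - y| + `|h - k|) * `|k|).
Proof.
move=> xr xhr yr ykr; have dfB z : B z -> differentiable f z by move=> /fC[].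
have r0 : 0 <= r by exact: le_trans xr.
have C0 : 0 <= C by exact: C11_ge0 fC.
have algebra (a b c d e g : 'M[R]_(m, n)) :
  a - b - c - (d - e - g) = a - c - (d - g) - (b - e).
  by apply/matrixP => i j; rewrite !mxE; ring.
pose psi t := (f (x + t *: h) - t *: 'D_h f x) - (f (y + t *: k) - t *: 'D_k f y).
have -> : (f (x + h) - f x - 'D_h f x) - (f (y + k) - f y - 'D_k f y) =
    psi 1 - psi 0.
  by rewrite /psi !scale1r !scale0r !addr0 !subr0 algebra.
apply: (mvt_mx (dg := fun t => ('D_h f (x + t *: h) - 'D_h f x) -
  ('D_k f (y + t *: k) - 'D_k f y))) => t t01.
  apply: is_derive_sub; apply: is_derive_sub; try exact: is_derive_scale1.
    exact: is_derive_segment dfB xr xhr t01.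
  exact: is_derive_segment dfB yr ykr t01.
have xt := cball_convex t01 xr xhr; have yt := cball_convex t01 yr ykr.
have algebra2 (a b c d e g : 'M[R]_(m, n)) :
  a - b - (c - d) = (a - e - (b - g)) + (e - g - (c - d)).
  by apply/matrixP => i j; rewrite !mxE; ring.
have -> : 'D_h f (x + t *: h) - 'D_h f x - ('D_k f (y + t *: k) - 'D_k f y) =
    ('D_(h - k) f (x + t *: h) - 'D_(h - k) f x) +
    ('D_k f (x + t *: h) - 'D_k f x - ('D_k f (y + t *: k) - 'D_k f y)).
  have E1 := deriveBdir h k (dfB _ xt); have E2 := deriveBdir h k (dfB _ xr).
  by rewrite E1 E2; exact: algebra2.
have tle (v : 'rV[R]_N) : `|t *: v| <= `|v|.
  by case/andP: t01 => t0 t1; rewrite normrZ (ger0_norm t0) ler_piMl.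
apply: le_trans (ler_normD _ _) _; apply: lerD.
  have [_ _ _ /(_ _ (h - k) xr) H] := fC xt; apply: le_trans H _.
  rewrite mulrAC ler_wpM2r // ler_wpM2l // [x + _]addrC addrK; exact: tle.
apply: le_trans (C11_ddiff (DC k) xr xt yr yt) _.
rewrite ler_wpM2l ?mulr_ge0 // -scalerBr lerD ?tle // ler_pM ?addr_ge0 ?tle //.
by rewrite lerD2l tle.
Qed.

Lemma C11D_taylor3 x h : B x -> B (x + h) ->
  `|f (x + h) - f x - 'D_h f x - 2^-1 *: 'D_h (fun y => 'D_h f y) x|
  <= C * `|h| ^+ 3.
Proof.
move=> xr xhr; have dfB z : B z -> differentiable f z by move=> /fC[].
have r0 : 0 <= r by exact: le_trans xr.
have C0 : 0 <= C by exact: C11_ge0 fC.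
pose H := 'D_h (fun y => 'D_h f y) x.
pose psi t := (f (x + t *: h) - t *: 'D_h f x) - (2^-1 * t ^+ 2) *: H.
have -> : f (x + h) - f x - 'D_h f x - 2^-1 *: H = psi 1 - psi 0.
  rewrite /psi !scale1r !scale0r expr1n expr0n /= mulr0 mulr1 scale0r addr0 !subr0.
  by rewrite [in RHS]addrAC; congr (_ - _); rewrite addrAC.
apply: (mvt_mx (dg := fun t => ('D_h f (x + t *: h) - 'D_h f x) - t *: H)) => t t01.
  apply: is_derive_sub.
    apply: is_derive_sub; last exact: is_derive_scale1.
    exact: is_derive_segment dfB xr xhr t01.
  have dq : is_derive t 1 ((2^-1 : R) *: (id ^+ 2 : R -> R)) t.
    apply: is_derive_eq.
    by rewrite /GRing.scale /= expr1 mulr1 mulKf // pnatr_eq0.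
  exact: is_derive_Zl dq.
have xt := cball_convex t01 xr xhr.
have := C11_taylor (DC h) xr xt.
rewrite (deriveZdir _ _ _) -/H; last by have [] := DC h xr.
move=> K; apply: le_trans K _.
have -> : C * `|h| ^+ 3 = C * `|h| * `|h| ^+ 2 by ring.
rewrite ler_wpM2l ?mulr_ge0 // lerXn2r ?nnegrE // normrZ.
by case/andP: t01 => t0 t1; rewrite (ger0_norm t0) ler_piMl.
Qed.

(** The second difference of [f] over the parallelogram with sides [e v] and [e w]
    is [e^2] times a second derivative, up to [e^3]. *)
Lemma C11D_cross x v w (e : R) : 0 <= e ->
  `|x - x0| + e * (`|v| + `|w|) <= r ->
  `|f (x + e *: w + e *: v) - f (x + e *: w) - (f (x + e *: v) - f x)
    - e ^+ 2 *: 'D_w (fun y => 'D_v f y) x|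
  <= C * e ^+ 3 * (`|v| * `|w| * (`|v| + `|w|)).
Proof.
move=> e0 xr; have dfB z : B z -> differentiable f z by move=> /fC[].
have inB s t : 0 <= s <= 1 -> 0 <= t <= 1 ->
    B (x + s *: (e *: w) + t *: (e *: v)).
  move=> /andP[s0 s1] /andP[t0 t1]; rewrite /cball /=; apply: le_trans xr.
  have -> : x + s *: (e *: w) + t *: (e *: v) - x0 =
    (x - x0) + (t *: (e *: v) + s *: (e *: w)).
    by rewrite -[LHS]addrA addrAC -!addrA; congr (_ + _);
      rewrite [LHS]addrC -addrA; congr (_ + _); rewrite addrC.
  rewrite (le_trans (ler_normD _ _)) // lerD2l (le_trans (ler_normD _ _)) //.
  rewrite mulrDr !normrZ (ger0_norm e0) (ger0_norm t0) (ger0_norm s0).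
  by apply: lerD; rewrite ler_piMl // mulr_ge0.
have i01 : (0 : R) <= (1 : R) <= (1 : R) by rewrite ler01 lexx.
have i00 : (0 : R) <= (0 : R) <= (1 : R) by rewrite ler01 lexx.
have inB0 t : 0 <= t <= 1 -> B (x + t *: (e *: v)).
  by move=> t01; have := inB 0 t i00 t01; rewrite scale0r addr0.
have inB1 t : 0 <= t <= 1 -> B (x + e *: w + t *: (e *: v)).
  by move=> t01; have := inB 1 t i01 t01; rewrite scale1r.
have r0 : 0 <= r.
  by apply: le_trans xr; rewrite addr_ge0 // mulr_ge0 // addr_ge0.
have C0 : 0 <= C by exact: C11_ge0 fC.
set H := 'D_w (fun y => 'D_v f y) x.
pose psi t := f (x + e *: w + t *: (e *: v)) - f (x + t *: (e *: v))
  - t *: (e ^+ 2 *: H).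
have -> : f (x + e *: w + e *: v) - f (x + e *: w) - (f (x + e *: v) - f x)
    - e ^+ 2 *: H = psi 1 - psi 0.
  rewrite /psi !scale1r !scale0r !addr0 subr0.
  by move: (f _) (f _) (f _) (f _) => a b c d; apply/matrixP => i j; rewrite !mxE;
    ring.
have B0 : B x by have := inB0 0 i00; rewrite scale0r addr0.
have B1 : B (x + e *: w) by have := inB1 0 i00; rewrite scale0r addr0.
have B2 : B (x + e *: v) by have := inB0 1 i01; rewrite scale1r.
have B3 : B (x + e *: w + e *: v) by have := inB1 1 i01; rewrite scale1r.
apply: (mvt_mx (dg := fun t => ('D_(e *: v) f (x + e *: w + t *: (e *: v)) -
  'D_(e *: v) f (x + t *: (e *: v))) - e ^+ 2 *: H)) => t t01.
  apply: is_derive_sub; last exact: is_derive_scale1.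
  by apply: is_derive_sub; exact: (is_derive_segment dfB).
have bt := inB0 t t01; have bt1 := inB1 t t01.
set z := x + t *: (e *: v) in bt *.
have zE : x + e *: w + t *: (e *: v) = z + e *: w by rewrite addrAC.
rewrite zE in bt1 *.
have E1 := deriveZdir e v (dfB _ bt1); have E2 := deriveZdir e v (dfB _ bt).
rewrite E1 E2 {E1 E2} -scalerBr.
have -> : e *: ('D_v f (z + e *: w) - 'D_v f z) - e ^+ 2 *: H =
   e *: (('D_v f (z + e *: w) - 'D_v f z) - e *: H) by rewrite [RHS]scalerBr
     scalerA expr2.
have T := C11_taylor (DC v) bt bt1.
have dDv y : B y -> differentiable (fun y => 'D_v f y) y.
  by move=> By; have [] := DC v By.
have E1 := deriveZdir e w (dDv _ bt).
have [_ _ _ L] := DC v bt; have {}L := L x w B0.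
rewrite normrZ (ger0_norm e0).
have -> : C * e ^+ 3 * (`|v| * `|w| * (`|v| + `|w|)) =
   e * (C * `|v| * (e ^+ 2 * `|w| ^+ 2) + e * (C * `|v| * `|w| * (e * `|v|))).
  by ring.
rewrite ler_wpM2l //.
have algebra (a b c d : 'M[R]_(m, n)) : a - b - d = (a - b - c) + (c - d).
  by apply/matrixP => i j; rewrite !mxE; ring.
rewrite (algebra _ _ ('D_(e *: w) (fun y => 'D_v f y) z)).
apply: le_trans (ler_normD _ _) _; apply: lerD.
  by apply: le_trans T _; rewrite normrZ (ger0_norm e0) exprMn.
rewrite E1 -scalerBr normrZ (ger0_norm e0) ler_wpM2l //.
apply: le_trans L _; rewrite ler_wpM2l ?mulr_ge0 //.
rewrite /z [x + _]addrC addrK !normrZ (ger0_norm e0).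
by case/andP: t01 => t0 t1; rewrite (ger0_norm t0) ler_piMl // mulr_ge0.
Qed.

(** Schwarz' theorem: the second difference in [C11D_cross] is symmetric in the two
    sides of the parallelogram. *)
Lemma C11D_sym x v w : `|x - x0| < r ->
  'D_w (fun y => 'D_v f y) x = 'D_v (fun y => 'D_w f y) x.
Proof.
move=> xr; apply/eqP; rewrite -subr_eq0 -normr_eq0 eq_le normr_ge0 andbT.
have r0 : 0 <= r by exact: le_trans (ltW xr).
have C0 : 0 <= C by exact: C11_ge0 fC.
set a := `|v| + `|w|; have a0 : 0 <= a by rewrite addr_ge0.
set K := 2 * C * (`|v| * `|w| * a).
have K0 : 0 <= K by rewrite !mulr_ge0.
set D1 := 'D_w _ x; set D2 := 'D_v _ x.
have algebra (u q s p d1 d2 : 'M[R]_(m, n)) :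
    d1 - d2 = (u - q - (s - p) - d2) - (u - s - (q - p) - d1).
  by apply/matrixP => i j; rewrite !mxE; ring.
have main (e : R) : 0 < e -> `|x - x0| + e * a <= r -> `|D1 - D2| <= K * e.
  move=> e0 er.
  have A := C11D_cross (ltW e0) er.
  have er' : `|x - x0| + e * (`|w| + `|v|) <= r by rewrite addrC [X in X + _]mulrC
    addrC [_ * e]mulrC [`|w| + _]addrC.
  have B' := C11D_cross (ltW e0) er'.
  rewrite -(ler_pM2l (exprn_gt0 2 e0)) -{1}(ger0_norm (exprn_ge0 2 (ltW e0))).
  rewrite -normrZ scalerBr.
  rewrite [x + e *: v + e *: w]addrAC in B'.
  move: A B'; rewrite -/D1 -/D2.
  move: (f _) (f _) (f _) (f _) => p q s u A B'.
  rewrite (algebra u q s p).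
  apply: le_trans (ler_normB _ _) _; apply: le_trans (lerD B' A) _.
  rewrite /K /a le_eqVlt; apply/orP; left; apply/eqP; ring.
rewrite leNgt; apply/negP => D0.
set d := `|D1 - D2| in main D0 *.
pose e := Num.min ((r - `|x - x0|) / (a + 1)) (d / (2 * (K + 1))).
have e0 : 0 < e.
  by rewrite lt_min !divr_gt0 ?subr_gt0 // ?mulr_gt0 // ltr_wpDl.
have ea : `|x - x0| + e * a <= r.
  rewrite -lerBrDl; apply: (@le_trans _ _ (e * (a + 1))).
    by rewrite ler_wpM2l ?ltW // ltr_pwDr.
  by rewrite -ler_pdivlMr ?ltr_wpDl // ge_min lexx.
have := main e e0 ea; apply/negP; rewrite -ltNge.
apply: (@le_lt_trans _ _ ((K + 1) * e)).
  by rewrite ler_wpM2r ?ltW // ltr_pwDr.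
apply: (@le_lt_trans _ _ (d / 2)); last by lra.
rewrite mulrC -ler_pdivlMr ?ltr_wpDl // -mulrA -invfM ge_min lexx orbT //.
Qed.

End C11D_estimates.

(** * Distance to a submanifold and tangent vectors *)

Lemma continuous_dist (R : realType) (V : normedModType R) (x0 : V) :
  continuous (fun x => `|x - x0|).
Proof.
by move=> x; apply: cvg_norm; apply: cvgB; [exact: cvg_id|exact: cvg_cst].
Qed.

Lemma continuous_penalized (R : realType) (V W : normedModType R) (F : V -> W)
    (c : R) (y z : V) : {for z, continuous F} ->
  {for z, continuous (fun z => `|F z| + c * `|z - y|)}.
Proof.
move=> cF; apply: cvgD; first exact: cvg_norm.
by apply: cvgM; [exact: cvg_cst|exact: continuous_dist].
Qed.

Lemma cball_compact (R : realType) (N : nat) (x0 : 'rV[R]_N) (r : R) :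
  compact (cball x0 r).
Proof.
apply: bounded_closed_compact.
  exists (`|x0| + r); split; first exact: num_real.
  move=> M xM x xr; apply: le_trans (ltW xM).
  by rewrite -[x](subrKC x0) (le_trans (ler_normD _ _)) // lerD2l.
rewrite (_ : cball x0 r = (fun x => `|x - x0|) @^-1` [set t | t <= r]) //.
apply: closed_comp; last exact: closed_le.
by move=> x _; exact: (@continuous_dist R 'rV[R]_N).
Qed.

Section submanifold.
Context (R : realType) (N d : nat) (M : set 'rV[R]_N).

Lemma local_equation0 m U F : local_equation (d := d) M m U F ->
  forall x, U x -> M x <-> F x = 0.
Proof.
move=> [_ _ _ _ MU] x Ux; split => [Mx|Fx].
  have : (M `&` U) x by []. by rewrite MU => -[].
have : (M `&` U) x by rewrite MU. by case.
Qed.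

Lemma local_right_inverse m U (F : 'rV[R]_N -> 'rV[R]_(N - d)) :
  local_equation (d := d) M m U F ->
  exists (A : R) (L : 'rV[R]_(N - d) -> 'rV[R]_N), 0 <= A /\ forall w,
    'D_(L w) F m = w /\ `|L w| <= A * `|w|.
Proof.
move=> [Uo Um sF surj _].
have dF : differentiable F m by exact: smooth_differentiable sF Um.
have /choice[v vP] : forall k : 'I_(N - d), exists v, 'd F m v = delta_mx 0 k.
  by move=> k; exact: surj.
exists ((N - d)%:R * (\sum_k `|v k|)), (fun w => \sum_k w 0 k *: v k); split.
  by rewrite mulr_ge0 // sumr_ge0.
move=> w; split.
  rewrite deriveE // linear_sum [RHS]row_sum_delta; apply: eq_bigr => k _.
  by rewrite linearZ vP.
apply: row_entry_sum => k.
by rewrite (bigD1 k) //= lerDl sumr_ge0.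
Qed.

(** The point [y'] minimises [|F z| + lam |z - y|] on a ball around [m]. If [F z] were
    not zero at the minimiser [z], the Newton step [h = - L (F z)] would halve
    [|F z|] and raise the penalty by a quarter of [|F z|] at most. Comparing the
    minimum with the value at [y] gives the distance. *)
Lemma local_correction m U (F : 'rV[R]_N -> 'rV[R]_(N - d)) :
  M m -> local_equation (d := d) M m U F ->
  exists C r : R, [/\ 0 <= C, 0 < r, forall y, cball m r y -> U y &
    forall y, cball m r y -> exists y', M y' /\ `|y' - y| <= C * `|F y|].
Proof.
have aux (a b c e : R) :
  a <= 2^-1 * b -> c <= e + 4^-1 * b -> 0 < b -> a + c < b + e by lra.
move=> Mm eqF; have [A [L [A0 LP]]] := local_right_inverse eqF.
have [Uo Um sF _ _] := eqF; have FM := local_equation0 eqF.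
have [K [r0 [K0 r00 rU FC]]] := smooth_C11 Uo Um sF.
(* On the ball of radius [rho], [F'] is close enough to [F'(m)] for the Newton step
   to halve [F]. *)
pose rho := Num.min r0 (6 * (K + 1) * (A + 1))^-1.
have K1 : 0 < K + 1 by rewrite ltr_wpDl.
have A1 : 0 < A + 1 by rewrite ltr_wpDl.
have rho0 : 0 < rho by rewrite lt_min r00 invr_gt0 !mulr_gt0.
have rhor0 : rho <= r0 by rewrite ge_min lexx.
have {}FC : C11 F m rho K by exact: C11W FC.
have {}rU y : cball m rho y -> U y by move=> yr; apply: rU; exact: le_trans rhor0.
have KrA : 3 * K * rho * A <= 2^-1.
  have rk : rho * (6 * (K + 1) * (A + 1)) <= 1.
    by rewrite -ler_pdivlMr ?mul1r ?ge_min ?lexx ?orbT // !mulr_gt0.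
  have : 3 * K * rho * A <= 2^-1 * (rho * (6 * (K + 1) * (A + 1))) by nra.
  by move=> H; apply: le_trans H _; rewrite ler_piMr // invr_ge0.
(* The Newton step has length at most [A |F z|]. *)
pose lam : R := (4 * (A + 1))^-1.
have lam0 : 0 < lam by rewrite invr_gt0 mulr_gt0.
have lamA : lam * A <= 4^-1.
  by rewrite /lam invfM -mulrA ler_piMr ?invr_ge0 // mulrC ler_pdivrMr // mul1r lerDl.
clearbody lam rho.
have ilam0 : 0 <= lam^-1 by rewrite invr_ge0 ltW.
have m_in : cball m rho m by rewrite /cball /= subrr normr0 ltW.
have Fm : F m = 0 by apply/FM.
have FK y : cball m rho y -> `|F y| <= K * `|y - m|.
  by move=> yr; have := C11_lip FC yr m_in; rewrite Fm subr0.
have D0 : 0 < 1 + K / lam + A * K.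
  by rewrite -addrA ltr_wpDr // addr_ge0 ?mulr_ge0.
(* Both the minimiser and its image under a Newton step stay in the ball of radius
   [rho]; see [rrho]. *)
pose r := rho / (1 + K / lam + A * K).
have r0' : 0 < r by rewrite divr_gt0.
have rrho : r + K * r / lam + A * K * r = rho.
  rewrite -[RHS](divfK (lt0r_neq0 D0)) -/r; ring.
have rle : r <= rho.
  have := mulr_ge0 (mulr_ge0 K0 (ltW r0')) ilam0.
  have := mulr_ge0 (mulr_ge0 A0 K0) (ltW r0').
  by move: rrho; lra.
exists lam^-1, r; split => //.
  by move=> y yr; apply: rU; exact: le_trans rle.
move=> y yr; have yrho : cball m rho y by exact: le_trans rle.
pose Phi (z : 'rV[R]_N) := `|F z| + lam * `|z - y|.
have cPhi : {within cball m rho, continuous Phi}.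
  apply: continuous_in_subspaceT => z; rewrite inE => zr.
  apply: (@continuous_penalized R 'rV[R]_N 'rV[R]_(N - d)).
  by apply: differentiable_continuous; exact: smooth_differentiable sF (rU _ zr).
have seg0 : cball m rho !=set0 by exists m.
have [z zr zmin] := compact_EVT_min seg0 (@cball_compact _ _ m rho) cPhi.
rewrite inE in zr.
have zle : Phi z <= `|F y|.
  by have := zmin y; rewrite inE => /(_ yrho); rewrite /Phi subrr normr0 mulr0 addr0.
have Fy : `|F y| <= K * r by apply: le_trans (FK _ yrho) _; rewrite ler_wpM2l.
have zy : `|z - y| <= `|F y| / lam.
  by rewrite ler_pdivlMr // mulrC; apply: le_trans zle; rewrite lerDr.
have Fz : `|F z| <= `|F y| by apply: le_trans zle; rewrite lerDl mulr_ge0 // ltW.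
exists z; split; last by rewrite mulrC.
apply/FM; first exact: rU.
apply/eqP; rewrite -normr_le0 leNgt; apply/negP => Fz0.
have [LD LA] := LP (F z).
pose h := - L (F z).
have hA : `|h| <= A * `|F z| by rewrite normrN.
have zhr : cball m rho (z + h).
  rewrite /cball /=; have -> : z + h - m = h + (z - y) + (y - m).
    by rewrite -[RHS]addrA subrKA addrAC addrC.
  rewrite -rrho; apply: le_trans (ler_normD _ _) _; rewrite addrC -addrA;
    apply: lerD => //.
  apply: le_trans (ler_normD _ _) _; rewrite addrC; apply: lerD.
    by apply: (le_trans hA); rewrite -mulrA ler_wpM2l // (le_trans Fz).
  by apply: (le_trans zy); rewrite ler_wpM2r.
have hr : `|h| <= 2 * rho.
  have -> : h = (z + h - m) - (z - m) by rewrite opprB addrA subrK addrC addKr.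
  rewrite mulr2n mulrDl mul1r; apply: le_trans (ler_normB _ _) _; exact: lerD.
have T := C11_taylor FC zr zhr.
have [_ _ _ /(_ m h m_in) T2] := FC z zr.
have dFm : differentiable F m by exact: smooth_differentiable sF Um.
have DhF : 'D_h F m = - F z by rewrite deriveE // linearN -deriveE // LD.
have Fzh : `|F (z + h)| <= 2^-1 * `|F z|.
  have -> : F (z + h) = (F (z + h) - F z - 'D_h F z) + ('D_h F z - 'D_h F m).
    rewrite DhF opprK -[X in X - 'D_h F z]/(F (z + h) - F z).
    by move: (F (z + h)) ('D_h F z) (F z) => a b c; rewrite addrA subrK subrK.
  apply: le_trans (ler_normD _ _) _; apply: le_trans (lerD T T2) _.
  have h0 := normr_ge0 h. have zm0 : `|z - m| <= rho by [].
  apply: (@le_trans _ _ (3 * K * rho * `|h|)).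
    rewrite expr2; have : K * `|h| * `|h| <= K * `|h| * (2 * rho).
      by rewrite ler_wpM2l ?mulr_ge0.
    have : K * `|h| * `|z - m| <= K * `|h| * rho by rewrite ler_wpM2l ?mulr_ge0.
    move=> H1 H2; rewrite mulrA.
    have -> : 3 * K * rho * `|h| = K * `|h| * (2 * rho) + K * `|h| * rho by ring.
    exact: lerD.
  apply: (@le_trans _ _ (3 * K * rho * A * `|F z|)).
    by rewrite -[leRHS]mulrA ler_wpM2l // !mulr_ge0 // ltW.
  by rewrite ler_wpM2r.
have := zmin (z + h); rewrite inE => /(_ zhr); apply/negP; rewrite -ltNge /Phi.
have zhy : `|z + h - y| <= `|z - y| + A * `|F z|.
  by rewrite addrAC (le_trans (ler_normD _ _)) // lerD2l.
have : lam * `|z + h - y| <= lam * `|z - y| + 4^-1 * `|F z|.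
  apply: le_trans (ler_wpM2l (ltW lam0) zhy) _; rewrite mulrDr lerD2l mulrA.
  by rewrite ler_wpM2r.
by move=> H; exact: aux Fzh H Fz0.
Qed.

(** The point [m + t v] is at distance [o(t)] from [M] by [local_correction], and [h]
    vanishes on [M]; divide by [t]. As a consequence, derivatives along tangent
    vectors depend on the values on [M] only, and so does [tderiv]. *)
Lemma tangent_vanish (W : normedModType R) (h : 'rV[R]_N -> W) m v U' :
  open U' -> U' m -> differentiable h m -> M m ->
  (forall x, M x -> U' x -> h x = 0) -> tangent d M m v -> 'D_v h m = 0.
Proof.
move=> Uo' Um' dh Mm hM [U [F [eqF Fv]]].
have [C [r [C0 r0 rU corr]]] := local_correction Mm eqF.
have [Uo Um sF _ _] := eqF.
have dF : differentiable F m by exact: smooth_differentiable sF Um.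
have Fm : F m = 0 by apply/(local_equation0 eqF).
have hm : h m = 0 by exact: hM.
have /near_norm[r1 [r10 rU']] : \forall x \near m, U' x by exact: open_nbhs_nbhs.
have dhc : continuous ('d h m) by exact: diff_continuous.
have [k [k0 kP]] : exists k : R, 0 < k /\ forall x, `|'d h m x| <= k * `|x|.
  have /linear_boundedP kP : bounded_near ('d h m) (nbhs 0).
    by apply: continuous_linear_bounded; exact: dhc.
  near +oo_R => k; exists k; split; near: k; last exact: kP.
  exact: nbhs_pinfty_gt.
rewrite deriveE //; apply/eqP; rewrite -normr_le0; apply/ler_addgt0Pl => c c0.
rewrite addr0.
pose Q := k * (C * `|v|) + (`|v| + C * `|v|).
have Q0 : 0 <= Q by rewrite !addr_ge0 ?mulr_ge0 // ltW.
pose e := Num.min 1 (c / (Q + 1)).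
have Q1 : 0 < Q + 1 by rewrite ltr_wpDl.
have e0 : 0 < e by rewrite lt_min ltr01 divr_gt0.
have [d1 [d10 FP]] := differentiable_eps dF e0.
have [d2 [d20 hP]] := differentiable_eps dh e0.
pose b := `|v| + C * `|v| + 1.
have b0 : 0 < b by rewrite ltr_wpDl // addr_ge0 // mulr_ge0.
pose t := Num.min (Num.min r d1) (Num.min r1 d2) / (2 * b).
have tm : 0 < Num.min (Num.min r d1) (Num.min r1 d2).
  by rewrite !lt_min r0 d10 r10 d20.
have t0 : 0 < t by rewrite divr_gt0 // mulr_gt0.
have tb : t * b < Num.min (Num.min r d1) (Num.min r1 d2).
  rewrite /t invfM mulrA mulrVK ?unitfE ?gt_eqF //.
  by rewrite ltr_pdivrMr // ltr_pMr // ltr1n.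
move: tb; rewrite !lt_min => /andP[/andP[tr td1] /andP[tr1 td2]].
have tv : `|t *: v| = t * `|v| by rewrite normrZ (gtr0_norm t0).
have tvb : `|m + t *: v - m| <= t * b.
  rewrite addrC addKr tv ler_wpM2l ?(ltW t0) // /b -addrA lerDl.
  by rewrite addr_ge0 // mulr_ge0.
have [|y' [My' y'P]] := corr (m + t *: v).
  by rewrite /cball /=; apply: le_trans tvb (ltW tr).
have Fy : `|F (m + t *: v)| <= e * (t * `|v|).
  have := FP (m + t *: v) (le_lt_trans tvb td1).
  by rewrite Fm subr0 [m + _]addrC addrK linearZ /= Fv scaler0 subr0 tv.
have e1 : e <= 1 by rewrite ge_min lexx.
have y'v : `|y' - (m + t *: v)| <= e * (t * (C * `|v|)).
  apply: le_trans y'P _; apply: le_trans (ler_wpM2l C0 Fy) _.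
  by rewrite le_eqVlt; apply/orP; left; apply/eqP; ring.
have y'm : `|y' - m| <= t * (`|v| + C * `|v|).
  have -> : y' - m = t *: v + (y' - (m + t *: v)) by rewrite [- (m + _)]opprD
    addrCA [- m - _]addrC [t *: v + _]addrA subrr add0r.
  rewrite mulrDr (le_trans (ler_normD _ _)) // tv lerD2l (le_trans y'v) //.
  by rewrite ler_piMl // (mulr_ge0 (ltW t0)) // mulr_ge0.
have y'b : `|y' - m| < t * b.
  by apply: le_lt_trans y'm _; rewrite ltr_pM2l // ltrDl.
have hy' : `|'d h m (y' - m)| <= e * `|y' - m|.
  have := hP y' (lt_trans y'b td2).
  by rewrite hm hM // ?subrr ?sub0r ?normrN //; exact/rU'/(lt_trans y'b).
have : t * `|'d h m v| <= t * (e * Q).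
  rewrite -{1}(gtr0_norm t0) -normrZ -linearZ /=.
  have -> : t *: v = (y' - m) - (y' - (m + t *: v)).
    by rewrite opprB addrC addrA addrNK addrC addKr.
  rewrite linearB /= (le_trans (ler_normB _ _)) //.
  apply: (@le_trans _ _ (e * (t * (`|v| + C * `|v|)) + k * (e * (t * (C * `|v|))))).
    apply: lerD; first by apply: (le_trans hy'); rewrite ler_wpM2l // ltW.
    by apply: (le_trans (kP _)); rewrite ler_wpM2l // ltW.
  by rewrite /Q le_eqVlt; apply/orP; left; apply/eqP; ring.
rewrite ler_pM2l // => H; apply: (le_trans H).
apply: (@le_trans _ _ (c / (Q + 1) * Q)).
  by rewrite ler_wpM2r // ge_min lexx orbT.
by rewrite mulrAC ler_pdivrMr // ler_wpM2l ?(ltW c0) // lerDl.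
Unshelve. all: by end_near. Qed.

Lemma tangent_equation m U F v : M m -> local_equation (d := d) M m U F ->
  tangent d M m v -> 'D_v F m = 0.
Proof.
move=> Mm eqF tv; have [Uo Um sF _ _] := eqF.
apply: (tangent_vanish Uo Um _ Mm _ tv).
  exact: smooth_differentiable sF Um.
by move=> x Mx Ux; apply/(local_equation0 eqF).
Qed.

End submanifold.

(** * Paths following an approximate flow *)

Lemma closed_norm_le (R : realType) (V : normedModType R) (T : topologicalType)
    (f g : T -> V) (c : R) : continuous f -> continuous g ->
  closed [set y | `|f y - g y| <= c].
Proof.
move=> cf cg; apply: (@closed_comp _ _ (fun y => `|f y - g y|) [set x | x <= c]).
  by move=> y _; apply: cvg_norm; apply: cvgB; [exact: cf|exact: cg].
exact: closed_le.
Qed.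

Lemma subn_split (i j k m : nat) : (i <= k)%N -> (k < j)%N -> (j - i <= m.+1)%N ->
  (k - i <= m)%N /\ (j - k.+1 <= m)%N.
Proof. by lia. Qed.

Lemma half_split (R : realType) (x y z : R) : x + y <= z -> z / 2 < x -> y <= z / 2.
Proof. by lra. Qed.

Lemma cluster_norm_le (R : realType) (V : normedModType R) (T : topologicalType)
    (F : set_system T) (f g : T -> V) (c : R) (x : T) :
  cluster F x -> continuous f -> continuous g ->
  F [set y | `|f y - g y| <= c] -> `|f x - g x| <= c.
Proof.
rewrite clusterE => Fx cf cg Fc; apply: (closed_norm_le cf cg); exact: Fx.
Qed.

(** [D s t] is an approximate flow, such as one step of a numerical scheme. [W]
    stands for a power of the control with exponent above one, and [W_half] is what
    is retained of this. From a point of [G] there is a step into [S] at distance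
    [C1 W] of the step of [D], and [G_stable] says that the points of [S] which are
    close enough to [D a t x0] lie in [G], so that the scheme can go on. *)
Section Davie.
Context (R : realType) (V : normedModType R) (a b : R).
Context (om W : R -> R -> R) (q0 : R).
Hypothesis ab : a <= b.
Hypothesis om_ge0 : forall s t, a <= s -> s <= t -> t <= b -> 0 <= om s t.
Hypothesis om_diag : forall s, a <= s <= b -> om s s = 0.
Hypothesis om_super : forall s u t, a <= s -> s <= u -> u <= t -> t <= b ->
  om s u + om u t <= om s t.
Hypothesis W_half : forall s t s' t', a <= s' -> s' <= s -> s <= t -> t <= t' ->
  t' <= b -> om s t <= om s' t' / 2 -> W s t <= q0 * W s' t'.
Hypothesis W_mono : forall s t s' t', a <= s' -> s' <= s -> s <= t -> t <= t' ->
  t' <= b -> W s t <= W s' t'.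
Hypothesis W_ge0 : forall s t, a <= s -> s <= t -> t <= b -> 0 <= W s t.

Variables (D : R -> R -> V -> V) (G S : set V) (L C1 C2 K : R).
Hypotheses (L0 : 0 <= L) (K0 : 0 <= K) (C10 : 0 <= C1) (C20 : 0 <= C2).
Hypothesis KE : K * q0 * (1 + L ^+ 2) + (L * C1 + L * C2 + C2) <= K.
Hypothesis D_id : forall s x, a <= s <= b -> D s s x = x.
Hypothesis D_lip : forall s t x y, a <= s -> s <= t -> t <= b ->
  `|D s t x - D s t y| <= L * `|x - y|.
Hypothesis D_defect : forall s u t x, a <= s -> s <= u -> u <= t -> t <= b ->
  G x -> `|D u t (D s u x) - D s t x| <= C2 * W s t.

(** The pivot of Davie's induction: after removal of one step, both remaining
    parts carry at most half of the control. *)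
Lemma split_index (t : nat -> R) (i j : nat) :
  (forall k l, (k <= l)%N -> t k <= t l) -> (forall k, a <= t k <= b) ->
  (i < j)%N -> exists k, [/\ (i <= k < j)%N,
    om (t i) (t k) <= om (t i) (t j) / 2 &
    om (t k.+1) (t j) <= om (t i) (t j) / 2].
Proof.
move=> tmono tab ij.
have at_ k : a <= t k by case/andP: (tab k).
have tb k : t k <= b by case/andP: (tab k).
have hij : 0 <= om (t i) (t j) / 2.
  by rewrite divr_ge0 //; apply: om_ge0 => //; exact/tmono/ltnW.
pose P k := (i <= k < j)%N && (om (t i) (t k) <= om (t i) (t j) / 2).
have exP : exists k, P k.
  by exists i; rewrite /P leqnn ij /= om_diag.
have ubP k : P k -> (k <= j)%N by case/andP => /andP[_ /ltnW].
case: (ex_maxnP exP ubP) => k /andP[/andP[ik kj] kom] kmax.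
exists k; split => //; first by rewrite ik.
move: kj; rewrite leq_eqVlt => /orP[/eqP->|kj]; first by rewrite om_diag.
have ikS : (i <= k.+1)%N by rewrite (leq_trans ik).
have : ~~ P k.+1 by apply/negP => /kmax; rewrite ltnn.
rewrite /P ikS kj /= -ltNge => H.
exact: half_split (om_super (at_ i) (tmono _ _ ikS) (tmono _ _ (ltnW kj)) (tb j)) H.
Qed.

(** Induction on the number of steps, cutting at [split_index]. Each half is
    bounded by [K q0 W], and composing the pieces with the flow costs Lipschitz
    factors [L], one crossing step and two defects; [KE] says that the sum is at
    most [K W]. *)
Lemma discrete_davie (t : nat -> R) (x : nat -> V) (n : nat) :
  (forall k l, (k <= l)%N -> t k <= t l) -> (forall k, a <= t k <= b) ->
  (forall i, (i < n)%N -> G (x i)) ->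
  (forall i, (i < n)%N ->
     `|x i.+1 - D (t i) (t i.+1) (x i)| <= C1 * W (t i) (t i.+1)) ->
  forall i j, (i <= j <= n)%N ->
     `|x j - D (t i) (t j) (x i)| <= K * W (t i) (t j).
Proof.
move=> tmono tab xG xstep i j ijn.
have at_ k : a <= t k by case/andP: (tab k).
have tb k : t k <= b by case/andP: (tab k).
have [m mE] : exists m, (j - i <= m)%N by exists (j - i)%N.
elim: m i j mE ijn => [|m IH] i j mE /andP[ij jn].
  have -> : j = i by apply/eqP; rewrite eqn_leq ij andbT -subn_eq0 -leqn0.
  by rewrite D_id // subrr normr0 mulr_ge0 // W_ge0.
move: ij; rewrite leq_eqVlt => /orP[/eqP<-|ij].
  by rewrite D_id // subrr normr0 mulr_ge0 // W_ge0.
have [k [/andP[ik kj] om1 om2]] := split_index tmono tab ij.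
have tik := tmono _ _ ik; have tkk := tmono _ _ (leqnSn k).
have tkj := tmono _ _ kj; have tij := tmono _ _ (ltnW ij).
have tikS : t i <= t k.+1 by exact: le_trans tkk.
have tkj' : t k <= t j by exact: le_trans tkj.
set w := W (t i) (t j).
have [mE1 mE2] := subn_split ik kj mE.
have E1 : `|x k - D (t i) (t k) (x i)| <= K * (q0 * w).
  apply: le_trans (IH i k _ _) _.
  - exact: mE1.
  - by rewrite ik (leq_trans (ltnW kj)).
  - by rewrite ler_wpM2l // W_half.
have E2 : `|x j - D (t k.+1) (t j) (x k.+1)| <= K * (q0 * w).
  apply: le_trans (IH k.+1 j _ _) _.
  - exact: mE2.
  - by rewrite kj.
  - by rewrite ler_wpM2l // W_half.
have E3 : `|x k.+1 - D (t k) (t k.+1) (x k)| <= C1 * w.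
  have H := xstep k (leq_trans kj jn); apply: (le_trans H).
  by rewrite ler_wpM2l // W_mono.
have iG : G (x i) by apply: xG; exact: leq_trans jn.
have E4 := D_defect (at_ i) tik tkk (tb k.+1) iG.
have E5 := D_defect (at_ i) tikS tkj (tb j) iG.
have -> : x j - D (t i) (t j) (x i) =
  (x j - D (t k.+1) (t j) (x k.+1))
  + ((D (t k.+1) (t j) (x k.+1) - D (t k.+1) (t j) (D (t i) (t k.+1) (x i)))
  + (D (t k.+1) (t j) (D (t i) (t k.+1) (x i)) - D (t i) (t j) (x i))).
  by rewrite !subrKA.
have E6 : `|x k.+1 - D (t i) (t k.+1) (x i)| <=
    C1 * w + (L * (K * (q0 * w)) + C2 * w).
  have -> : x k.+1 - D (t i) (t k.+1) (x i) =
    (x k.+1 - D (t k) (t k.+1) (x k)) +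
    ((D (t k) (t k.+1) (x k) - D (t k) (t k.+1) (D (t i) (t k) (x i))) +
     (D (t k) (t k.+1) (D (t i) (t k) (x i)) - D (t i) (t k.+1) (x i))).
    by rewrite !subrKA.
  rewrite (le_trans (ler_normD _ _)) // lerD // (le_trans (ler_normD _ _)) //.
  apply: lerD; first by rewrite (le_trans (D_lip _ _ _ _ _)) // ler_wpM2l.
  by apply: (le_trans E4); rewrite ler_wpM2l // W_mono.
rewrite (le_trans (ler_normD _ _)) //.
apply: (@le_trans _ _ (K * (q0 * w) +
    (L * (C1 * w + (L * (K * (q0 * w)) + C2 * w)) + C2 * w))).
  apply: lerD => //; rewrite (le_trans (ler_normD _ _)) //; apply: lerD => //.
  by rewrite (le_trans (D_lip _ _ _ _ _)) // ler_wpM2l.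
have -> : K * (q0 * w) + (L * (C1 * w + (L * (K * (q0 * w)) + C2 * w)) + C2 * w)
   = (K * q0 * (1 + L ^+ 2) + (L * C1 + L * C2 + C2)) * w by ring.
by rewrite ler_wpM2r // W_ge0.
Qed.

Hypothesis D_step : forall s t x, a <= s -> s <= t -> t <= b -> G x ->
  exists y, S y /\ `|y - D s t x| <= C1 * W s t.
Variable x0 : V.
Hypothesis G_x0 : G x0.
Hypothesis G_stable : forall t y, a <= t <= b -> S y ->
  `|y - D a t x0| <= K * W a t -> G y.

Lemma discrete_scheme (t : nat -> R) :
  (forall k l, (k <= l)%N -> t k <= t l) -> (forall k, a <= t k <= b) -> t 0 = a ->
  exists x : nat -> V, [/\ x 0 = x0, forall i, G (x i) &
    forall i j, (i <= j)%N -> `|x j - D (t i) (t j) (x i)| <= K * W (t i) (t j)].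
Proof.
move=> tmono tab t0.
have /choice[f fP] : forall z : nat * V, exists y, G z.2 ->
    S y /\ `|y - D (t z.1) (t z.1.+1) z.2| <= C1 * W (t z.1) (t z.1.+1).
  move=> [i x] /=; have [Gx|nGx] := pselect (G x); last by exists x.
  have [||y Sy] := @D_step (t i) (t i.+1) x _ (tmono _ _ (leqnSn i)) _ Gx.
  - by case/andP: (tab i).
  - by case/andP: (tab i.+1).
  by exists y.
pose x := fix x i := if i is i'.+1 then f (i', x i') else x0.
have xG n : forall i, (i <= n)%N -> G (x i).
  elim: n => [|n IH] i; first by rewrite leqn0 => /eqP->.
  rewrite leq_eqVlt => /orP[/eqP->|]; last exact: IH.
  have [Sx _] := fP (n, x n) (IH _ (leqnn n)).
  apply: (@G_stable (t n.+1)) => //; rewrite -{1 2}t0.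
  have sG i' : (i' < n.+1)%N -> G (x i') by rewrite ltnS; exact: IH.
  have sD i' : (i' < n.+1)%N ->
      `|x i'.+1 - D (t i') (t i'.+1) (x i')| <= C1 * W (t i') (t i'.+1).
    by move=> /sG Gx; have [] := fP (i', x i') Gx.
  have n0 : (0 <= n.+1 <= n.+1)%N by rewrite leqnn.
  exact: discrete_davie tmono tab sG sD 0 n.+1 n0.
have {}xG i : G (x i) by exact: xG (leqnn i).
exists x; split => // i j ij.
apply: (@discrete_davie t x j) => // [i' _|]; last by rewrite ij leqnn.
by have [] := fP (i', x i') (xG i').
Qed.

Lemma finite_scheme (s : seq R) : (forall r, r \in s -> a <= r <= b) ->
  exists X : R -> V, [/\ X a = x0, forall r, G (X r) &
    forall r r', r \in s -> r' \in s -> r <= r' ->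
      `|X r' - D r r' (X r)| <= K * W r r'].
Proof.
move=> sab; pose ts := a :: sort <=%R s.
have tsS : sorted <=%R ts.
  rewrite /= path_min_sorted ?sort_le_sorted //.
  by apply/allP => r; rewrite mem_sort => /sab/andP[].
have mts r : (r \in ts) = (r == a) || (r \in s) by rewrite inE mem_sort.
have tsab r : r \in ts -> a <= r <= b.
  by rewrite mts => /orP[/eqP->|/sab//]; rewrite lexx.
pose t i := nth b ts i.
have tab i : a <= t i <= b.
  have [/(mem_nth b)/tsab//|] := ltnP i (size ts).
  by move=> /(nth_default b); rewrite /t => ->; rewrite ab lexx.
have tmono k l : (k <= l)%N -> t k <= t l.
  move=> kl; have [ls|/(nth_default b)] := ltnP l (size ts); last first.
    by rewrite /t => ->; case/andP: (tab k).
  apply: (sorted_leq_nth le_trans lexx b tsS) => //.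
  by rewrite inE (leq_ltn_trans kl).
have [x [xx0 xG xD]] := discrete_scheme tmono tab (erefl _ : t 0 = a).
(* The index of a time outside of [ts] is the size of [ts], where [x] is defined too. *)
exists (fun r => x (index r ts)); split => // [|r r' rs rs' rr'].
  by rewrite /ts /= eqxx.
have rts : r \in ts by rewrite mts rs orbT.
have rts' : r' \in ts by rewrite mts rs' orbT.
have := xD (index r ts) (index r' ts).
rewrite /t !nth_index //; apply; rewrite leqNgt; apply/negP => lt.
have r'r := sorted_ltn_index le_trans tsS _ _ rts' rts lt.
have E : r = r' by apply/eqP; rewrite eq_le rr'.
by rewrite E ltnn in lt.
Qed.

Hypothesis G_compact : compact G.

Lemma D_continuous s t : a <= s -> s <= t -> t <= b -> continuous (D s t).
Proof.
move=> as_ st tb x; apply/cvgrPdist_le => e e0; apply/near_norm.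
exists (e / (L + 1)); split; first by rewrite divr_gt0 // ltr_wpDl.
move=> y yx; apply: le_trans (D_lip _ _ as_ st tb) _.
apply: (@le_trans _ _ ((L + 1) * `|x - y|)).
  by rewrite ler_wpM2r // lerDl.
by rewrite mulrC -ler_pdivlMr ?ltr_wpDl // distrC ltW.
Qed.

(** Finite sets of times are directed by inclusion and each of them is served by
    [finite_scheme]. By Tychonoff's theorem these paths have a cluster point in
    the topology of pointwise convergence; the bound for two given times is a
    closed condition satisfied as soon as both times belong to the finite set. *)
Lemma davie_existence : exists X : R -> V, [/\ X a = x0,
  forall r, G (X r) &
  forall r r', a <= r -> r <= r' -> r' <= b ->
    `|X r' - D r r' (X r)| <= K * W r r'].
Proof.
pose good (s : seq R) (X : R -> V) := [/\ X a = x0, forall r, G (X r) &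
  forall r r', r \in s -> r' \in s -> r <= r' ->
      `|X r' - D r r' (X r)| <= K * W r r'].
pose F : set_system (prod_topology (fun _ : R => V)) :=
  fun P => exists s : seq R, (forall r, r \in s -> a <= r <= b) /\
    (forall X, good s X -> P X).
have FF : ProperFilter F.
  split; last split.
  - by move=> [s [sab]]; have [X XP] := finite_scheme sab; move=> /(_ X XP).
  - by exists nil.
  - move=> P Q [s [sab sP]] [s' [sab' sQ]]; exists (s ++ s'); split.
      by move=> r; rewrite mem_cat => /orP[/sab|/sab'].
    move=> X [X0 XG XD]; split; [apply: sP|apply: sQ]; split => // r r' rs rs'.
      by apply: XD; rewrite mem_cat ?rs ?rs'.
    by apply: XD; rewrite mem_cat ?rs ?rs' orbT.
  - move=> P Q PQ [s [sab sP]]; exists s; split => // X /sP; exact: PQ.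
have [|X [XG Xcl]] := @tychonoff R (fun=> V) (fun=> G) (fun=> G_compact) F FF.
  by exists nil; split => // X [].
have evalc (r : R) : continuous (fun X : prod_topology (fun _ : R => V) => X r).
  exact: (@proj_continuous R (fun=> V) r).
exists X; split => //.
  apply/eqP; rewrite -subr_eq0 -normr_le0.
  apply: (cluster_norm_le Xcl (evalc a) (@cst_continuous _ _ x0)).
  by exists nil; split => // Y [Ya _ _]; rewrite /= Ya subrr normr0.
move=> r r' ar rr' r'b.
have cD : continuous (fun X : prod_topology (fun _ : R => V) => D r r' (X r)).
  move=> Y; apply: (@continuous_comp _ _ _
    (fun Y : prod_topology (fun _ : R => V) => Y r)); first exact: evalc.
  exact: D_continuous.
apply: (cluster_norm_le Xcl (evalc r') cD); exists [:: r; r']; split.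
  move=> c; rewrite !inE => /orP[|] /eqP->; rewrite ?ar ?r'b ?(le_trans ar) //.
  by rewrite (le_trans rr').
by move=> Y [_ _ YD]; apply: YD => //; rewrite !inE eqxx ?orbT.
Qed.

End Davie.

(** * Powers of a control *)

Lemma within_continuous_eps (R : realType) (V W : normedModType R) (D : set V)
    (f : V -> W) : {within D, continuous f} <->
  forall x, D x -> forall e : R, 0 < e ->
    exists d : R, 0 < d /\ forall y, D y -> `|y - x| < d -> `|f y - f x| <= e.
Proof.
rewrite subspace_continuousP; split => H x Dx.
  move=> e e0; have /cvgrPdist_le/(_ e e0) := H x Dx.
  rewrite /within /= => /near_norm[d [d0 dP]]; exists d; split => // y Dy yx.
  by rewrite distrC; exact: dP.
apply/cvgrPdist_le => e e0; have [d [d0 dP]] := H x Dx e e0.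
apply/near_norm; exists d; split => // y yx Dy; rewrite distrC; exact: dP.
Qed.

Lemma prod_norm_lt (R : realType) (x y u v d : R) :
  `|x - u| < d -> `|y - v| < d -> `|(x, y) - (u, v)| < d.
Proof. by move=> xu yv; rewrite /Num.Def.normr /= gt_max xu. Qed.

Section control.
Context (R : realType) (T p : R) (omega : R -> R -> R).
Hypotheses (p_ge2 : 2 <= p) (p_lt3 : p < 3).
Hypothesis omega_control : control T omega.

(** The size of the first level: a term of order [k] in the driver is of size
    [omw ^ k]. *)
Definition omw s t := omega s t `^ (1 / p).

Lemma p_gt0 : 0 < p. Proof. exact: lt_le_trans p_ge2. Qed.

Lemma omega_ge0 s t : 0 <= s -> s <= t -> t <= T -> 0 <= omega s t.
Proof.
have [_ _ om0 omp] := omega_control.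
move=> s0; rewrite le_eqVlt => /orP[/eqP<- sT|st tT]; first by rewrite om0 // s0.
exact/ltW/omp.
Qed.

Lemma omega_diag s : 0 <= s <= T -> omega s s = 0.
Proof. by have [_ _ om0 _] := omega_control; exact: om0. Qed.

Lemma omega_super s u t : 0 <= s -> s <= u -> u <= t -> t <= T ->
  omega s u + omega u t <= omega s t.
Proof. by have [_ oms _ _] := omega_control; exact: oms. Qed.

Lemma omega_mono s t s' t' : 0 <= s' -> s' <= s -> s <= t -> t <= t' -> t' <= T ->
  omega s t <= omega s' t'.
Proof.
move=> s0 ss st tt tT.
have s0' : 0 <= s by exact: le_trans ss.
have tT' : t <= T by exact: le_trans tT.
apply: (@le_trans _ _ (omega s' t)).
  apply: le_trans (omega_super s0 ss st tT'); rewrite lerDr.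
  by apply: omega_ge0 => //; exact: le_trans tT'.
have s't : s' <= t by exact: le_trans st.
apply: le_trans (omega_super s0 s't tt tT); rewrite lerDl.
by apply: omega_ge0 => //; exact: le_trans s't.
Qed.

Lemma omw_ge0 s t : 0 <= omw s t. Proof. exact: powR_ge0. Qed.

Lemma powR_omw (k : nat) s t : (0 < k)%N -> 0 <= omega s t ->
  omega s t `^ (k%:R / p) = omw s t ^+ k.
Proof.
move=> k0 om0; rewrite /omw -powR_mulrn ?powR_ge0 // -powRrM.
by congr (_ `^ _); rewrite mul1r mulrC.
Qed.

Lemma omw_mono s t s' t' : 0 <= s' -> s' <= s -> s <= t -> t <= t' -> t' <= T ->
  omw s t <= omw s' t'.
Proof.
move=> s0 ss st tt tT; apply: ge0_ler_powR.
- by rewrite divr_ge0 // ltW // p_gt0.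
- by rewrite nnegrE omega_ge0 ?(le_trans s0) ?(le_trans tt).
- by rewrite nnegrE omega_ge0 // (le_trans ss) // (le_trans st).
- exact: omega_mono.
Qed.

Lemma omw_diag s : 0 <= s <= T -> omw s s = 0.
Proof.
move=> sT; rewrite /omw omega_diag // powR0 //.
by rewrite mul1r invr_neq0 // gt_eqF // p_gt0.
Qed.

Lemma omw_gt0 s t : 0 <= s -> s < t -> t <= T -> 0 < omw s t.
Proof.
move=> s0 st tT; rewrite powR_gt0 //.
by have [_ _ _ omp] := omega_control; exact: omp.
Qed.

(** The factor by which [omega^(3/p)] shrinks when the control is halved. *)
Definition half_factor : R := 2^-1 `^ (3 / p).

Lemma half_factor_ge0 : 0 <= half_factor. Proof. exact: powR_ge0. Qed.

(** Here [p < 3] enters: halving a third-order quantity gains more than the factor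
    two lost by cutting an interval in two. *)
Lemma half_factor_lt : half_factor < 2^-1.
Proof.
have e0 : 0 < 3 / p - 1 by rewrite subr_gt0 ltr_pdivlMr ?p_gt0 // mul1r.
have h0 : 0 <= 2^-1 :> R by rewrite invr_ge0.
rewrite /half_factor -(subrK 1 (3 / p)) powRD;
  last by rewrite invr_eq0 pnatr_eq0 implybT.
rewrite powRr1 // -[ltRHS]mul1r ltr_pM2r ?invr_gt0 //.
have := @gt0_ltr_powR _ _ e0 2^-1 1; rewrite powR1; apply; rewrite ?nnegrE //.
by rewrite invf_lt1 // ltr1n.
Qed.

Lemma omw_half s t s' t' : 0 <= s' -> s' <= s -> s <= t -> t <= t' -> t' <= T ->
  omega s t <= omega s' t' / 2 -> omw s t ^+ 3 <= half_factor * omw s' t' ^+ 3.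
Proof.
move=> s0 ss st tt tT om.
have om0 : 0 <= omega s t by rewrite omega_ge0 ?(le_trans s0) ?(le_trans tt).
have om0' : 0 <= omega s' t' by rewrite omega_ge0 // (le_trans ss) // (le_trans st).
rewrite -!powR_omw // /half_factor -powRM // ?invr_ge0 // [2^-1 * _]mulrC.
by apply: ge0_ler_powR => //; rewrite ?nnegrE ?divr_ge0 // ltW // p_gt0.
Qed.

Lemma omega_eps t (e : R) : 0 <= t <= T -> 0 < e ->
  exists d : R, 0 < d /\ forall s u, 0 <= s -> s <= u -> u <= T ->
    `|s - t| < d -> `|u - t| < d -> omega s u <= e.
Proof.
move=> tT e0; have [cont _ _ _] := omega_control.
have tt : simplex T (t, t) by case/andP: tT => t0 tT'; split => //=.
have [d [d0 dP]] := (within_continuous_eps _ _).1 cont (t, t) tt e e0.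
exists d; split => // s u s0 su uT sd ud.
have := dP (s, u); rewrite /= omega_diag // subr0 => H.
apply: le_trans (ler_norm _) _; apply: H; first by split.
by rewrite /Num.Def.normr /= gt_max sd.
Qed.

Lemma omw_eps t (e : R) : 0 <= t <= T -> 0 < e ->
  exists d : R, 0 < d /\ forall s u, 0 <= s -> s <= u -> u <= T ->
    `|s - t| < d -> `|u - t| < d -> omw s u <= e.
Proof.
move=> tT e0; have [|d [d0 dP]] := @omega_eps t (e `^ p) tT _.
  by rewrite powR_gt0.
exists d; split => // s u s0 su uT sd ud; have H := dP s u s0 su uT sd ud.
have -> : e = (e `^ p) `^ (1 / p).
  by rewrite -powRrM mul1r mulfV ?powRr1 ?ltW // gt_eqF // p_gt0.
apply: ge0_ler_powR => //; rewrite ?nnegrE ?powR_ge0 ?omega_ge0 //.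
by rewrite divr_ge0 // ltW // p_gt0.
Qed.

(** Intermediate value theorem for [omega s], then superadditivity for the right
    half. *)
Lemma omega_midpoint s t : 0 <= s -> s <= t -> t <= T ->
  exists u, [/\ s <= u, u <= t, omega s u <= omega s t / 2 &
    omega u t <= omega s t / 2].
Proof.
move=> s0 st tT; have om0 := omega_ge0 s0 st tT.
have c : {within `[s, t], continuous (fun u => omega s u)}.
  apply/within_continuous_eps => u; rewrite /= in_itv /= => /andP[su ut] e e0.
  have [cont _ _ _] := omega_control.
  have tt : simplex T (s, u) by split => //=; exact: le_trans tT.
  have [d [d0 dP]] := (within_continuous_eps _ _).1 cont (s, u) tt e e0.
  exists d; split => // v; rewrite /= in_itv /= => /andP[sv vt] vu.
  apply: (dP (s, v)); first by split => //=; exact: le_trans tT.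
  by apply: prod_norm_lt; rewrite ?subrr ?normr0.
have sT : 0 <= s <= T by rewrite s0 (le_trans st).
have [|u] := IVT st c (v := omega s t / 2).
  rewrite omega_diag // min_l // max_r // divr_ge0 //= ler_pdivrMr //.
  by rewrite ler_peMr // ler1n.
rewrite in_itv /= => /andP[su ut] uE; exists u; split => //.
  by rewrite uE.
have := omega_super s0 su ut tT; rewrite uE.
by rewrite -lerBrDl {1}(splitr (omega s t)) addrK.
Qed.

(** A continuous positive function on the compact set of pairs at distance [d]. *)
Lemma omw_lower (d : R) : 0 < d ->
  exists c : R, 0 < c /\ forall s t, 0 <= s -> s + d <= t -> t <= T -> c <= omw s t.
Proof.
move=> d0; have [dT|Td] := leP d T; last first.
  exists 1; split => // s t s0 sdt tT; have := le_trans sdt tT.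
  by rewrite leNgt (lt_le_trans Td) // lerDr.
have c : {within [set` `[0, T - d]], continuous (fun u => omega u (u + d))}.
  apply/within_continuous_eps => u; rewrite /= in_itv /= => /andP[u0 uT] e e0.
  have [cont _ _ _] := omega_control.
  have tt : simplex T (u, u + d) by split => //=;
    [rewrite lerDl ltW|rewrite -lerBrDr].
  have [k [k0 kP]] := (within_continuous_eps _ _).1 cont (u, u + d) tt e e0.
  exists k; split => // v; rewrite /= in_itv /= => /andP[v0 vT] vu.
  apply: (kP (v, v + d)); first by split => //=; [rewrite lerDl ltW|rewrite -lerBrDr].
  by apply: prod_norm_lt; rewrite // opprD addrACA subrr addr0.
have K0 : [set` `[0, T - d]] !=set0 by exists 0; rewrite /= in_itv /= lexx subr_ge0.
have [u] := compact_EVT_min K0 (@segment_compact _ _ _) c.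
rewrite inE /= in_itv /= => /andP[u0 uT] umin.
have uTd : u + d <= T by rewrite -lerBrDr.
have udu : u < u + d by rewrite ltrDl.
exists (omw u (u + d)); split; first exact: omw_gt0.
move=> s t s0 sdt tT.
have ssd : s <= s + d by rewrite lerDl ltW.
have sdT : s + d <= T by exact: le_trans tT.
apply: (@le_trans _ _ (omw s (s + d))); last exact: omw_mono.
apply: ge0_ler_powR; rewrite ?nnegrE ?omega_ge0 // ?(ltW udu) //.
  by rewrite divr_ge0 // ltW // p_gt0.
by apply: umin; rewrite inE /= in_itv /= s0 lerBrDr.
Qed.

End control.

(** * From local bounds to global bounds *)

Section near_diagonal.
Context (R : realType) (T p : R) (omega : R -> R -> R).
Hypotheses (p_ge2 : 2 <= p) (p_lt3 : p < 3).
Hypothesis omega_control : control T omega.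
Context (V : normedModType R).
Local Notation w := (omw p omega).

Definition small_near (T0 : R) (k : nat) (g : R -> R -> V) (t : R) : Prop :=
  exists e C : R, 0 < e /\ forall s u, 0 <= s -> s <= u -> u <= T0 ->
    `|s - t| < e -> `|u - t| < e -> `|g s u| <= C * w s u ^+ k.

(** A Lebesgue number argument on the compact interval [0, T0]. *)
Lemma small_near_uniform (T0 : R) (k : nat) (g : R -> R -> V) :
  (forall t, 0 <= t <= T0 -> small_near T0 k g t) ->
  exists d C : R, [/\ 0 < d, 0 <= C & forall s u, 0 <= s -> s <= u -> u <= T0 ->
    u - s <= d -> `|g s u| <= C * w s u ^+ k].
Proof.
move=> loc.
pose P (r s : R) := forall u, s <= u -> u <= T0 -> u - s <= r ->
   `|g s u| <= r^-1 * w s u ^+ k.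
have cov := (near_covering_withinP _).2
  ((compact_near_coveringP _).1 (@segment_compact R 0 T0)).
have : \forall r \near 0^'+, [set` `[0, T0]] `<=` P r.
  apply: cov => t; rewrite /= in_itv /= => t0T.
  have [e [C [e0 eP]]] := loc t t0T.
  have e2 : 0 < e / 2 by rewrite divr_gt0.
  have nt : \forall s \near t, `|s - t| < e / 2.
    by apply/near_norm; exists (e / 2).
  near=> s r; rewrite in_itv /= => /andP[s0 sT] u su uT usr.
  have r0 : 0 < r by near: r; exact: nbhs_right_gt.
  have se : `|s - t| < e / 2 by near: s.
  have re : r <= e / 2 by near: r; apply: nbhs_right_le.
  have rC : r <= (`|C| + 1)^-1.
    by near: r; apply: nbhs_right_le; rewrite invr_gt0 ltr_wpDl.
  have set' : `|s - t| < e.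
    by apply: lt_trans se _; rewrite ltr_pdivrMr // ltr_pMr // ltr1n.
  have ut : `|u - t| < e.
    have -> : u - t = (s - t) + (u - s) by rewrite [RHS]addrC subrKA.
    rewrite (le_lt_trans (ler_normD _ _)) // [ltRHS]splitr ltr_leD //.
    by rewrite ger0_norm ?subr_ge0 //; exact: le_trans re.
  apply: (le_trans (eP s u s0 su uT set' ut)).
  rewrite ler_wpM2r ?exprn_ge0 ?omw_ge0 // (le_trans (ler_norm _)) //.
  apply: (@le_trans _ _ (`|C| + 1)); first by rewrite lerDl.
  by rewrite -[leLHS]invrK lef_pV2 // posrE ?invr_gt0 ltr_wpDl.
move=> H; near (0:R)^'+ => r.
have r0 : 0 < r by near: r; exact: nbhs_right_gt.
exists r, r^-1; split; rewrite ?invr_ge0 ?ltW // => s u s0 su uT usr.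
have PH : [set` `[0, T0]] `<=` P r by near: r.
by apply: PH => //; rewrite /= in_itv /= s0 (le_trans su).
Unshelve. all: by end_near. Qed.

(** Away from the diagonal [omw] is bounded below, so that a bounded function is
    bounded by any power of [omw] there. *)
Lemma near_diagonal_global (T0 : R) (g : R -> R -> V) (k : nat) (d C B : R) :
  T0 <= T -> 0 < d ->
  (forall s u, 0 <= s -> s <= u -> u <= T0 -> u - s <= d ->
    `|g s u| <= C * w s u ^+ k) ->
  (forall s u, 0 <= s -> s <= u -> u <= T0 -> `|g s u| <= B) ->
  exists C' : R, 0 <= C' /\ forall s u, 0 <= s -> s <= u -> u <= T0 ->
    `|g s u| <= C' * w s u ^+ k.
Proof.
move=> T0T d0 gC gB; have [c [c0 cP]] := omw_lower p_ge2 omega_control d0.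
exists (`|C| + `|B| / c ^+ k); split.
  by rewrite addr_ge0 // divr_ge0 // exprn_ge0 // ltW.
move=> s u s0 su uT; have w0 : 0 <= w s u ^+ k by rewrite exprn_ge0 ?omw_ge0.
have [usd|usd] := leP (u - s) d.
  apply: le_trans (gC s u s0 su uT usd) _; rewrite ler_wpM2r //.
  by rewrite (le_trans (ler_norm _)) // lerDl divr_ge0 // exprn_ge0 // ltW.
apply: le_trans (gB s u s0 su uT) _; apply: (le_trans (ler_norm _)).
apply: (@le_trans _ _ (`|B| / c ^+ k * w s u ^+ k)); last first.
  by rewrite ler_wpM2r // lerDr.
rewrite -mulrA ler_peMr // mulrC ler_pdivlMr ?exprn_gt0 // mul1r.
rewrite lerXn2r ?nnegrE ?omw_ge0 ?(ltW c0) //.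
by apply: cP => //; [rewrite addrC -lerBrDr ltW|exact: le_trans uT T0T].
Qed.

End near_diagonal.

(** The a priori bound by [C0] is improved again and again, and the constants tend to
    the fixed point [A / (1 - lam)] of [Q |-> lam Q + A]. *)
Lemma contraction_bound (R : realType) (X : Type) (D : X -> Prop) (r v : X -> R)
    (lam A C0 : R) : 0 <= lam < 1 -> 0 <= A -> 0 <= C0 ->
  (forall x, D x -> 0 <= v x) ->
  (forall x, D x -> r x <= C0 * v x) ->
  (forall Q, 0 <= Q -> (forall x, D x -> r x <= Q * v x) ->
     forall x, D x -> r x <= (lam * Q + A) * v x) ->
  forall x, D x -> r x <= A / (1 - lam) * v x.
Proof.
move=> /andP[l0 l1] A0 C00 v0 rC rQ.
have l1' : 0 < 1 - lam by rewrite subr_gt0.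
have main k x : D x -> r x <= (lam ^+ k * C0 + A / (1 - lam)) * v x.
  elim: k x => [|k IH] x Dx.
    rewrite expr0 mul1r (le_trans (rC x Dx)) // ler_wpM2r ?v0 // lerDl.
    by rewrite divr_ge0 // ltW.
  have Q0 : 0 <= lam ^+ k * C0 + A / (1 - lam).
    by rewrite addr_ge0 // ?(divr_ge0 A0) ?mulr_ge0 ?exprn_ge0 // ltW.
  have := rQ _ Q0 IH x Dx.
  have -> // : lam * (lam ^+ k * C0 + A / (1 - lam)) + A =
    lam ^+ k.+1 * C0 + A / (1 - lam).
  by rewrite exprS; field; rewrite gt_eqF.
move=> x Dx; apply/ler_addgt0Pr => e e0.
have : lam ^+ n @[n --> \oo] --> (0 : R) by apply: cvg_expr; rewrite ger0_norm.
move=> /cvgrPdist_le/(_ (e / (C0 * v x + 1)));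
  rewrite divr_gt0 // ?ltr_wpDl ?mulr_ge0 ?v0 //.
move=> /(_ isT) [k _ kP]; have := kP k (leqnn k).
rewrite sub0r normrN ger0_norm ?exprn_ge0 // => H.
apply: (le_trans (main k x Dx)); rewrite mulrDl addrC lerD2l.
apply: (@le_trans _ _ (e / (C0 * v x + 1) * (C0 * v x))).
  by rewrite -mulrA ler_wpM2r // mulr_ge0 // v0.
rewrite mulrAC ler_pdivrMr ?ltr_wpDl ?mulr_ge0 ?v0 //.
by rewrite ler_wpM2l ?lerDl // ltW.
Qed.

Lemma two_half_factor (R : realType) (p : R) : 2 <= p -> p < 3 ->
  0 <= 2 * half_factor p < 1.
Proof.
move=> p2 p3; rewrite mulr_ge0 ?half_factor_ge0 //= mulrC -ltr_pdivlMr //.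
by rewrite mul1r half_factor_lt.
Qed.

Section additive.
Context (R : realType) (T p : R) (omega : R -> R -> R).
Hypotheses (p_ge2 : 2 <= p) (p_lt3 : p < 3).
Hypothesis omega_control : control T omega.
Context (V : normedModType R).
Local Notation w := (omw p omega).

(** Cutting at the midpoint for the control turns a bound by [Q] into one by
    [2 * half_factor p * Q + B]. *)
Lemma halving_step (g : R -> R -> V) (a b Q B : R) : 0 <= a -> b <= T -> 0 <= Q ->
  (forall s u t, a <= s -> s <= u -> u <= t -> t <= b ->
     `|g s t - g s u - g u t| <= B * w s t ^+ 3) ->
  (forall s t, a <= s -> s <= t -> t <= b -> `|g s t| <= Q * w s t ^+ 3) ->
  forall s t, a <= s -> s <= t -> t <= b ->
    `|g s t| <= (2 * half_factor p * Q + B) * w s t ^+ 3.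
Proof.
move=> a0 bT Q0 gB gQ s t as_ st tb.
have s0 : 0 <= s by exact: le_trans as_.
have tT : t <= T by exact: le_trans bT.
have [u [su ut om1 om2]] := omega_midpoint omega_control s0 st tT.
have W1 := omw_half p_ge2 omega_control s0 (lexx s) su ut tT om1.
have W2 := omw_half p_ge2 omega_control s0 su ut (lexx t) tT om2.
have -> : g s t = g s u + g u t + (g s t - g s u - g u t).
  by rewrite -[g s t - _ - _]addrA -opprD subrKC.
have -> : (2 * half_factor p * Q + B) * w s t ^+ 3 =
  Q * (half_factor p * w s t ^+ 3) + Q * (half_factor p * w s t ^+ 3)
  + B * w s t ^+ 3 by ring.
have us : u <= b by exact: le_trans tb.
have asu : a <= u by exact: le_trans su.
apply: le_trans (ler_normD _ _) _; apply: lerD; last exact: gB.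
apply: le_trans (ler_normD _ _) _; apply: lerD.
  by apply: (le_trans (gQ s u as_ su us)); rewrite ler_wpM2l.
by apply: (le_trans (gQ u t asu ut tb)); rewrite ler_wpM2l.
Qed.

(** The uniqueness part of the sewing lemma: [halving_step] without defect is a
    contraction. *)
Lemma additive_small_eq0 (T0 : R) (g : R -> R -> V) :
  0 <= T0 -> T0 <= T ->
  (forall s u t, 0 <= s -> s <= u -> u <= t -> t <= T0 ->
     g s t = g s u + g u t) ->
  (exists C, forall s t, 0 <= s -> s <= t -> t <= T0 ->
     `|g s t| <= C * w s t ^+ 3) ->
  forall s t, 0 <= s -> s <= t -> t <= T0 -> g s t = 0.
Proof.
move=> T00 T0T gadd [C gC] s t s0 st tT0.
apply/eqP; rewrite -normr_le0.
have := @contraction_bound R (R * R)%type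
  (fun x => [/\ 0 <= x.1, x.1 <= x.2 & x.2 <= T0])
  (fun x => `|g x.1 x.2|) (fun x => w x.1 x.2 ^+ 3) (2 * half_factor p) 0 `|C|.
rewrite mul0r => /(_ _ _ _ _ _ _ (s, t)); rewrite mul0r; apply => //.
- exact: two_half_factor.
- by move=> x _; rewrite exprn_ge0 // omw_ge0.
- move=> [x y] /= [x0 xy yT]; apply: (le_trans (gC x y x0 xy yT)).
  by rewrite ler_wpM2r ?exprn_ge0 ?omw_ge0 // ler_norm.
move=> Q Q0 gQ [x y] /= [x0 xy yT].
apply: (@halving_step g 0 T0) => //; last by move=> s' t' *; apply: (gQ (s', t')).
move=> s' u t' *; rewrite -addrA -opprD -gadd //.
by rewrite subrr normr0 mul0r.
Qed.

End additive.

(** * One step of the second-order scheme *)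

Lemma coord_sum2_le (R : realType) (n : nat) (A : 'M[R]_n) (W : normedModType R)
    (w : 'I_n -> 'I_n -> W) C :
  (forall i j, `|w i j| <= C) ->
  `|\sum_i \sum_j A i j *: w i j| <= n%:R ^+ 2 * C * `|A|.
Proof.
move=> wC; apply: le_trans (ler_norm_sum _ _ _) _.
apply: (@le_trans _ _ (\sum_(i < n) n%:R * (C * `|A|))).
  apply: ler_sum => i _; apply: le_trans (ler_norm_sum _ _ _) _.
  apply: (@le_trans _ _ (\sum_(j < n) C * `|A|)).
    apply: ler_sum => j _; rewrite normrZ mulrC ler_pM //.
    exact: mx_entry_le.
  by rewrite sumr_const card_ord -[_ *+ n]mulr_natl.
by rewrite sumr_const card_ord -[_ *+ n]mulr_natl expr2 !mulrA.
Qed.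

Section clamp.
Context (R : realType) (N : nat) (m : 'rV[R]_N) (r : R).
Hypothesis r_ge0 : 0 <= r.

(** A 1-Lipschitz retraction onto the ball, available coordinate by coordinate for
    the maximum norm. It makes the scheme globally Lipschitz. *)
Definition clamp (x : 'rV[R]_N) : 'rV[R]_N :=
  \row_i Num.max (m 0 i - r) (Num.min (m 0 i + r) (x 0 i)).

Lemma clamp_cball x : cball m r (clamp x).
Proof.
apply: mx_norm_le => // i j; rewrite !mxE ord1.
set a := m 0 j; set y := x 0 j.
have h : a - r <= Num.max (a - r) (Num.min (a + r) y) <= a + r.
  rewrite le_max lexx /= ge_max ge_min lexx /= andbT.
  by rewrite lerD2l ge0_cp.
by rewrite ler_norml lerBrDr lerBlDr addrC [r + a]addrC.
Qed.

Lemma clamp_id x : cball m r x -> clamp x = x.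
Proof.
move=> xr; apply/rowP => i; rewrite !mxE.
have := le_trans (mx_entry_le (x - m) 0 i) xr.
rewrite !mxE ler_norml lerBrDr lerBlDr addrC [r + _]addrC => /andP[h1 h2].
by rewrite min_r // max_r.
Qed.

Lemma clamp_lip x y : `|clamp x - clamp y| <= `|x - y|.
Proof.
apply: mx_norm_le => // i j; rewrite !mxE.
apply: le_trans (mx_entry_le (x - y) 0 j); rewrite !mxE.
move: (m 0 j) (x 0 j) (y 0 j) => a u v.
wlog uv : u v / u <= v.
  move=> H; have [/H//|/ltW/H] := leP u v.
  by rewrite distrC [X in _ <= X -> _]distrC.
have mono : Num.max (a - r) (Num.min (a + r) u) <= Num.max (a - r) (Num.min (a + r)
  v).
  rewrite ge_max !le_max lexx /= le_min !ge_min lexx /= uv !orbT //.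
rewrite distrC [leRHS]distrC !ger0_norm ?subr_ge0 //.
have : Num.max (a - r) (Num.min (a + r) v) <=
   Num.max (a - r) (Num.min (a + r) u) + (v - u).
  have vu : 0 <= v - u by rewrite subr_ge0.
  rewrite ge_max; apply/andP; split.
    by rewrite -[leLHS]addr0 lerD // le_max lexx.
  rewrite ge_min; apply/orP.
  have [ua|au] := leP (a + r) u.
    left; rewrite -[leLHS]addr0 lerD // le_max lexx orbT //.
  by right; rewrite -[leLHS](subrKC u) lerD2r le_max lexx orbT.
by rewrite lerBlDl addrC.
Qed.

End clamp.

Lemma remainder_algebra (R : realType) (m n : nat) (a b c d a' b' c' d' d2 :
  'M[R]_(m, n)) :
  a - b - c + d - (a' - b' - c' + d') =
  (a - b - c - (a' - b' - c')) + ((d - d2) + (d2 - d')).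
Proof. by apply/matrixP => i j; rewrite !mxE; ring. Qed.

Lemma step_algebra (R : realType) (m n : nat) (a b c d e f g : 'M[R]_(m, n)) :
  a + d + (c + f) - (a + b + (d + e + g)) = c - b - g + (f - e).
Proof. by apply/matrixP => i j; rewrite !mxE; ring. Qed.

Section fields.
Context (R : realType) (N n : nat) (m : 'rV[R]_N) (r C : R).
Context (f : 'I_n -> 'rV[R]_N -> 'rV[R]_N).
Local Notation B := (cball m r).

Definition field_deriv i j (x : 'rV[R]_N) := 'D_(f i x) (f j) x.

Hypothesis C_ge0 : 0 <= C.
Hypothesis fC : forall i, C11 (f i) m r C.
Hypothesis dfC : forall i v, C11 (fun x => 'D_v (f i) x) m r (C * `|v|).
Hypothesis gC : forall i j, C11 (field_deriv i j) m r C.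

Definition field1 (z : 'rV[R]_n) x := \sum_i z 0 i *: f i x.
Definition field2 (Z : 'M[R]_n) x := \sum_i \sum_j Z i j *: field_deriv i j x.
Definition davie_step (z : 'rV[R]_n) (Z : 'M[R]_n) x := field1 z x + field2 Z x.

Lemma field1_le z x : B x -> `|field1 z x| <= n%:R * C * `|z|.
Proof. by move=> xr; apply: row_entry_sum => i; case: (fC i xr). Qed.

Lemma field2_le Z x : B x -> `|field2 Z x| <= n%:R ^+ 2 * C * `|Z|.
Proof. by move=> xr; apply: coord_sum2_le => i j; case: (gC i j xr). Qed.

Lemma field1_lip z x y : B x -> B y ->
  `|field1 z x - field1 z y| <= n%:R * C * `|z| * `|x - y|.
Proof.
move=> xr yr; rewrite /field1 -sumrB; under eq_bigr do rewrite -scalerBr.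
have -> : n%:R * C * `|z| * `|x - y| = n%:R * (C * `|x - y|) * `|z| by ring.
by apply: row_entry_sum => i; exact: C11_lip (fC i) xr yr.
Qed.

Lemma field2_lip Z x y : B x -> B y ->
  `|field2 Z x - field2 Z y| <= n%:R ^+ 2 * C * `|Z| * `|x - y|.
Proof.
move=> xr yr; rewrite /field2 -sumrB; under eq_bigr do rewrite -sumrB.
under eq_bigr do under eq_bigr do rewrite -scalerBr.
have -> : n%:R ^+ 2 * C * `|Z| * `|x - y| = n%:R ^+ 2 * (C * `|x - y|) * `|Z| by ring.
by apply: coord_sum2_le => i j; exact: C11_lip (gC i j) xr yr.
Qed.

(** In the uses of [step_remainder], the first of two steps moves [x] by
    [h], and [e] is the second-order part of [h]. *)
Definition step_remainder (z : 'rV[R]_n) (Z : 'M[R]_n) x h e :=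
  \sum_j z 0 j *: (f j (x + h) - f j x - 'D_h (f j) x + 'D_e (f j) x)
  + (field2 Z (x + h) - field2 Z x).

(** The driver of the composed step is [z1 + z2], [Z1 + Z2 + z1 (x) z2] by Chen's
    relation. The tensor product is matched by the derivative of [f_j] along
    [h - e = field1 z1 x], and what is left is the Taylor remainder [step_remainder]. *)
Lemma step_compose z1 Z1 z2 Z2 x h e : B x -> h = field1 z1 x + e ->
  davie_step z1 Z1 x + davie_step z2 Z2 (x + h) - davie_step (z1 + z2) (Z1 + Z2 +
    tens z1 z2) x
  = step_remainder z2 Z2 x h e.
Proof.
move=> xr hE; have df j : differentiable (f j) x by case: (fC j xr).
have E1 : field1 (z1 + z2) x = field1 z1 x + field1 z2 x.
  rewrite /field1 -big_split /=; apply: eq_bigr => i _.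
  by rewrite mxE scalerDl.
have E2 : field2 (Z1 + Z2 + tens z1 z2) x =
    field2 Z1 x + field2 Z2 x + \sum_j z2 0 j *: \sum_i z1 0 i *: field_deriv i j x.
  rewrite /field2 -big_split /=.
  under [X in _ = _ + X]eq_bigr do rewrite scaler_sumr.
  rewrite [X in _ = _ + X]exchange_big /= -big_split /=; apply: eq_bigr => i _.
  rewrite -!big_split /=; apply: eq_bigr => j _.
  rewrite !mxE big_ord1 !mxE !scalerDl scalerA; congr (_ + _ *: _); exact: mulrC.
have E3 j : 'D_h (f j) x - 'D_e (f j) x = \sum_i z1 0 i *: field_deriv i j x.
  rewrite -deriveBdir // hE addrK /field1 deriveE // linear_sum.
  by apply: eq_bigr => i _; rewrite linearZ /field_deriv deriveE.
rewrite /davie_step /step_remainder E1 E2 step_algebra; congr (_ + _).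
rewrite /field1 -!sumrB; apply: eq_bigr => j _; rewrite -E3 -!scalerBr.
congr (_ *: _); move: ('D_h _ _) ('D_e _ _) (f j (x + h) - f j x) => u v w'.
by rewrite opprB addrA addrAC.
Qed.

Lemma step_remainder_le z Z x h e eta A : 0 <= eta -> 0 <= A ->
  `|z| <= eta -> `|Z| <= eta ^+ 2 -> B x -> B (x + h) ->
  `|h| <= A * eta -> `|e| <= A * eta ^+ 2 ->
  `|step_remainder z Z x h e| <= (n%:R * C * (A ^+ 2 + A) + n%:R ^+ 2 * C * A) *
    eta ^+ 3.
Proof.
move=> eta0 A0 zE ZE xr xhr hE eE.
rewrite mulrDl; apply: le_trans (ler_normD _ _) _; apply: lerD.
  apply: (@le_trans _ _ (n%:R * (C * (A ^+ 2 + A) * eta ^+ 2) * `|z|)).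
    apply: row_entry_sum => j; apply: le_trans (ler_normD _ _) _.
    have -> : C * (A ^+ 2 + A) * eta ^+ 2 = C * (A * eta) ^+ 2 + C * (A * eta ^+ 2).
      by ring.
    apply: lerD.
      apply: (le_trans (C11_taylor (fC j) xr xhr)); rewrite ler_wpM2l //.
      by rewrite lerXn2r ?nnegrE // mulr_ge0.
    have [_ _ H _] := fC j xr; apply: (le_trans (H e)).
    by rewrite ler_wpM2l.
  have -> : n%:R * C * (A ^+ 2 + A) * eta ^+ 3 =
     n%:R * (C * (A ^+ 2 + A) * eta ^+ 2) * eta by ring.
  by rewrite ler_wpM2l // !mulr_ge0 // ?exprn_ge0 // addr_ge0 ?exprn_ge0.
apply: le_trans (field2_lip Z xhr xr) _; rewrite [x + h]addrC addrK.
have -> : n%:R ^+ 2 * C * A * eta ^+ 3 = n%:R ^+ 2 * C * eta ^+ 2 * (A * eta).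
  by ring.
by rewrite ler_pM ?mulr_ge0 ?exprn_ge0 // ler_wpM2l // mulr_ge0 // exprn_ge0.
Qed.

Lemma field2_ddiff Z x h y k : B x -> B (x + h) -> B y -> B (y + k) ->
  `|field2 Z (x + h) - field2 Z x - (field2 Z (y + k) - field2 Z y)| <=
  n%:R ^+ 2 * (C * (`|h - k| + (`|x - y| + `|h - k|) * `|k|)) * `|Z|.
Proof.
move=> xr xhr yr ykr.
have -> : field2 Z (x + h) - field2 Z x - (field2 Z (y + k) - field2 Z y) =
  \sum_i \sum_j Z i j *: (field_deriv i j (x + h) - field_deriv i j x -
    (field_deriv i j (y + k) - field_deriv i j y)).
  rewrite /field2 -2!sumrB -sumrB; apply: eq_bigr => i _.
  rewrite -2!sumrB -sumrB; apply: eq_bigr => j _.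
  by rewrite -!scalerBr.
by apply: coord_sum2_le => i j; exact: C11_ddiff (gC i j) xr xhr yr ykr.
Qed.

(** Here [dl] bounds the distance of the base points and [rho] the difference of
    the Davie errors. The bound is linear in both, and [rho] has a factor [eta]
    which is small on short intervals: this is what makes uniqueness a
    contraction. *)
Lemma step_remainder_diff z Z x h e y k e' eta A dl rho :
  0 <= eta <= 1 -> 1 <= A -> 0 <= dl -> 0 <= rho ->
  `|z| <= eta -> `|Z| <= eta ^+ 2 ->
  B x -> B (x + h) -> B y -> B (y + k) ->
  `|h| <= A * eta -> `|k| <= A * eta -> `|e'| <= A * eta ^+ 2 ->
  `|x - y| <= dl -> `|h - k| <= A * (eta * dl + rho) ->
  `|e - e'| <= A * (eta ^+ 2 * dl + rho) ->
  `|step_remainder z Z x h e - step_remainder z Z y k e'| <=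
    (6 * n%:R * C * A ^+ 3 + 3 * n%:R ^+ 2 * C * A ^+ 2) * (eta ^+ 3 * dl + eta *
      rho).
Proof.
move=> /andP[eta0 eta1] A1 dl0 rho0 zE ZE xr xhr yr ykr hE kE e'E xy hk ee.
have A0 : 0 <= A by exact: le_trans A1.
pose D := eta * dl + rho.
have D0 : 0 <= D by rewrite addr_ge0 ?mulr_ge0.
have P1 : (`|x - y| + `|h - k|) * `|k| <= (A + A ^+ 2) * D.
  rewrite mulrDl [leRHS]mulrDl; apply: lerD.
    apply: (@le_trans _ _ (dl * (A * eta))); first by rewrite ler_pM.
    have -> : dl * (A * eta) = A * (eta * dl) by ring.
    by rewrite ler_wpM2l // lerDl.
  apply: (@le_trans _ _ ((A * D) * (A * eta))); first by rewrite ler_pM.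
  have -> : A * D * (A * eta) = A ^+ 2 * D * eta by ring.
  by rewrite ler_piMr // mulr_ge0 // exprn_ge0.
have P2 : `|h - k| + (`|x - y| + `|h - k|) * `|k| <= 3 * A ^+ 2 * D.
  apply: le_trans (lerD hk P1) _; rewrite -/D.
  have -> : A * D + (A + A ^+ 2) * D = (A + A + A ^+ 2) * D by ring.
  rewrite ler_wpM2r //; have AA : A <= A ^+ 2 by rewrite expr2 ler_peMr.
  have -> : 3 * A ^+ 2 = A ^+ 2 + A ^+ 2 + A ^+ 2 by ring.
  by rewrite !lerD.
have algebra : 6 * n%:R * C * A ^+ 3 + 3 * n%:R ^+ 2 * C * A ^+ 2 =
   n%:R * (C * 6 * A ^+ 3) + 3 * n%:R ^+ 2 * C * A ^+ 2 by ring.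
rewrite algebra {algebra} mulrDl.
have nC0 : 0 <= n%:R :> R by [].
have -> : step_remainder z Z x h e - step_remainder z Z y k e' =
  \sum_j z 0 j *: ((f j (x + h) - f j x - 'D_h (f j) x) -
                   (f j (y + k) - f j y - 'D_k (f j) y)
                   + ('D_(e - e') (f j) x + ('D_e' (f j) x - 'D_e' (f j) y)))
  + (field2 Z (x + h) - field2 Z x - (field2 Z (y + k) - field2 Z y)).
  rewrite /step_remainder [in LHS]opprD addrACA; congr (_ + _).
  rewrite -sumrB; apply: eq_bigr => j _; rewrite -scalerBr; congr (_ *: _).
  have df : differentiable (f j) x by case/(fC j): xr.
  have E := deriveBdir e e' df; rewrite E; exact: remainder_algebra.
apply: le_trans (ler_normD _ _) _; apply: lerD.
  have D3 : 0 <= eta ^+ 2 * dl + rho by rewrite addr_ge0 // mulr_ge0 // exprn_ge0.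
  have S0 : 0 <= C * 6 * A ^+ 3 * (eta ^+ 2 * dl + rho).
    by rewrite mulr_ge0 // mulr_ge0 ?exprn_ge0 // mulr_ge0.
  apply: (@le_trans _ _ (n%:R * (C * 6 * A ^+ 3 * (eta ^+ 2 * dl + rho)) * `|z|)).
    apply: row_entry_sum => j.
    have R1 := C11D_rem_diff (fC j) (dfC j) xr xhr yr ykr.
    have [_ _ Q1 Q2] := fC j xr; have {}Q1 := Q1 (e - e'); have {}Q2 := Q2 y e' yr.
    apply: (le_trans (ler_normD _ _)).
    have S1 : C * `|h| * `|h - k| + C * `|k| * (`|h - k| + (`|x - y| + `|h - k|) *
      `|k|)
        <= C * 4 * A ^+ 3 * (eta ^+ 2 * dl + rho).
      apply: (@le_trans _ _ (C * (A * eta) * (A * D) + C * (A * eta) * (3 * A ^+ 2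
        * D))).
        by apply: lerD; apply: ler_pM; rewrite ?mulr_ge0 ?addr_ge0 ?mulr_ge0 //
          ler_wpM2l.
      have -> : C * (A * eta) * (A * D) + C * (A * eta) * (3 * A ^+ 2 * D) =
        C * (A ^+ 2 + 3 * A ^+ 3) * (eta * D) by ring.
      apply: ler_pM; rewrite ?mulr_ge0 // ?addr_ge0 ?mulr_ge0 ?exprn_ge0 //.
        rewrite -mulrA ler_wpM2l //.
        have AA : A ^+ 2 <= A ^+ 3 by rewrite ler_weXn2l.
        have -> : 4 * A ^+ 3 = A ^+ 3 + 3 * A ^+ 3 by ring.
        by rewrite lerD2r.
      rewrite /D mulrDr mulrA -expr2 lerD2l.
      by rewrite ler_piMl.
    have -> : C * 6 * A ^+ 3 * (eta ^+ 2 * dl + rho) =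
      C * 4 * A ^+ 3 * (eta ^+ 2 * dl + rho) +
      (C * A ^+ 3 * (eta ^+ 2 * dl + rho) + C * A ^+ 3 * (eta ^+ 2 * dl + rho)) by
        ring.
    have AA : A <= A ^+ 3 by rewrite -[leLHS]expr1 ler_weXn2l.
    apply: lerD; first exact: le_trans S1.
    apply: (le_trans (ler_normD _ _)); apply: lerD.
      apply: (le_trans Q1); rewrite -mulrA ler_wpM2l //.
      by apply: (le_trans ee); rewrite ler_wpM2r.
    apply: (le_trans Q2).
    have -> : C * `|e'| * `|x - y| = C * (`|e'| * `|x - y|) by ring.
    have -> : C * A ^+ 3 * (eta ^+ 2 * dl + rho) =
      C * (A ^+ 3 * (eta ^+ 2 * dl + rho)) by ring.
    rewrite ler_wpM2l //.
    apply: (@le_trans _ _ (A * eta ^+ 2 * dl)); first by rewrite ler_pM.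
    have -> : A * eta ^+ 2 * dl = A * (eta ^+ 2 * dl) by ring.
    apply: (@le_trans _ _ (A * (eta ^+ 2 * dl + rho))).
      by rewrite ler_wpM2l // lerDl.
    by rewrite ler_wpM2r.
  have -> : n%:R * (C * 6 * A ^+ 3) * (eta ^+ 3 * dl + eta * rho) =
    n%:R * (C * 6 * A ^+ 3 * (eta ^+ 2 * dl + rho)) * eta by ring.
  by rewrite ler_wpM2l // mulr_ge0.
apply: (le_trans (field2_ddiff Z xr xhr yr ykr)).
have n20 : 0 <= n%:R ^+ 2 :> R by rewrite exprn_ge0.
apply: (@le_trans _ _ (n%:R ^+ 2 * (C * (3 * A ^+ 2 * D)) * eta ^+ 2)).
  apply: ler_pM => //.
    by rewrite mulr_ge0 // mulr_ge0 // addr_ge0 // mulr_ge0 // addr_ge0.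
  by rewrite ler_wpM2l // ler_wpM2l.
have -> : n%:R ^+ 2 * (C * (3 * A ^+ 2 * D)) * eta ^+ 2 =
  3 * n%:R ^+ 2 * C * A ^+ 2 * (eta ^+ 3 * dl + eta * (eta * rho)).
  by rewrite /D; ring.
rewrite ler_wpM2l ?mulr_ge0 ?exprn_ge0 // lerD2l ler_wpM2l //.
by rewrite ler_piMl.
Qed.

End fields.

(** * A step stays close to the submanifold *)

Lemma quadratic_tangent (R : realType) (V W : normedModType R) (phi psi : V -> W)
    (x : V) (C d : R) : 0 < d -> differentiable psi x ->
  (forall y, `|y - x| < d ->
     `|phi y - phi x - (psi y - psi x)| <= C * `|y - x| ^+ 2) ->
  differentiable phi x /\ forall v, 'D_v phi x = 'D_v psi x.
Proof.
move=> d0 dpsi H.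
have key (e : R) : 0 < e -> exists d : R, 0 < d /\ forall y, `|y - x| < d ->
    `|phi y - phi x - 'd psi x (y - x)| <= e * `|y - x|.
  move=> e0; have e2 : 0 < e / 2 by rewrite divr_gt0.
  have [d1 [d10 d1P]] := differentiable_eps dpsi e2.
  have C1 : 0 < `|C| + 1 by rewrite ltr_wpDl.
  exists (Num.min d1 (Num.min d (e / 2 / (`|C| + 1)))); split.
    by rewrite !lt_min d10 d0 /= divr_gt0.
  move=> y; rewrite !lt_min => /andP[yd1 /andP[yd yC]].
  have -> : phi y - phi x - 'd psi x (y - x) =
    (phi y - phi x - (psi y - psi x)) + (psi y - psi x - 'd psi x (y - x)).
    by rewrite subrKA.
  apply: (le_trans (ler_normD _ _)); rewrite [e]splitr mulrDl.
  apply: lerD; last exact: d1P.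
  apply: (le_trans (H y yd)); rewrite expr2 mulrA ler_wpM2r //.
  apply: (@le_trans _ _ ((`|C| + 1) * `|y - x|)).
    by rewrite ler_wpM2r // (le_trans (ler_norm _)) // lerDl.
  by rewrite mulrC -ler_pdivlMr // ltW.
have dc : continuous ('d psi x) by exact: diff_continuous.
have dphi : differentiable phi x by exact: (eps_differentiable dc).
split => // v; rewrite (deriveE v dphi) (deriveE v dpsi).
apply/eqP; rewrite -subr_eq0 -normr_le0; apply/ler_addgt0Pr => e e0; rewrite add0r.
have v1 : 0 < `|v| + 1 by rewrite ltr_wpDl.
have e2 : 0 < e / (2 * (`|v| + 1)) by rewrite divr_gt0 // mulr_gt0.
have [d1 [d10 P1]] := key _ e2.
have [d2 [d20 P2]] := differentiable_eps dphi e2.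
pose t := Num.min d1 d2 / (2 * (`|v| + 1)).
have md : 0 < Num.min d1 d2 by rewrite lt_min d10.
have t0 : 0 < t by rewrite divr_gt0 // mulr_gt0.
have tv : `|x + t *: v - x| = t * `|v|.
  by rewrite addrC addKr normrZ gtr0_norm.
have : `|x + t *: v - x| < Num.min d1 d2.
  rewrite tv /t mulrAC ltr_pdivrMr ?mulr_gt0 // ltr_pM2l //.
  by rewrite mulrDr mulr1 mulr2n mulrDl mul1r -addrA ltrDl ltr_wpDl.
rewrite lt_min => /andP[y1 y2].
have := P1 _ y1; have := P2 _ y2; rewrite tv.
have E1 : 'd phi x (t *: v) = t *: 'd phi x v by rewrite linearZ.
have E2 : 'd psi x (t *: v) = t *: 'd psi x v by rewrite linearZ.
have xtv : x + t *: v - x = t *: v by rewrite addrC addKr.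
rewrite xtv E1 E2 => Q2 Q1.
have Q : t * `|'d phi x v - 'd psi x v| <= t * e.
  rewrite -{1}(gtr0_norm t0) -normrZ scalerBr.
  have -> : t *: 'd phi x v - t *: 'd psi x v =
    (phi (x + t *: v) - phi x - t *: 'd psi x v) -
    (phi (x + t *: v) - phi x - t *: 'd phi x v).
    move: (phi _ - _) (t *: _) (t *: _) => a b c.
    by rewrite opprB [RHS]addrC subrKA.
  apply: (le_trans (ler_normB _ _)); apply: (le_trans (lerD Q1 Q2)).
  have -> : e / (2 * (`|v| + 1)) * (t * `|v|) + e / (2 * (`|v| + 1)) * (t * `|v|)
     = t * (e * (`|v| / (`|v| + 1))) by field; rewrite gt_eqF.
  rewrite ler_pM2l // ler_piMr ?(ltW e0) // ler_pdivrMr // mul1r lerDl //.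
by rewrite -(ler_pM2l t0).
Qed.

Lemma derive_linear_comp (R : realType) (V W W' : normedModType R)
    (L : {linear W -> W'}) (Y : V -> W) (x : V) : continuous L ->
  differentiable Y x -> differentiable (fun y => L (Y y)) x /\
  forall v, 'D_v (fun y => L (Y y)) x = L ('D_v Y x).
Proof.
move=> cL dY; have dL : differentiable L (Y x) by exact: linear_differentiable.
have dLY : differentiable (L \o Y) x by exact: differentiable_comp.
split => // v; rewrite (deriveE v dLY) (deriveE v dY).
by rewrite (diff_comp dY dL) /= diff_lin.
Qed.

Lemma half_norm_le (R : realType) (V : normedModType R) (u v : V) (b : R) :
  `|u| <= b -> `|v| <= b -> `|2^-1 *: (u + v)| <= b.
Proof.
move=> ub vb; rewrite normrZ ger0_norm ?invr_ge0 // mulrC ler_pdivrMr //.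
by rewrite (le_trans (ler_normD _ _)) // mulrDr mulr1 lerD.
Qed.

Section second_order.
Context (R : realType) (N k : nat) (F : 'rV[R]_N -> 'rV[R]_k).
Context (m : 'rV[R]_N) (r C : R).
Local Notation B := (cball m r).
Hypotheses (C_ge0 : 0 <= C) (FC : C11 F m r C).
Hypothesis DFC : forall v, C11 (fun x => 'D_v F x) m r (C * `|v|).

Lemma interior_near x : `|x - m| < r -> \forall y \near x, B y.
Proof.
move=> xr; apply/near_norm; exists (r - `|x - m|); rewrite subr_gt0; split => // y yx.
have -> : cball m r y = (`|(x - m) + (y - x)| <= r) by rewrite [_ + (y - x)]addrC
  subrKA.
rewrite (le_trans (ler_normD _ _)) //.
by rewrite addrC -lerBrDr ltW.
Qed.

(** The product rule for [y |-> F'(y) Y(y)]. The comparison map [psi] varies one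
    factor at a time; it differs by a product of two increments, which is
    quadratic, so [quadratic_tangent] applies. *)
Lemma derive_along (Y : 'rV[R]_N -> 'rV[R]_N) x : C11 Y m r C ->
  `|x - m| < r ->
  differentiable (fun y => 'D_(Y y) F y) x /\ forall v,
  'D_v (fun y => 'D_(Y y) F y) x =
    'D_('D_v Y x) F x + 'D_v (fun y => 'D_(Y x) F y) x.
Proof.
move=> YC xr; have xB : B x by exact: ltW.
have [dF Fx DFx DDF] := FC xB; have [dY Yx DY DDY] := YC x xB.
have [dDF _ _ _] := DFC (Y x) xB.
pose psi y := 'd F x (Y y) + 'D_(Y x) F y.
have cdF : continuous ('d F x) by exact: diff_continuous.
have [dFY DFY] := derive_linear_comp cdF dY.
have dpsi : differentiable psi x by exact: differentiableD.
have /near_norm[d [d0 dB]] := interior_near xr.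
have quad y : `|y - x| < d ->
    `|'D_(Y y) F y - 'D_(Y x) F x - (psi y - psi x)| <= C * C * `|y - x| ^+ 2.
  move=> /dB yB; have [dFy _ _ _] := FC yB.
  have -> : 'D_(Y y) F y - 'D_(Y x) F x - (psi y - psi x) =
     'D_(Y y - Y x) F y - 'D_(Y y - Y x) F x.
    rewrite /psi (deriveBdir (Y y) (Y x) dFy) (deriveBdir (Y y) (Y x) dF).
    rewrite -!(deriveE _ dF).
    move: ('D_(Y y) F y) ('D_(Y x) F x) ('D_(Y y) F x) ('D_(Y x) F y) => a b c e.
    by apply/matrixP => i j; rewrite !mxE; ring.
  have [_ _ _ H] := FC yB; apply: (le_trans (H x (Y y - Y x) xB)).
  rewrite expr2 mulrA ler_wpM2r // -mulrA ler_wpM2l //.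
  exact: C11_lip YC yB xB.
have [dphi Dphi] := quadratic_tangent d0 dpsi quad.
split => // v; rewrite Dphi; rewrite /psi deriveD; [|exact: diff_derivable..].
congr (_ + _).
by rewrite DFY (deriveE ('D_v Y x) dF).
Qed.

Definition hess x v w := 'D_v (fun y => 'D_w F y) x.

Lemma hess_sumr (l : nat) (c : 'I_l -> R) (w : 'I_l -> 'rV[R]_N) x v :
  `|x - m| < r -> hess x v (\sum_j c j *: w j) = \sum_j c j *: hess x v (w j).
Proof.
move=> xr; have dD j : differentiable (fun y => 'D_(w j) F y) x.
  by have [] := DFC (w j) (ltW xr).
have [_ <-] := derive_lincomb c dD.
apply: near_eq_derive; near=> y.
have yB : B y by near: y; exact: interior_near.
have [dF _ _ _] := FC yB.
rewrite deriveE // linear_sum; apply: eq_bigr => j _.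
by rewrite linearZ deriveE.
Unshelve. all: by end_near. Qed.

Lemma hess_suml (l : nat) (c : 'I_l -> R) (w : 'I_l -> 'rV[R]_N) x v :
  `|x - m| < r -> hess x (\sum_j c j *: w j) v = \sum_j c j *: hess x (w j) v.
Proof.
move=> xr; have [dD _ _ _] := DFC v (ltW xr).
rewrite /hess deriveE // linear_sum; apply: eq_bigr => j _.
by rewrite linearZ deriveE.
Qed.

Lemma hess_sym x v w : `|x - m| < r -> hess x v w = hess x w v.
Proof. by move=> xr; exact: (C11D_sym FC DFC). Qed.

Lemma hess_le x v w : `|x - m| < r -> `|hess x v w| <= C * `|w| * `|v|.
Proof. by move=> xr; have [_ _ H _] := DFC w (ltW xr); exact: H. Qed.

Lemma hessBl x u v w : `|x - m| < r -> hess x (u - v) w = hess x u w - hess x v w.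
Proof. by move=> xr; apply: deriveBdir; have [] := DFC w (ltW xr). Qed.

End second_order.

Section step_near_manifold.
Context (R : realType) (N n d : nat) (M : set 'rV[R]_N).
Context (m : 'rV[R]_N) (r C : R) (U : set 'rV[R]_N).
Context (F : 'rV[R]_N -> 'rV[R]_(N - d)) (f : 'I_n -> 'rV[R]_N -> 'rV[R]_N).
Local Notation B := (cball m r).
Hypothesis C_ge0 : 0 <= C.
Hypothesis eqF : local_equation (d := d) M m U F.
Hypothesis BU : forall x, B x -> U x.
Hypothesis FC : C11 F m r C.
Hypothesis DFC : forall v, C11 (fun x => 'D_v F x) m r (C * `|v|).
Hypothesis fC : forall i, C11 (f i) m r C.
Hypothesis gC : forall i j, C11 (field_deriv f i j) m r C.
Hypothesis f_tangent : forall i x, M x -> B x -> tangent d M x (f i x).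

Lemma local_equation_at x : U x -> local_equation (d := d) M x U F.
Proof. by move=> Ux; have [? _ ? ? ?] := eqF. Qed.

Lemma field_kernel i x : M x -> B x -> 'D_(f i x) F x = 0.
Proof.
move=> Mx xB; apply: (tangent_equation Mx (local_equation_at (BU xB))).
exact: f_tangent.
Qed.

(** The derivative of the identity [F'(x) f_j(x) = 0] on [M] along the tangent
    vector [f_i x]. *)
Lemma covariant_hess i j x : M x -> `|x - m| < r ->
  'D_(field_deriv f i j x) F x = - hess F x (f i x) (f j x).
Proof.
move=> Mx xr; have [dphi Dphi] := derive_along C_ge0 FC DFC (fC j) xr.
pose U' := [set y : 'rV[R]_N | `|y - m| < r].
have Uo' : open U'.
  rewrite (_ : U' = (fun y => `|y - m|) @^-1` [set t | t < r]) //.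
  apply: open_comp; last exact: open_lt.
  by move=> y _; exact: (@continuous_dist R 'rV[R]_N).
have := tangent_vanish Uo' xr dphi Mx _ (f_tangent i Mx (ltW xr)).
rewrite Dphi -/(field_deriv f i j x) => /(_ _)/eqP; rewrite addr_eq0 => H.
by apply/eqP; apply: H => y My yr; apply: field_kernel => //; exact: ltW.
Qed.

(** Expand [F (x + h)] at [x], with [h = a + e] and [a] of order one. By
    [field_kernel] the first-order term of [a] vanishes; by [covariant_hess] that
    of [e] is minus the Hessian contracted with [Z], which is minus half of
    [hess F x a a] because the Hessian is symmetric and [Z] has symmetric part
    [z (x) z / 2]. This cancels the second-order term of [a]. *)
Lemma step_near_manifold x (z : 'rV[R]_n) (Z : 'M[R]_n) eta : M x ->
  `|x - m| < r -> 0 <= eta <= 1 ->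
  `|z| <= eta -> `|Z| <= eta ^+ 2 ->
  (forall i j, Z i j + Z j i = z 0 i * z 0 j) ->
  B (x + davie_step f z Z x) ->
  `|F (x + davie_step f z Z x)| <=
    C * ((n%:R * C + n%:R ^+ 2 * C) ^+ 3 + (n%:R * C + n%:R ^+ 2 * C) ^+ 2) * eta
      ^+ 3.
Proof.
move=> Mx xr /andP[eta0 eta1] zE ZE Zsym; have xB : B x by exact: ltW.
rewrite /davie_step; set a := field1 f z x; set e := field2 f Z x;
  set h := a + e => hB.
set A := n%:R * C + n%:R ^+ 2 * C.
have nC0 : 0 <= n%:R * C by rewrite mulr_ge0.
have nC20 : 0 <= n%:R ^+ 2 * C by rewrite mulr_ge0 // exprn_ge0.
have A0 : 0 <= A by rewrite addr_ge0.
have aE : `|a| <= n%:R * C * eta.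
  by apply: (le_trans (field1_le fC z xB)); rewrite ler_wpM2l.
have eE : `|e| <= n%:R ^+ 2 * C * eta ^+ 2.
  by apply: (le_trans (field2_le gC Z xB)); rewrite ler_wpM2l.
have ee : eta ^+ 2 <= eta by rewrite expr2 ler_piMl.
have hE : `|h| <= A * eta.
  apply: (le_trans (ler_normD _ _)); rewrite /A mulrDl; apply: lerD => //.
  by apply: (le_trans eE); rewrite ler_wpM2l.
have hE3 : `|h| ^+ 3 <= (A * eta) ^+ 3 by rewrite lerXn2r ?nnegrE // mulr_ge0.
have aA : `|a| <= A * eta by apply: (le_trans aE); rewrite ler_wpM2r // lerDl.
have eA : `|e| <= A * eta ^+ 2.
  by apply: (le_trans eE); rewrite ler_wpM2r ?exprn_ge0 // lerDr.
have [dF _ _ _] := FC xB.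
have Fx : F x = 0 by apply/(local_equation0 eqF (BU xB)).
have DaF : 'D_a F x = 0.
  rewrite deriveE // linear_sum big1 // => i _.
  by rewrite linearZ /= -deriveE // field_kernel // scaler0.
pose H i j := hess F x (f i x) (f j x).
have DeF : 'D_e F x = - \sum_i \sum_j Z i j *: H i j.
  rewrite deriveE // linear_sum -sumrN; apply: eq_bigr => i _.
  rewrite linear_sum -sumrN; apply: eq_bigr => j _.
  by rewrite linearZ /= -deriveE // covariant_hess // scalerN.
have Haa : hess F x a a = \sum_i \sum_j (z 0 i * z 0 j) *: H i j.
  rewrite (hess_suml DFC _ _ _ xr); apply: eq_bigr => i _.
  rewrite (hess_sumr FC DFC _ _ _ xr) scaler_sumr; apply: eq_bigr => j _.
  by rewrite scalerA.
have Zsum : \sum_i \sum_j Z i j *: H i j = 2^-1 *: hess F x a a.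
  have S : \sum_i \sum_j Z i j *: H i j = \sum_i \sum_j Z j i *: H i j.
    rewrite exchange_big /=; apply: eq_bigr => i _; apply: eq_bigr => j _.
    by rewrite /H (hess_sym FC DFC).
  rewrite Haa; under [in RHS]eq_bigr do under eq_bigr do rewrite -Zsym scalerDl.
  under [in RHS]eq_bigr do rewrite big_split /=.
  rewrite big_split /= -S -mulr2n -[X in _ = 2^-1 *: X]scaler_nat scalerA.
  by rewrite mulVf ?scale1r // pnatr_eq0.
have DhF : 'D_h F x + 2^-1 *: hess F x h h =
    2^-1 *: (hess F x e h + hess F x e a).
  have -> : 'D_h F x = - (2^-1 *: hess F x a a).
    by rewrite -Zsum -DeF deriveE // linearD /= -!deriveE // DaF add0r.
  rewrite addrC -scalerBr; congr (_ *: _).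
  have eh : e = h - a by rewrite /h addrC addKr.
  have E1 : hess F x e h = hess F x h h - hess F x a h.
    by rewrite {1}eh; exact: (hessBl DFC).
  have E2 : hess F x e a = hess F x a h - hess F x a a.
    by rewrite {1}eh -(hess_sym FC DFC h a xr); exact: (hessBl DFC).
  rewrite E1 E2; move: (hess F x h h) (hess F x a h) (hess F x a a) => q1 q2 q3.
  by rewrite subrKA.
have -> : F (x + h) = (F (x + h) - F x - 'D_h F x - 2^-1 *: hess F x h h)
   + 2^-1 *: (hess F x e h + hess F x e a).
  rewrite -DhF Fx subr0; move: (F (x + h)) ('D_h F x) (2^-1 *: _) => u1 u2 u3.
  by rewrite -[u1 - u2 - u3]addrA -opprD subrK.
have T3 : `|F (x + h) - F x - 'D_h F x - 2^-1 *: hess F x h h| <= C * `|h| ^+ 3.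
  exact: C11D_taylor3 FC DFC _ _ xB hB.
rewrite mulrDr mulrDl; apply: (le_trans (ler_normD _ _)); apply: lerD.
  apply: (le_trans T3).
  have -> : C * A ^+ 3 * eta ^+ 3 = C * (A * eta) ^+ 3 by ring.
  exact: (ler_wpM2l C_ge0 hE3).
have P v : `|v| <= A * eta -> `|hess F x e v| <= C * A ^+ 2 * eta ^+ 3.
  move=> vA; apply: (le_trans (hess_le DFC _ _ xr)).
  have -> : C * A ^+ 2 * eta ^+ 3 = C * (A * eta) * (A * eta ^+ 2) by ring.
  apply: ler_pM; [exact: mulr_ge0|exact: normr_ge0| |exact: eA].
  exact: (ler_wpM2l C_ge0 vA).
exact: half_norm_le (P _ hE) (P _ aA).
Qed.

End step_near_manifold.

(** * Charts adapted to the vector fields *)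

Lemma open_bigcap_finType (T : topologicalType) (I : finType) (V : I -> set T) :
  (forall i, open (V i)) -> open (\bigcap_(i in [set: I]) V i).
Proof.
move=> Vo; rewrite openE => x xV.
have : \forall y \near x, forall i, V i y.
  by apply: filter_forall => i; apply: open_nbhs_nbhs; split; [|exact: xV].
by apply: filterS => y Vy i _; exact: Vy.
Qed.

Lemma Ck_subset (R : realType) (V W : normedModType R) k (U U' : set V) (f : V -> W) :
  U' `<=` U -> Ck k U f -> Ck k U' f.
Proof.
move=> UU'; elim: k f => [|k IH] f; first by move=> cf x /UU'; exact: cf.
by move=> [df dfv]; split => [x /UU'|v]; [exact: df|exact: (IH _ (dfv v))].
Qed.

(** In coordinates [field_deriv] is bilinear in the entries of [f i] and of the
    partial derivatives of [f j]. *)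
Lemma smooth_field_deriv (R : realType) (N n : nat) (U : set 'rV[R]_N)
    (f : 'I_n -> 'rV[R]_N -> 'rV[R]_N) i j : open U ->
  smooth_on U (f i) -> smooth_on U (f j) -> smooth_on U (field_deriv f i j).
Proof.
move=> Uo fi fj q.
pose h x := \sum_(l < N) \sum_(a < N)
  ((f i x) 0 l * ('D_(delta_mx 0 l) (f j) x) 0 a) *: (delta_mx 0 a : 'rV[R]_N).
apply: (@Ck_eq _ _ _ Uo _ _ h).
  move=> x Ux; rewrite /field_deriv /h (derive_coordE _ (smooth_differentiable fj
    Ux)).
  apply: eq_bigr => l _;
    rewrite {2}(row_sum_delta ('D_(delta_mx 0 l) (f j) x)) scaler_sumr.
  by apply: eq_bigr => a _; rewrite scalerA.
apply: (Ck_sum Uo) => l; apply: (Ck_sum Uo) => a; apply: (Ck_scale Uo).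
apply: (Ck_M Uo); first exact: (Ck_coord Uo).
by apply: (Ck_coord Uo); exact: smooth_D.
Qed.

(** Around [m], the fields [Y] are restrictions of ambient fields [f] and [M] is
    the zero set of [F], with common bounds on one ball. The field
    [chart_correct] provides an approximate projection onto [M]. *)
Record adapted_chart (R : realType) (N n d : nat) (M : set 'rV[R]_N)
    (Y : 'rV[R]_n -> 'rV[R]_N -> 'rV[R]_N) (m : 'rV[R]_N) (r C : R)
    (f : 'I_n -> 'rV[R]_N -> 'rV[R]_N)
    (F : 'rV[R]_N -> 'rV[R]_(N - d)) (U : set 'rV[R]_N) : Prop := {
  chart_r : 0 < r;
  chart_C : 0 <= C;
  chart_eq : local_equation (d := d) M m U F;
  chart_U : forall x, cball m r x -> U x;
  chart_F : C11 F m r C;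
  chart_DF : forall v, C11 (fun x => 'D_v F x) m r (C * `|v|);
  chart_f : forall i, C11 (f i) m r C;
  chart_Df : forall i v, C11 (fun x => 'D_v (f i) x) m r (C * `|v|);
  chart_deriv : forall i j, C11 (field_deriv f i j) m r C;
  chart_tangent : forall i x, M x -> cball m r x -> tangent d M x (f i x);
  chart_field1 : forall a x, M x -> cball m r x -> Y a x = field1 f a x;
  chart_field2 : forall A x, M x -> cball m r x ->
    tlift (fun a b => tderiv M (Y b) (Y a x) x) A = field2 f A x;
  chart_correct : forall y, cball m r y -> exists y', M y' /\ `|y' - y| <= C * `|F y|;
  chart_compact : forall r', r' <= r -> compact (M `&` cball m r') }.

Section adapted_chart_exists.
Context (R : realType) (N n d : nat) (M : set 'rV[R]_N).
Context (Y : 'rV[R]_n -> 'rV[R]_N -> 'rV[R]_N).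
Hypotheses (M_submanifold : submanifold d M).
Hypothesis (Y_linear : linear_vector_fields d M Y).

Lemma Y_sum a x : M x -> Y a x = \sum_i a 0 i *: Y (delta_mx 0 i) x.
Proof.
move=> Mx; have [_ Yl] := Y_linear; have lin := Yl x Mx.
have Y0 : Y 0 x = 0 by have := lin (-1) 0 0; rewrite scaler0 addr0 scaleN1r addNr.
rewrite {1}(row_sum_delta a); elim/big_rec2: _ => // i v u _ <-.
exact: lin.
Qed.

(** Two extensions differ by a map vanishing on [M], so [tangent_vanish] applies to
    their difference. Hence the choice made in [tderiv] is immaterial. *)
Lemma local_extension_derive b x v h U : open U -> U x -> smooth_on U h ->
  (forall y, M y -> U y -> h y = Y b y) -> M x -> tangent d M x v ->
  tderiv M (Y b) v x = 'D_v h x.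
Proof.
move=> Uo Ux sh hY Mx tv; rewrite /tderiv.
have [vf _] := Y_linear; have [ext _] := vf b.
have ex : exists g0, [set g | local_extension M (Y b) x g] g0 by exact: ext.
case: xgetP => [g0 _ [U' [Uo' Ux' sg gY]]|]; last first.
  by case: ex => g0 H /(_ g0); case.
have dg := smooth_differentiable sg Ux'; have dh := smooth_differentiable sh Ux.
have dgh : differentiable (g0 - h) x by exact: differentiableB.
have := tangent_vanish (openI Uo Uo') (conj Ux Ux') dgh Mx _ tv.
rewrite deriveB; [|exact: diff_derivable..] => H.
apply/eqP; rewrite -subr_eq0; apply/eqP; apply: H => y My [Uy Uy'].
by rewrite !fctE gY // hY // subrr.
Qed.

Lemma adapted_chart_exists m : M m ->
  exists r C f F U, @adapted_chart R N n d M Y m r C f F U.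
Proof.
move=> Mm; have [dN /(_ m Mm)[U0 [F eqF0]]] := M_submanifold.
have [vf _] := Y_linear.
have /choice[f fP] : forall i : 'I_n, exists h,
    local_extension M (Y (delta_mx 0 i)) m h.
  by move=> i; have [ext _] := vf (delta_mx 0 i); exact: ext.
have /choice[V VP] := fP.
pose U1 := \bigcap_(i in [set: 'I_n]) V i.
have U1m : U1 m by move=> i _; case: (VP i).
have U1V i : U1 `<=` V i by move=> x; apply.
have U1o : open U1 by apply: open_bigcap_finType => i; case: (VP i).
have [U0o U0m sF0 surj MU0] := eqF0.
pose U := U0 `&` U1.
have Uo : open U by exact: openI.
have Um : U m by [].
have eqF : local_equation (d := d) M m U F.
  split => //; first by move=> k; apply: Ck_subset (sF0 k); exact: subIsetl.
    by move=> x [Ux _]; exact: surj.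
  by rewrite /U setIA MU0; apply/seteqP; split => x /=; [move=> [[]]|move=> [[]]].
have [_ _ sF _ _] := eqF.
have sf i : smooth_on U (f i).
  move=> k; case: (VP i) => _ _ sfi _; apply: Ck_subset (sfi k).
  by move=> x [_ /U1V]; apply.
have fY i x : M x -> U x -> f i x = Y (delta_mx 0 i) x.
  by move=> Mx [_ /U1V Vx]; case: (VP i) => _ _ _; apply => //; exact: Vx.
have [C1 [r1 [C10 r10 rU FC DFC]]] := smooth_C11D Uo Um sF.
have [||C2 [r2 [C20 r20 P2]]] := @fin_unif R n (fun i C r => C11 (f i) m r C /\
    forall v, C11 (fun x => 'D_v (f i) x) m r (C * `|v|)).
- move=> i C C' r r' CC' /andP[_ rr'] [H1 H2]; split; first exact: C11W H1.
  by move=> v; apply: C11W (H2 v) => //; rewrite ler_wpM2r.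
- move=> i; have [C [r [? ? _ ? ?]]] := smooth_C11D Uo Um (sf i).
  by exists C, r.
have [||C3 [r3 [C30 r30 P3]]] := @fin_unif R n (fun i C r =>
    forall j, C11 (field_deriv f i j) m r C).
- by move=> i C C' r r' CC' /andP[_ rr'] H j; exact: C11W (H j).
- move=> i; have [||C [r [? ? H]]] := @fin_unif R n (fun j C r =>
  C11 (field_deriv f i j) m r C).
  + by move=> j C C' r r' CC' /andP[_ rr'] H; exact: C11W H.
  + move=> j; have [C [r [? ? _ ?]]] := smooth_C11 Uo Um (smooth_field_deriv Uo (sf
    i) (sf j)).
    by exists C, r.
  by exists C, r.
have [C4 [r4 [C40 r40 _ corr]]] := local_correction Mm eqF.
pose C := Num.max (Num.max C1 C2) (Num.max C3 C4).
pose r := Num.min (Num.min r1 r2) (Num.min r3 r4).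
have CC1 : C1 <= C by rewrite !le_max lexx.
have CC2 : C2 <= C by rewrite !le_max lexx !orbT.
have CC3 : C3 <= C by rewrite !le_max lexx !orbT.
have CC4 : C4 <= C by rewrite !le_max lexx !orbT.
have rr1 : r <= r1 by rewrite !ge_min lexx.
have rr2 : r <= r2 by rewrite !ge_min lexx !orbT.
have rr3 : r <= r3 by rewrite !ge_min lexx !orbT.
have rr4 : r <= r4 by rewrite !ge_min lexx !orbT.
have C0 : 0 <= C by exact: le_trans CC1.
have r0 : 0 < r by rewrite !lt_min r10 r20 r30 r40.
have {}rU x : cball m r x -> U x by move=> xr; apply: rU; exact: le_trans rr1.
clearbody C r.
exists r, C, f, F, U; split => //.
- exact: C11W FC.
- by move=> v; apply: C11W (DFC v) => //; rewrite ler_wpM2r.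
- by move=> i; case: (P2 i) => H _; exact: C11W H.
- by move=> i v; case: (P2 i) => _ /(_ v) H; apply: C11W H => //; rewrite ler_wpM2r.
- by move=> i j; exact: C11W (P3 i j).
- move=> i x Mx xr; rewrite fY //; last exact: rU.
  by case: (vf (delta_mx 0 i)) => _; exact.
- move=> a x Mx xr; rewrite Y_sum // /field1; apply: eq_bigr => i _.
  by rewrite fY //; exact: rU.
- move=> A x Mx xr; rewrite /tlift /field2; apply: eq_bigr => i _.
  apply: eq_bigr => j _; congr (_ *: _); rewrite /field_deriv fY //; last exact: rU.
  apply: (@local_extension_derive _ _ _ _ U) => //; first exact: rU.
    by move=> y My Uy; exact: fY.
  by case: (vf (delta_mx 0 i)) => _; exact.
- move=> y yr; have [|y' [My' H]] := corr y; first exact: le_trans rr4.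
  by exists y'; split => //; apply: (le_trans H); rewrite ler_wpM2r.
move=> r' r'r; apply: (@subclosed_compact _ _ (cball m r')).
- move=> y cy.
  have yr : cball m r' y.
    have cl : closed (cball m r') by apply: compact_closed;
      [exact: norm_hausdorff|exact: cball_compact].
    by apply: cl; move=> B /cy[z [[_ zr] Bz]]; exists z.
  have Uy : U y by apply: rU; exact: le_trans r'r.
  split => //; apply/(local_equation0 eqF Uy)/eqP.
  rewrite -normr_le0 leNgt; apply/negP => Fy0.
  have cF : {for y, continuous F}.
    exact: differentiable_continuous (smooth_differentiable sF Uy).
  have /cy[z [[Mz zr] /= zF]] : nbhs y [set z | `|F y - F z| < `|F y|].
    by move: cF => /cvgrPdist_lt/(_ _ Fy0).
  have Uz : U z by apply: rU; exact: le_trans r'r.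
  have Fz : F z = 0 by apply/(local_equation0 eqF Uz).
  by rewrite Fz subr0 ltxx in zF.
- exact: cball_compact.
- by move=> x [].
Qed.

End adapted_chart_exists.

(** * Elementary bounds for the driver and the scheme *)

Section step_bounds.
Context (R : realType) (N n : nat) (m : 'rV[R]_N) (r C : R).
Context (f : 'I_n -> 'rV[R]_N -> 'rV[R]_N).
Hypotheses (C_ge0 : 0 <= C) (fC : forall i, C11 (f i) m r C).
Hypothesis gC : forall i j, C11 (field_deriv f i j) m r C.
Local Notation A := (n%:R * C + n%:R ^+ 2 * C).
Variables (z : 'rV[R]_n) (Z : 'M[R]_n) (eta : R).
Hypotheses (eta01 : 0 <= eta <= 1) (zE : `|z| <= eta) (ZE : `|Z| <= eta ^+ 2).

Lemma step_const_ge0 : 0 <= A.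
Proof. by rewrite addr_ge0 // mulr_ge0 // exprn_ge0. Qed.

Lemma field2_small x : cball m r x -> `|field2 f Z x| <= A * eta ^+ 2.
Proof.
move=> xr; apply: (le_trans (field2_le gC Z xr)).
apply: (@le_trans _ _ (n%:R ^+ 2 * C * eta ^+ 2)).
  by rewrite ler_wpM2l // mulr_ge0 // exprn_ge0.
by rewrite ler_wpM2r ?exprn_ge0 ?lerDr ?mulr_ge0 //; case/andP: eta01.
Qed.

Lemma step_le x : cball m r x -> `|davie_step f z Z x| <= A * eta.
Proof.
move=> xr; have /andP[eta0 eta1] := eta01.
apply: (le_trans (ler_normD _ _)); rewrite mulrDl; apply: lerD.
  by apply: (le_trans (field1_le fC z xr)); rewrite ler_wpM2l // mulr_ge0.
apply: (le_trans (field2_le gC Z xr)); rewrite ler_wpM2l // ?mulr_ge0 ?exprn_ge0 //.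
by apply: (le_trans ZE); rewrite expr2 ler_piMl.
Qed.

Lemma step_lip x y : cball m r x -> cball m r y ->
  `|davie_step f z Z x - davie_step f z Z y| <= A * eta * `|x - y|.
Proof.
move=> xr yr; have /andP[eta0 eta1] := eta01.
rewrite /davie_step opprD addrACA; apply: (le_trans (ler_normD _ _)).
rewrite !mulrDl; apply: lerD.
  apply: (le_trans (field1_lip fC z xr yr)); rewrite ler_wpM2r // ler_wpM2l //.
  by rewrite mulr_ge0.
apply: (le_trans (field2_lip gC Z xr yr)); rewrite ler_wpM2r // ler_wpM2l //.
  by rewrite mulr_ge0 // exprn_ge0.
by apply: (le_trans ZE); rewrite expr2 ler_piMl.
Qed.

End step_bounds.

Lemma small_scale (R : realType) (a b c d : R) :
  0 <= a -> 0 <= b -> 0 <= c -> 0 <= d ->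
  exists e : R, [/\ 0 < e, a * e <= 1, b * e <= 1, c * e <= 1 & d * e <= 1].
Proof.
move=> a0 b0 c0 d0; exists (1 + a + b + c + d)^-1.
have s0 : 0 < 1 + a + b + c + d by lra.
by rewrite invr_gt0 !ler_pdivrMr // !mul1r; split => //; lra.
Qed.

(** As [q < 1/2], there is room for a Lipschitz constant slightly above one in
    the condition on the constants of [discrete_davie]. *)
Lemma half_factor_room (R : realType) (q : R) : 0 <= q -> q < 2^-1 ->
  exists lam : R, 0 < lam /\ q * (1 + (1 + lam) ^+ 2) < 1.
Proof. by move=> q0 q2; exists ((1 - 2 * q) / 3); split; nra. Qed.

Lemma small_products (R : realType) (c A lam r K w e : R) : 1 <= c -> 0 <= A ->
  0 < lam -> 0 < r -> 0 <= K -> 0 <= w -> w <= e ->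
  c * e <= 1 -> c * A / lam * e <= 1 -> 8 * c * A / r * e <= 1 ->
  8 * K / r * e <= 1 ->
  [/\ 0 <= c * w <= 1, A * (c * w) <= lam, A * (c * w) <= r / 8 & K * w ^+ 3 <= r /
    8].
Proof.
move=> c1 A0 l0 r0 K0 w0 we E1 E2 E3 E4.
have c0 : 0 <= c by exact: le_trans c1.
have cw : c * w <= 1 by apply: le_trans E1; rewrite ler_wpM2l.
have w1 : w <= 1 by apply: le_trans cw; rewrite ler_peMl.
split.
- by rewrite cw mulr_ge0.
- move: E2; rewrite mulrAC ler_pdivrMr // mul1r => E2; apply: le_trans E2.
  by rewrite mulrCA mulrA ler_wpM2l // mulr_ge0.
- move: E3; rewrite mulrAC ler_pdivrMr // mul1r => E3.
  rewrite ler_pdivlMr //; apply: le_trans E3.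
  have -> : A * (c * w) * 8 = 8 * c * A * w by ring.
  by rewrite ler_wpM2l // !mulr_ge0.
- move: E4; rewrite mulrAC ler_pdivrMr // mul1r => E4.
  rewrite ler_pdivlMr //; apply: le_trans E4.
  have -> : K * w ^+ 3 * 8 = 8 * K * w ^+ 3 by ring.
  rewrite ler_wpM2l // ?mulr_ge0 //; apply: le_trans we.
  by rewrite exprS ler_piMr // exprn_ile1.
Qed.

Lemma subr_translate (V : zmodType) (x h k l : V) : x + h + k - (x + l) = h + k - l.
Proof. by rewrite -(addrA x h) opprD addrACA subrr add0r. Qed.

Lemma subr_split3 (V : zmodType) (z y k m : V) : z - m = z - (y + k) + (k + (y - m)).
Proof. by rewrite (addrCA k) (addrA y) subrKA. Qed.

Section rde.
Context (R : realType) (T p : R) (omega : R -> R -> R).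
Context (n N d : nat) (M : set 'rV[R]_N).
Context (Y : 'rV[R]_n -> 'rV[R]_N -> 'rV[R]_N) (Z : rpath R n).
Hypotheses (T_gt0 : 0 < T) (p_ge2 : 2 <= p) (p_lt3 : p < 3).
Hypotheses (omega_control : control T omega).
Hypotheses (M_submanifold : submanifold d M).
Hypotheses (Y_linear : linear_vector_fields d M Y) (Z_WG : WG omega p T Z).
Local Notation w := (omw p omega).

Lemma incr_add (k : nat) (X : rpath R k) s u t : incr X s u + incr X u t = incr X s t.
Proof. by rewrite /incr addrC subrKA. Qed.

Lemma incr_diag (k : nat) (X : rpath R k) s : incr X s s = 0.
Proof. by rewrite /incr subrr. Qed.

Lemma level2_diag s : 0 <= s <= T -> level2 Z s s = 0.
Proof.
move=> /andP[s0 sT]; have [_ chen _ _ _] := Z_WG.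
have := chen s s s s0 (lexx s) (lexx s) sT.
rewrite incr_diag /tens trmx0 mul0mx addr0 => H.
by apply: (addrI (level2 Z s s)); rewrite addr0 -H.
Qed.

Lemma level2_sym s t i j : 0 <= s -> s <= t -> t <= T ->
  level2 Z s t i j + level2 Z s t j i = incr Z s t 0 i * incr Z s t 0 j.
Proof.
move=> s0 st tT; have [_ _ _ _ sym] := Z_WG.
have half0 : (2^-1 : R) != 0 by rewrite invr_eq0 pnatr_eq0.
have /matrixP/(_ i j) := scalerI half0 (sym s t s0 st tT).
by rewrite !mxE big_ord1 !mxE.
Qed.

Lemma driver_bounds : exists c : R, 1 <= c /\ forall s t, 0 <= s -> s <= t ->
  t <= T ->
  `|incr Z s t| <= c * w s t /\ `|level2 Z s t| <= (c * w s t) ^+ 2.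
Proof.
have [_ _ [c1 H1] [c2 H2] _] := Z_WG.
exists (Num.max 1 (Num.max c1 c2)); set c := Num.max 1 _.
have c1' : 1 <= c by rewrite le_max lexx.
have cc1 : c1 <= c by rewrite !le_max lexx !orbT.
have cc2 : c2 <= c by rewrite !le_max lexx !orbT.
clearbody c.
split => // s t s0; rewrite le_eqVlt => /orP[/eqP<- sT|st tT].
  by rewrite incr_diag level2_diag ?s0 //
    !normr0 (omw_diag p_ge2 omega_control) ?s0 // mulr0 expr0n.
have w0 : 0 < w s t by exact: (omw_gt0 p omega_control s0 st tT).
have om0 : 0 <= omega s t by exact: (omega_ge0 omega_control s0 (ltW st) tT).
split.
  have := H1 s t s0 st tT; rewrite -/(w s t) ler_pdivrMr // => H.
  by apply: (le_trans H); rewrite ler_wpM2r // ltW.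
have := H2 s t s0 st tT;
  rewrite (powR_omw p (k:=2) isT om0) ler_pdivrMr ?exprn_gt0 // => H.
apply: (le_trans H); rewrite exprMn ler_wpM2r ?exprn_ge0 ?(ltW w0) //.
by apply: (le_trans cc2); rewrite expr2 ler_peMr // (le_trans ler01).
Qed.

Definition davie_incr s t x : 'rV[R]_N :=
  Y (incr Z s t) x +
  tlift (fun a b => tderiv M (Y b) (Y a x) x) (level2 Z s t).

Definition davie_err (x : R -> 'rV[R]_N) s t := x t - x s - davie_incr s t (x s).

Lemma chart_davie_incr m r C f F U s t x :
  @adapted_chart R N n d M Y m r C f F U -> M x -> cball m r x ->
  davie_incr s t x = davie_step f (incr Z s t) (level2 Z s t) x.
Proof.
move=> ch Mx xr; rewrite /davie_incr /davie_step.
by rewrite (chart_field1 ch _ Mx xr) (chart_field2 ch _ Mx xr).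
Qed.

(** * Local existence *)

Local Notation err := davie_err.

Lemma davie_existence_control (V : normedModType R) (a b : R)
    (D : R -> R -> V -> V) (G S : set V) (L C1 C2 K : R) (x0 : V) :
  0 <= a -> a <= b -> b <= T -> 0 <= L -> 0 <= K -> 0 <= C1 -> 0 <= C2 ->
  K * half_factor p * (1 + L ^+ 2) + (L * C1 + L * C2 + C2) <= K ->
  (forall s x, a <= s <= b -> D s s x = x) ->
  (forall s t x y, a <= s -> s <= t -> t <= b ->
    `|D s t x - D s t y| <= L * `|x - y|) ->
  (forall s u t x, a <= s -> s <= u -> u <= t -> t <= b -> G x ->
    `|D u t (D s u x) - D s t x| <= C2 * w s t ^+ 3) ->
  (forall s t x, a <= s -> s <= t -> t <= b -> G x ->
    exists y, S y /\ `|y - D s t x| <= C1 * w s t ^+ 3) ->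
  G x0 ->
  (forall t y, a <= t <= b -> S y -> `|y - D a t x0| <= K * w a t ^+ 3 -> G y) ->
  compact G ->
  exists X : R -> V, [/\ X a = x0, forall r, G (X r) &
    forall s t, a <= s -> s <= t -> t <= b ->
      `|X t - D s t (X s)| <= K * w s t ^+ 3].
Proof.
move=> a0 ab bT L0 K0 C10 C20 KE Did Dlip Ddef Dstep Gx0 Gst Gc.
apply: (@davie_existence R V a b omega (fun s t => w s t ^+ 3) (half_factor p)
  ab _ _ _ _ _ _ D G S L C1 C2 K) => //.
- by move=> s t sa st tb;
  apply: (omega_ge0 omega_control (le_trans a0 sa) st (le_trans tb bT)).
- move=> s /andP[sa sb]; apply: (omega_diag omega_control).
  by rewrite (le_trans a0 sa) (le_trans sb bT).
- move=> s u t sa su ut tb.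
  exact: (omega_super omega_control (le_trans a0 sa) su ut (le_trans tb bT)).
- move=> s t s' t' sa ss st tt tb.
  exact: (omw_half p_ge2 omega_control (le_trans a0 sa) ss st tt (le_trans tb bT)).
- move=> s t s' t' sa ss st tt tb; apply: lerXn2r; rewrite ?nnegrE ?omw_ge0 //.
  exact: (omw_mono p_ge2 omega_control (le_trans a0 sa) ss st tt (le_trans tb bT)).
- by move=> *; rewrite exprn_ge0 ?omw_ge0.
Qed.

Lemma step0 f (x : 'rV[R]_N) : davie_step f (0 : 'rV[R]_n) 0 x = 0.
Proof.
rewrite /davie_step /field1 /field2 big1 => [|i _]; last by rewrite mxE scale0r.
by rewrite add0r big1 // => i _; rewrite big1 // => j _; rewrite mxE scale0r.
Qed.

(** [davie_existence] for the scheme [x + davie_step], with [G] the part of [M] in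
    the ball of radius [r / 2]: [omw] is so small on the interval that the path
    cannot leave [G]. The neighbourhood [e] serves all starting times and points
    near [(tau, m)]. *)
Lemma local_solution tau m : 0 <= tau <= T -> M m ->
  exists e : R, 0 < e /\ forall a b y, 0 <= a -> a <= b -> b <= T ->
    `|a - tau| < e -> `|b - tau| < e -> M y -> `|y - m| < e ->
    exists x : R -> 'rV[R]_N, [/\ x a = y, forall t, M (x t) &
      exists K, 0 <= K /\ forall s t, a <= s -> s <= t -> t <= b ->
        `|x t - x s| <= K * w s t /\ `|err x s t| <= K * w s t ^+ 3].
Proof.
move=> tau0T Mm.
have [r [C [f [F [U ch]]]]] := adapted_chart_exists M_submanifold Y_linear Mm.
have [c [c1 drv]] := driver_bounds.
have r0 := chart_r ch; have C0 := chart_C ch.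
have fC := chart_f ch; have gC := chart_deriv ch.
set A := n%:R * C + n%:R ^+ 2 * C.
have A0 : 0 <= A by exact: step_const_ge0.
have q0 := half_factor_ge0 p; have q2 := half_factor_lt p_ge2 p_lt3.
(* On a short interval the scheme is Lipschitz with constant [1 + lam]. *)
have [lam [lam0 qlam]] := half_factor_room q0 q2.
have c0 : 0 <= c by exact: le_trans c1.
pose C1 := C * (C * (A ^+ 3 + A ^+ 2)) * c ^+ 3.
pose C2 := (n%:R * C * (A ^+ 2 + A) + n%:R ^+ 2 * C * A) * c ^+ 3.
have C10 : 0 <= C1 by rewrite /C1 !(mulr_ge0, addr_ge0, exprn_ge0).
have C20 : 0 <= C2 by rewrite /C2 !(mulr_ge0, addr_ge0, exprn_ge0).
pose L := 1 + lam.
have L0 : 0 <= L by rewrite addr_ge0 // ltW.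
(* The condition on the constants in [discrete_davie] becomes an equality. *)
pose K := (L * C1 + L * C2 + C2) / (1 - half_factor p * (1 + L ^+ 2)).
have K0 : 0 <= K.
  by rewrite divr_ge0 ?subr_ge0 ?(ltW qlam) // !addr_ge0 // mulr_ge0.
have KE : K * half_factor p * (1 + L ^+ 2) + (L * C1 + L * C2 + C2) <= K.
  have D0 : 1 - half_factor p * (1 + L ^+ 2) != 0 by rewrite subr_eq0 gt_eqF.
  rewrite -[X in _ + X](divfK D0) -/K -mulrA -mulrDr.
  by rewrite [X in K * X](_ : _ = 1) ?mulr1 // addrC subrK.
have [e1 [e10 E1 E2 E3 E4]] := small_scale c0 (divr_ge0 (mulr_ge0 c0 A0) (ltW lam0))
  (divr_ge0 (mulr_ge0 (mulr_ge0 (ler0n R 8) c0) A0) (ltW r0))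
  (divr_ge0 (mulr_ge0 (ler0n R 8) K0) (ltW r0)).
have [e2 [e20 small]] := omw_eps p_ge2 omega_control tau0T e10.
exists (Num.min e2 (r / 8)); split; first by rewrite lt_min e20 divr_gt0.
move=> a b y a0 ab bT; rewrite !lt_min => /andP[ae _] /andP[be _] My /andP[_ ym].
have wE s t : a <= s -> s <= t -> t <= b -> [/\ 0 <= c * w s t <= 1,
    A * (c * w s t) <= lam, A * (c * w s t) <= r / 8 & K * w s t ^+ 3 <= r / 8].
  move=> sa st tb;
    apply: (small_products c1 A0 lam0 r0 K0 (omw_ge0 _ _ _ _) _ E1 E2 E3 E4).
  apply: le_trans (small a b a0 ab bT ae be).
  exact: (omw_mono p_ge2 omega_control a0 sa st tb bT).
clearbody K.
pose D s t x : 'rV[R]_N := x + davie_step f (incr Z s t) (level2 Z s t) (clamp m r x).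
pose G : set 'rV[R]_N := M `&` cball m (r / 2).
have r8 : r / 8 <= r / 2 by lra.
have r28 : r / 2 + r / 8 <= r by lra.
have r3 : r / 8 + (r / 8 + r / 8) <= r / 2 by lra.
have r2 : r / 2 < r by lra.
have clG x : cball m (r / 2) x -> clamp m r x = x.
  by move=> xr; apply: clamp_id; rewrite ?ltW // /cball /= (le_trans xr) // ltW.
have segG x : cball m (r / 2) x -> cball m r x.
  by move=> xr; rewrite /cball /= (le_trans xr) // ltW.
have dr s t : a <= s -> s <= t -> t <= b -> `|incr Z s t| <= c * w s t /\
    `|level2 Z s t| <= (c * w s t) ^+ 2.
  move=> sa st tb; exact: drv (le_trans a0 sa) st (le_trans tb bT).
have stepG s t x : a <= s -> s <= t -> t <= b -> cball m r x ->
    `|davie_step f (incr Z s t) (level2 Z s t) x| <= A * (c * w s t).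
  move=> sa st tb xG; have [d1 d2] := dr s t sa st tb.
  have [cw _ _ _] := wE s t sa st tb.
  exact: (step_le C0 fC gC cw d1 d2 xG).
have moveG s t x : a <= s -> s <= t -> t <= b -> cball m (r / 2) x ->
    cball m r (x + davie_step f (incr Z s t) (level2 Z s t) x).
  move=> sa st tb xG; rewrite /cball /= addrAC (le_trans (ler_normD _ _)) //.
  apply: le_trans r28; apply: lerD => //.
  by have [_ _ + _] := wE s t sa st tb; apply: le_trans; apply: stepG => //;
    apply: segG.
have [x [xa xG xK]] : exists x : R -> 'rV[R]_N, [/\ x a = y, forall t, G (x t) &
    forall s t, a <= s -> s <= t -> t <= b ->
      `|x t - D s t (x s)| <= K * w s t ^+ 3].
  apply: (@davie_existence_control 'rV[R]_N a b D G M L C1 C2 K) => //.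
  - move=> s x /andP[sa sb].
    rewrite /D incr_diag level2_diag ?step0 ?addr0 //.
    by rewrite (le_trans a0 sa) (le_trans sb bT).
  - move=> s t x x' sa st tb; rewrite /D opprD addrACA.
    apply: (le_trans (ler_normD _ _)); rewrite /L mulrDl mul1r lerD //.
    have [d1 d2] := dr s t sa st tb; have [cw cl _ _] := wE s t sa st tb.
    apply: (le_trans (step_lip C0 fC gC cw d1 d2 (clamp_cball _ (ltW r0) _)
      (clamp_cball _ (ltW r0) _))).
    apply: (@le_trans _ _ (lam * `|clamp m r x - clamp m r x'|)).
      by rewrite ler_wpM2r.
    by rewrite ler_wpM2l ?(ltW lam0) // clamp_lip // ltW.
  - move=> s u t x sa su ut tb [Mx xG].
    have sb := le_trans ut tb; have st := le_trans su ut; have ua := le_trans sa su.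
    pose h := davie_step f (incr Z s u) (level2 Z s u) x.
    have xh : cball m r (x + h) by exact: moveG.
    have -> : D u t (D s u x) - D s t x = step_remainder f (incr Z u t) (level2 Z u
      t) x h (field2 f (level2 Z s u) x).
      have hE : h = field1 f (incr Z s u) x + field2 f (level2 Z s u) x by [].
      rewrite -(step_compose fC (level2 Z s u) (incr Z u t) (level2 Z u t) (segG x
        xG) hE).
      have [_ chen _ _ _] := Z_WG.
      rewrite (incr_add Z) -(chen s u t (le_trans a0 sa) su ut (le_trans tb bT)).
      rewrite /D (clG x xG) (clamp_id xh) -/h.
      exact: subr_translate.
    have [d1 d2] := dr s u sa su sb; have [d1' d2'] := dr u t ua ut tb.
    have [/andP[cw0 cw1] _ _ _] := wE s t sa st tb.
    have m1 : c * w s u <= c * w s t.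
      by rewrite ler_wpM2l // (omw_mono p_ge2 omega_control (le_trans a0 sa)) //
        (le_trans tb bT).
    have m2 : c * w u t <= c * w s t.
      by rewrite ler_wpM2l // (omw_mono p_ge2 omega_control (le_trans a0 sa)) //
        (le_trans tb bT).
    have sq1 : (c * w s u) ^+ 2 <= (c * w s t) ^+ 2.
      by rewrite lerXn2r ?nnegrE ?mulr_ge0 ?omw_ge0.
    have sq2 : (c * w u t) ^+ 2 <= (c * w s t) ^+ 2.
      by rewrite lerXn2r ?nnegrE ?mulr_ge0 ?omw_ge0.
    have cw01 : 0 <= c * w s t <= 1 by rewrite cw0 cw1.
    have := step_remainder_le C0 fC gC cw0 A0 (le_trans d1' m2) (le_trans d2' sq2)
      (segG x xG) xh
      (step_le C0 fC gC cw01 (le_trans d1 m1) (le_trans d2 sq1) (segG x xG))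
      (field2_small C0 gC cw01 (le_trans d2 sq1) (segG x xG)).
    by rewrite (exprMn _ c) mulrA.
  - move=> s t x sa st tb [Mx xG]; rewrite /D (clG x xG).
    have [y' [My' y'E]] := chart_correct ch (moveG s t x sa st tb xG).
    exists y'; split => //; apply: (le_trans y'E).
    have [d1 d2] := dr s t sa st tb; have [cw _ _ _] := wE s t sa st tb.
    have xr : `|x - m| < r by apply: le_lt_trans r2.
    have Hs i j : level2 Z s t i j + level2 Z s t j i = incr Z s t 0 i * incr Z s t
      0 j.
      exact: level2_sym (le_trans a0 sa) st (le_trans tb bT).
    have := step_near_manifold C0 (chart_eq ch) (chart_U ch) (chart_F ch) (chart_DF
      ch) fC gC (chart_tangent ch) Mx xr cw d1 d2 Hs (moveG s t x sa st tb xG).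
    move=> H; apply: (le_trans (ler_wpM2l C0 H)).
    by rewrite /C1 (exprMn _ c) !mulrA.
  - split=> //; rewrite /cball /= (le_trans (ltW ym)) //.
  - move=> t z /andP[ta tb] Mz zK; split => //; rewrite /cball /=.
    have yG : cball m (r / 2) y by rewrite /cball /= (le_trans (ltW ym)).
    have [_ _ H1 H2] := wE a t (lexx a) ta tb.
    have -> : z - m = (z - D a t y) + (davie_step f (incr Z a t) (level2 Z a t) y +
      (y - m)).
      by rewrite /D (clG y yG); exact: subr_split3.
    apply: (le_trans (ler_normD _ _)); apply: le_trans r3; apply: lerD.
      exact: le_trans zK H2.
    apply: (le_trans (ler_normD _ _)); apply: lerD; last exact: ltW.
    by apply: le_trans H1; apply: stepG => //; apply: segG.
  - apply: (chart_compact ch); exact: ltW.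
exists x; split => // [t|]; first by case: (xG t).
exists (A * c + K); split => [|s t sa st tb]; first by rewrite addr_ge0 // mulr_ge0.
have [Mx xs] := xG s; have w0 : 0 <= w s t by exact: omw_ge0.
have [/andP[_ cw1] _ _ _] := wE s t sa st tb.
have w1 : w s t <= 1 by apply: le_trans cw1; rewrite ler_peMl.
have xst : `|x t - x s - davie_step f (incr Z s t) (level2 Z s t) (x s)| <= K * w s
  t ^+ 3.
  by have := xK s t sa st tb; rewrite /D (clG _ xs) opprD addrA.
split; last first.
  rewrite /davie_err (chart_davie_incr _ _ ch Mx (segG _ xs)).
  by apply: (le_trans xst); rewrite ler_wpM2r ?exprn_ge0 // lerDr mulr_ge0.
rewrite -(subrK (davie_step f (incr Z s t) (level2 Z s t) (x s)) (x t - x s)).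
rewrite addrC (le_trans (ler_normD _ _)) // mulrDl lerD //.
  by rewrite -mulrA; apply: stepG => //; apply: segG.
by apply: (le_trans xst); rewrite ler_wpM2l // exprS ler_piMr // exprn_ile1.
Qed.

(** * Local uniqueness *)

Lemma contraction_factor (q : R) : q < 2^-1 ->
  2 * q + (2^-1 - q) < 1 /\ 1 - (2 * q + (2^-1 - q)) = 2^-1 - q.
Proof. by move=> q2; split; [lra | field]. Qed.

Lemma common_bound (A0 K : R) : 0 <= A0 -> 0 <= K ->
  exists A, [/\ 1 <= A, A0 <= A & A0 + K <= A].
Proof. by move=> a0 k0; exists (1 + A0 + K); split; lra. Qed.

Lemma unique_products (c B0 lam P u e : R) : 1 <= c -> 0 <= B0 -> 0 < lam ->
  0 <= P -> 0 <= u -> u <= e ->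
  c * e <= 1 -> B0 * c / lam * e <= 1 -> 2 * P * e <= 1 ->
  [/\ 0 <= c * u <= 1, B0 * (c * u) <= lam & P * u ^+ 3 <= 2^-1].
Proof.
move=> c1 B00 lam0 P0 u0 ue E1 E2 E3.
have c0 : 0 <= c by exact: le_trans c1.
have cu : c * u <= 1 by apply: le_trans E1; rewrite ler_wpM2l.
have u1 : u <= 1 by apply: le_trans cu; rewrite ler_peMl.
split.
- by rewrite cu mulr_ge0.
- move: E2; rewrite mulrAC ler_pdivrMr // mul1r => E2; apply: le_trans E2.
  by rewrite mulrA ler_wpM2l // mulr_ge0.
- rewrite -[2^-1]mul1r ler_pdivlMr // mulrC mulrA; apply: le_trans E3.
  rewrite ler_wpM2l ?mulr_ge0 //; apply: le_trans ue.
  by rewrite exprS ler_piMr // exprn_ile1.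
Qed.

Lemma cube_small (K u v eta : R) : 0 <= K -> 0 <= u -> u <= v -> v <= eta ->
  eta <= 1 -> K * u ^+ 3 <= K * eta ^+ 2 /\ K * u ^+ 3 <= K * eta.
Proof.
move=> K0 u0 uv ve e1.
have ue := le_trans uv ve; have eta0 := le_trans u0 ue.
have u3 : u ^+ 3 <= eta ^+ 2.
  apply: (@le_trans _ _ (u ^+ 2)); last by rewrite lerXn2r.
  by rewrite exprS ler_piMl ?exprn_ge0 // (le_trans ue).
split; first by rewrite ler_wpM2l.
by rewrite ler_wpM2l // (le_trans u3) // expr2 ler_piMr.
Qed.

Lemma lipschitz_sum (A0 A b dl rho : R) : A0 <= A -> 1 <= A -> 0 <= b -> 0 <= dl ->
  0 <= rho -> A0 * b * dl + rho <= A * (b * dl + rho).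
Proof.
move=> AA A1 b0 d0 r0; rewrite mulrDr -mulrA lerD //; last by rewrite ler_peMl.
by rewrite ler_wpM2r // mulr_ge0.
Qed.

Lemma defect_arith (b c u v dl Q lam : R) : b * (c * u) <= lam -> 0 <= Q ->
  0 <= v -> v = u ^+ 3 ->
  b * ((c * u) ^+ 3 * dl + c * u * (Q * v)) <= (b * c ^+ 3 * dl + lam * Q) * v.
Proof.
move=> bl Q0 v0 vE; rewrite mulrDr mulrDl; apply: lerD.
  by rewrite exprMn vE; rewrite (_ : _ * _ = b * c ^+ 3 * dl * u ^+ 3) //; ring.
by rewrite [leLHS]mulrA -[leRHS]mulrA ler_wpM2r // mulr_ge0.
Qed.

Lemma defect_algebra (xs xu xt k l q : 'rV[R]_N) :
  xt - xs - q - (xu - xs - k) - (xt - xu - l) = k + l - q.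
Proof. by apply/matrixP => i j; rewrite !mxE; ring. Qed.

Lemma cancel_common (a a' b c : 'rV[R]_N) : a - b - c - (a' - b - c) = a - a'.
Proof. by apply/matrixP => i j; rewrite !mxE; ring. Qed.

Lemma double_diff (a b c a' b' c' : 'rV[R]_N) :
  a - b - c - (a' - b' - c') = a - a' - (b - b') - (c - c').
Proof. by apply/matrixP => i j; rewrite !mxE; ring. Qed.

Definition err_diff (x y : R -> 'rV[R]_N) s t : 'rV[R]_N := err x s t - err y s t.

Lemma err_diff_defect x y s u t :
  err_diff x y s t - err_diff x y s u - err_diff x y u t =
  err x s t - err x s u - err x u t - (err y s t - err y s u - err y u t).
Proof.
rewrite /err_diff; move: (err x s t) (err x s u) (err x u t) => a b c.
by move: (err y s t) (err y s u) (err y u t) => a' b' c'; rewrite double_diff.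
Qed.

(** The first step is taken with the true increment [x u - x s], whose second-order
    part includes the Davie error. *)
Lemma err_defect m r C f F U (x : R -> 'rV[R]_N) s u t :
  @adapted_chart R N n d M Y m r C f F U ->
  0 <= s -> s <= u -> u <= t -> t <= T ->
  M (x s) -> M (x u) -> cball m r (x s) -> cball m r (x u) ->
  err x s t - err x s u - err x u t =
  step_remainder f (incr Z u t) (level2 Z u t) (x s) (x u - x s)
    (field2 f (level2 Z s u) (x s) + err x s u).
Proof.
move=> ch s0 su ut tT Ms Mu xs xu.
have hE : x u - x s = field1 f (incr Z s u) (x s) +
    (field2 f (level2 Z s u) (x s) + err x s u).
  rewrite addrA -/(davie_step f _ _ _) -(chart_davie_incr _ _ ch Ms xs).
  by rewrite /davie_err addrC subrK.
rewrite -(step_compose (chart_f ch) (level2 Z s u) (incr Z u t) (level2 Z u t) xs hE).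
have [_ chen _ _ _] := Z_WG.
rewrite incr_add -(chen s u t s0 su ut tT) /davie_err defect_algebra.
rewrite (chart_davie_incr _ _ ch Ms xs) (chart_davie_incr _ _ ch Ms xs).
by rewrite (chart_davie_incr _ _ ch Mu xu) [x s + _]addrC subrK.
Qed.

Lemma err_diff_remainder m r C f F U (x y : R -> 'rV[R]_N) s u t :
  @adapted_chart R N n d M Y m r C f F U ->
  0 <= s -> s <= u -> u <= t -> t <= T ->
  M (x s) -> M (y s) -> M (x u) -> M (y u) ->
  cball m r (x s) -> cball m r (y s) -> cball m r (x u) -> cball m r (y u) ->
  err_diff x y s t - err_diff x y s u - err_diff x y u t =
  step_remainder f (incr Z u t) (level2 Z u t) (x s) (x u - x s)
    (field2 f (level2 Z s u) (x s) + err x s u) -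
  step_remainder f (incr Z u t) (level2 Z u t) (y s) (y u - y s)
    (field2 f (level2 Z s u) (y s) + err y s u).
Proof.
move=> ch s0 su ut tT Mxs Mys Mxu Myu xs ys xu yu.
rewrite err_diff_defect; congr (_ - _).
  exact: (err_defect ch s0 su ut tT Mxs Mxu xs xu).
exact: (err_defect ch s0 su ut tT Mys Myu ys yu).
Qed.

Lemma err_step m r C f F U (x : R -> 'rV[R]_N) s u :
  @adapted_chart R N n d M Y m r C f F U -> M (x s) -> cball m r (x s) ->
  x u - x s = davie_step f (incr Z s u) (level2 Z s u) (x s) + err x s u.
Proof.
move=> ch Ms xs; rewrite -(chart_davie_incr _ _ ch Ms xs).
by rewrite /davie_err [RHS]addrC subrK.
Qed.

(** Let [Dl] be the difference of the Davie errors. If the paths are [dl] apart and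
    [Dl] is bounded by [Q w^3], then [step_remainder_diff] bounds the defect of [Dl] by
    [(B0 c^3 dl + lam Q) w^3], and [contraction_bound] yields [Dl <= P dl w^3]. As
    the paths start from the same point, their distance equals [Dl], hence is at
    most [dl / 2]; a second use of [contraction_bound] shows that it is zero. The
    constant [K] of the two paths is fixed first because [e] depends on it. *)
Lemma local_unique K tau m : 0 <= K -> 0 <= tau <= T -> M m ->
  exists e : R, 0 < e /\ forall a b (x y : R -> 'rV[R]_N),
    0 <= a -> a <= b -> b <= T -> `|a - tau| < e -> `|b - tau| < e ->
    (forall t, a <= t <= b ->
      [/\ M (x t), M (y t), `|x t - m| < e & `|y t - m| < e]) ->
    x a = y a ->
    (forall s t, a <= s -> s <= t -> t <= b ->
      `|err x s t| <= K * w s t ^+ 3 /\ `|err y s t| <= K * w s t ^+ 3) ->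
    forall t, a <= t <= b -> x t = y t.
Proof.
move=> K0 tau0T Mm.
have [r [C [f [F [U ch]]]]] := adapted_chart_exists M_submanifold Y_linear Mm.
have [c [c1 drv]] := driver_bounds.
have r0 := chart_r ch; have C0 := chart_C ch.
have fC := chart_f ch; have dfC := chart_Df ch; have gC := chart_deriv ch.
set A0 := n%:R * C + n%:R ^+ 2 * C.
have A00 : 0 <= A0 by exact: step_const_ge0.
have A0E : A0 = n%:R * C + n%:R ^+ 2 * C by [].
have q0 := half_factor_ge0 p; have q2 := half_factor_lt p_ge2 p_lt3.
have c0 : 0 <= c by exact: le_trans c1.
have [A [A1 AA0 AK]] := common_bound A00 K0.
pose B0 := 6 * n%:R * C * A ^+ 3 + 3 * n%:R ^+ 2 * C * A ^+ 2.
have B0E : B0 = 6 * n%:R * C * A ^+ 3 + 3 * n%:R ^+ 2 * C * A ^+ 2 by [].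
have A_ge0 : 0 <= A by exact: le_trans A1.
have B00 : 0 <= B0 by rewrite /B0 !(mulr_ge0, addr_ge0, exprn_ge0).
pose lam := 2^-1 - half_factor p.
have lam0 : 0 < lam by rewrite subr_gt0.
(* The fixed point of the contraction for [Dl], relative to [dl]. *)
pose P := B0 * c ^+ 3 / lam.
have P0 : 0 <= P by rewrite /P divr_ge0 ?mulr_ge0 ?exprn_ge0 // ltW.
have [e1 [e10 E1 E2 E3 _]] := small_scale c0 (divr_ge0 (mulr_ge0 B00 c0) (ltW lam0))
  (mulr_ge0 (ler0n R 2) P0) (lexx (0:R)).
have [e2 [e20 small]] := omw_eps p_ge2 omega_control tau0T e10.
exists (Num.min e2 r); split; first by rewrite lt_min e20.
move=> a b x y a0 ab bT; rewrite !lt_min => /andP[ae _] /andP[be _] xy xya xyE.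
have M_ t : a <= t <= b -> [/\ M (x t), M (y t), cball m r (x t) & cball m r (y t)].
  by move=> /xy [Mx My]; rewrite !lt_min => /andP[_ /ltW xr] /andP[_ /ltW yr].
have wE s t : a <= s -> s <= t -> t <= b -> [/\ 0 <= c * w s t <= 1,
    B0 * (c * w s t) <= lam & P * w s t ^+ 3 <= 2^-1].
  move=> sa st tb;
    apply: (unique_products c1 B00 lam0 P0 (omw_ge0 _ _ _ _) _ E1 E2 E3).
  apply: le_trans (small a b a0 ab bT ae be).
  exact: (omw_mono p_ge2 omega_control a0 sa st tb bT).
have dr s t : a <= s -> s <= t -> t <= b -> `|incr Z s t| <= c * w s t /\
    `|level2 Z s t| <= (c * w s t) ^+ 2.
  move=> sa st tb; exact: drv (le_trans a0 sa) st (le_trans tb bT).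
have PE : P * lam = B0 * c ^+ 3 by rewrite /P divfK // gt_eqF.
have [l1 l2] := contraction_factor q2.
rewrite -/lam in l1 l2; clearbody P B0 A0 lam.
pose Dl := err_diff x y.
have ErrK s t : a <= s -> s <= t -> t <= b -> `|Dl s t| <= K * 2 * w s t ^+ 3.
  move=> sa st tb; have [h1 h2] := xyE s t sa st tb.
  apply: (le_trans (ler_normB _ _)); apply: (le_trans (lerD h1 h2)).
  by rewrite [leRHS]mulrAC mulr_natr mulr2n.
have defect dl Q : 0 <= dl -> 0 <= Q ->
    (forall t, a <= t <= b -> `|x t - y t| <= dl) ->
    (forall s t, a <= s -> s <= t -> t <= b -> `|Dl s t| <= Q * w s t ^+ 3) ->
    forall s u t, a <= s -> s <= u -> u <= t -> t <= b ->
    `|Dl s t - Dl s u - Dl u t| <= (B0 * c ^+ 3 * dl + lam * Q) * w s t ^+ 3.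
  move=> dl0 Q0 xydl DlQ s u t sa su ut tb.
  have sb := le_trans ut tb; have st := le_trans su ut; have ua := le_trans sa su.
  have sab : a <= s <= b by rewrite sa (le_trans su).
  have uab : a <= u <= b by rewrite ua.
  have tT := le_trans tb bT; have s0 := le_trans a0 sa.
  have [Mxs Mys xs ys] := M_ s sab; have [Mxu Myu xu yu] := M_ u uab.
  have [/andP[cw0 cw1] Bw _] := wE s t sa st tb.
  have w0 : 0 <= w s t by exact: omw_ge0.
  have m1 : w s u <= w s t by exact: (omw_mono p_ge2 omega_control s0).
  have m2 : w u t <= w s t by exact: (omw_mono p_ge2 omega_control s0).
  have wc : w s t <= c * w s t by rewrite ler_peMl.
  have [d1 d2] := dr s u sa su sb; have [d1' d2'] := dr u t ua ut tb.
  have mono v : v <= w s t -> 0 <= v -> c * v <= c * w s t /\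
    (c * v) ^+ 2 <= (c * w s t) ^+ 2.
    by move=> vw v0; split;
      [rewrite ler_wpM2l | rewrite lerXn2r ?nnegrE ?mulr_ge0 // ler_wpM2l].
  have [n1 n2] := mono _ m1 (omw_ge0 _ _ _ _);
    have [n1' n2'] := mono _ m2 (omw_ge0 _ _ _ _).
  have [k1 k2] := cube_small K0 (omw_ge0 _ _ _ _) m1 wc cw1.
  have [ex ey] := xyE s u sa su sb.
  have eta01 : 0 <= c * w s t <= 1 by rewrite cw0 cw1.
  have rho0 : 0 <= Q * w s t ^+ 3 by rewrite mulr_ge0 ?exprn_ge0.
  have Dsu : `|Dl s u| <= Q * w s t ^+ 3.
    apply: (le_trans (DlQ s u sa su sb)); rewrite ler_wpM2l //.
    by rewrite lerXn2r ?nnegrE ?omw_ge0.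
  have zst := le_trans d1 n1; have Zst := le_trans d2 n2.
  have zst' := le_trans d1' n1'; have Zst' := le_trans d2' n2'.
  have hx := err_step u ch Mxs xs; have hy := err_step u ch Mys ys.
  have xs_u : cball m r (x s + (x u - x s)) by rewrite addrC subrK.
  have ys_u : cball m r (y s + (y u - y s)) by rewrite addrC subrK.
  have dxy := xydl s sab.
  have step_len v : M v -> forall z, cball m r v -> `|z| <= K * w s u ^+ 3 ->
      `|davie_step f (incr Z s u) (level2 Z s u) v + z| <= A * (c * w s t).
    move=> Mv z vr zK; apply: (le_trans (ler_normD _ _)).
    apply: (le_trans (lerD (step_le C0 fC gC eta01 zst Zst vr) (le_trans zK k2))).
    by rewrite -mulrDl -A0E ler_wpM2r.
  have := step_remainder_diff (e := field2 f (level2 Z s u) (x s) + err x s u)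
    (e' := field2 f (level2 Z s u) (y s) + err y s u)
    C0 fC dfC gC eta01 A1 dl0 rho0 zst' Zst' xs xs_u ys ys_u
    _ _ _ dxy _ _.
  rewrite -B0E /Dl (err_diff_remainder ch s0 su ut tT Mxs Mys Mxu Myu xs ys xu yu).
  move=> H; apply: (le_trans (H _ _ _ _ _)) => {H}.
  - by rewrite hx; exact: (step_len (x s) Mxs (err x s u) xs ex).
  - by rewrite hy; exact: (step_len (y s) Mys (err y s u) ys ey).
  - apply: (le_trans (ler_normD _ _)).
    apply: (le_trans (lerD (field2_small C0 gC eta01 Zst ys) (le_trans ey k1))).
    by rewrite -mulrDl -A0E ler_wpM2r ?exprn_ge0.
  - rewrite hx hy opprD addrACA; apply: (le_trans (ler_normD _ _)).
    apply: (le_trans (lerD (step_lip C0 fC gC eta01 zst Zst xs ys) Dsu)).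
    apply: le_trans (lipschitz_sum AA0 A1 cw0 dl0 rho0).
    by rewrite lerD2r -A0E ler_wpM2l // mulr_ge0.
  - rewrite opprD addrACA; apply: (le_trans (ler_normD _ _)).
    apply: (le_trans (lerD (field2_lip gC _ xs ys) Dsu)).
    apply: le_trans (lipschitz_sum AA0 A1 (exprn_ge0 2 cw0) dl0 rho0).
    rewrite lerD2r; apply: ler_pM => //; first by rewrite !mulr_ge0 ?exprn_ge0.
    apply: ler_pM => //; first by rewrite mulr_ge0 ?exprn_ge0.
    by rewrite A0E lerDr mulr_ge0.
  - by apply: defect_arith; rewrite ?exprn_ge0.
have close dl : 0 <= dl -> (forall t, a <= t <= b -> `|x t - y t| <= dl) ->
    forall s t, a <= s -> s <= t -> t <= b -> `|Dl s t| <= P * dl * w s t ^+ 3.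
  move=> dl0 xydl s t sa st tb.
  have := @contraction_bound R (R * R)%type
    (fun u => [/\ a <= u.1, u.1 <= u.2 & u.2 <= b]) (fun u => `|Dl u.1 u.2|)
    (fun u => w u.1 u.2 ^+ 3) (2 * half_factor p + lam) (B0 * c ^+ 3 * dl) (K * 2).
  rewrite l2 -PE [X in X / lam](mulrAC P) mulfK ?gt_eqF // => H.
  apply: (H _ _ _ _ _ _ (s, t)) => {H} //=.
  - by rewrite l1 andbT addr_ge0 ?mulr_ge0 // ltW.
  - by rewrite mulr_ge0 // mulr_ge0 // ltW.
  - by rewrite mulr_ge0.
  - by move=> u _; rewrite exprn_ge0 ?omw_ge0.
  - by move=> [u v] [/= ua uv vb]; apply: ErrK.
  - move=> Q Q0 HQ [u v] [/= ua uv vb].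
    have HQ' s' t' : a <= s' -> s' <= t' -> t' <= b ->
      `|Dl s' t'| <= Q * w s' t' ^+ 3.
      by move=> sa' st' tb'; apply: (HQ (s', t')).
    have := halving_step p_ge2 omega_control a0 bT Q0 (defect dl Q dl0 Q0 xydl HQ')
      HQ' ua uv vb.
    by rewrite PE => H;
      rewrite (mulrDl (2 * half_factor p)) -addrA [lam * Q + _]addrC.
move=> t tab; apply/eqP; rewrite -subr_eq0 -normr_le0.
have := @contraction_bound R R (fun u => a <= u <= b) (fun u => `|x u - y u|)
  (fun=> 1) 2^-1 0 (r + r).
rewrite mul0r mul0r; apply=> //.
- by rewrite invr_ge0 ler0n invf_lt1 ?ltr1n.
- by rewrite addr_ge0 // ltW.
- move=> u /M_ [_ _ xr yr]; rewrite mulr1; apply: (le_trans (ler_distD m _ _)).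
  by rewrite (distrC m); apply: lerD.
- move=> Q Q0 HQ u /andP[au ub]; rewrite addr0 mulr1.
  have -> : x u - y u = Dl a u.
    by rewrite /Dl /err_diff /davie_err xya cancel_common.
  have xyQ v : a <= v <= b -> `|x v - y v| <= Q by move=> /HQ; rewrite mulr1.
  apply: (le_trans (close Q Q0 xyQ a u (lexx a) au ub)).
  have [_ _ Pw] := wE a u (lexx a) au ub.
  by rewrite mulrAC ler_wpM2r.
Qed.

(** * Davie paths and their uniqueness *)

Lemma real_induction (T0 : R) (P : R -> Prop) : 0 <= T0 ->
  (forall t, 0 <= t <= T0 -> (forall s, 0 <= s < t -> P s) -> P t) ->
  (forall t, 0 <= t -> t < T0 -> (forall s, 0 <= s <= t -> P s) ->
    exists e, 0 < e /\ forall s, t <= s -> s <= t + e -> s <= T0 -> P s) ->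
  forall t, 0 <= t <= T0 -> P t.
Proof.
move=> T00 closing opening.
pose S := [set t | 0 <= t <= T0 /\ forall s, 0 <= s <= t -> P s].
have P0 : P 0.
  apply: closing => [|s /andP[s0]]; first by rewrite lexx T00.
  by rewrite ltNge s0.
have S0 : S 0.
  split => [|s]; first by rewrite lexx.
  by rewrite -eq_le => /eqP <-.
have hS : has_sup S.
  split; first by exists 0.
  by exists T0 => t [/andP[]].
set sg := sup S.
have sg0 : 0 <= sg by exact: sup_upper_bound.
have sgT : sg <= T0 by apply: ge_sup => [|t [/andP[]]//]; exists 0.
have below s : 0 <= s < sg -> P s.
  move=> /andP[s0 ssg]; have e0 : 0 < sg - s by rewrite subr_gt0.
  have [t [_ Pt]] := sup_adherent e0 hS; rewrite -/sg subKr => st.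
  by apply: Pt; rewrite s0 ltW.
have Psg : P sg by apply: closing; rewrite ?sg0.
have upto s : 0 <= s <= sg -> P s.
  move=> /andP[s0]; rewrite le_eqVlt => /orP[/eqP -> //|ss]; apply: below.
  by rewrite s0.
suff sgE : sg = T0 by rewrite -sgE.
apply/eqP; rewrite eq_le sgT leNgt; apply/negP => sgT'.
have [e [e0 Pe]] := opening sg sg0 sgT' upto.
pose t := Num.min (sg + e) T0.
have sgt : sg < t by rewrite lt_min sgT' ltrDl e0.
have : S t.
  split => [|s /andP[s0 st]];
    first by rewrite (le_trans sg0 (ltW sgt)) ge_min lexx orbT.
  have [ssg|ssg] := leP s sg; first by apply: upto; rewrite s0.
  by move: st; rewrite le_min => /andP[s1 s2]; apply: Pe => //; exact: ltW.
by move/(sup_upper_bound hS); rewrite leNgt sgt.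
Qed.

(** The form taken by the equation for the trace alone; see [solution_path] and
    [lift_solution]. *)
Definition davie_path (T0 : R) (x : R -> 'rV[R]_N) : Prop :=
  [/\ {within `[0, T0], continuous x}, (forall t, 0 <= t <= T0 -> M (x t)) &
    exists dl K : R, [/\ 0 < dl, 0 <= K & forall s t, 0 <= s -> s <= t -> t <= T0 ->
      t - s <= dl -> `|err x s t| <= K * w s t ^+ 3]].

Lemma path_eps T0 (x : R -> 'rV[R]_N) t (e : R) : {within `[0, T0], continuous x} ->
  0 <= t <= T0 -> 0 < e ->
  exists dl, 0 < dl /\ forall s, 0 <= s <= T0 -> `|s - t| < dl -> `|x s - x t| <= e.
Proof.
move/within_continuous_eps => xc tT e0.
have [dl [dl0 H]] := xc t ltac:(by rewrite /= in_itv) e e0.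
by exists dl; split => // s sT; apply: H; rewrite /= in_itv.
Qed.

Lemma davie_path_unique T0 x y : 0 <= T0 -> T0 <= T ->
  davie_path T0 x -> davie_path T0 y -> x 0 = y 0 ->
  forall t, 0 <= t <= T0 -> x t = y t.
Proof.
move=> T00 T0T [xc xM [dx [Kx [dx0 Kx0 xK]]]] [yc yM [dy [Ky [dy0 Ky0 yK]]]] xy0.
apply: real_induction => // [t /andP[t0 tT] eqs|t t0 tT eqs].
  move: t0; rewrite le_eqVlt => /orP[/eqP <- //|t0].
  apply/eqP; rewrite -subr_eq0 -normr_le0; apply/ler_addgt0Pl => e e0.
  have e20 : 0 < e / 2 by rewrite divr_gt0.
  have tT0 : 0 <= t <= T0 by rewrite (ltW t0).
  have [d1 [d10 H1]] := path_eps xc tT0 e20.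
  have [d2 [d20 H2]] := path_eps yc tT0 e20.
  pose h := Num.min t (Num.min d1 d2) / 2.
  have m0 : 0 < Num.min t (Num.min d1 d2) by rewrite !lt_min t0 d10.
  have h0 : 0 < h by rewrite divr_gt0.
  have hm : h < Num.min t (Num.min d1 d2) by rewrite /h ltr_pdivrMr // ltr_pMr //
    ltr1n.
  move: hm; rewrite !lt_min => /and3P[ht h1 h2].
  have sT : 0 <= t - h <= T0.
    by rewrite subr_ge0 ltW //= (le_trans _ tT) // gerBl ltW.
  have sd : `|t - h - t| = h by rewrite addrAC subrr add0r normrN gtr0_norm.
  have := H1 (t - h) sT; have := H2 (t - h) sT; rewrite sd => /(_ h2) H2' /(_ h1) H1'.
  rewrite addr0 [e]splitr; apply: (le_trans (ler_distD (x (t - h)) _ _)).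
  rewrite (distrC (x t)); apply: lerD => //.
  rewrite eqs //; case/andP: sT => -> _ /=.
  by rewrite ltrBlDr ltrDl.
have tT0 : 0 <= t <= T0 by rewrite t0 ltW.
have tTT : 0 <= t <= T by rewrite t0 (le_trans (ltW tT)).
have xyt : x t = y t by apply: eqs; rewrite t0 lexx.
have K0 : 0 <= Num.max Kx Ky by rewrite le_max Kx0.
have [e [e0 He]] := local_unique K0 tTT (xM t tT0).
have e20 : 0 < e / 2 by rewrite divr_gt0.
have e2 : e / 2 < e by rewrite ltr_pdivrMr // ltr_pMr // ltr1n.
have [d1 [d10 H1]] := path_eps xc tT0 e20.
have [d2 [d20 H2]] := path_eps yc tT0 e20.
pose h := Num.min (e / 2) (Num.min (Num.min d1 d2 / 2) (Num.min dx dy)).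
have h0 : 0 < h by rewrite !lt_min e20 divr_gt0 ?lt_min ?d10 ?d20 ?dx0 ?dy0.
exists h; split => // s ts sh sT.
have [h1 h2 h3 h4 h5] : [/\ h < e, h < d1, h < d2, h <= dx & h <= dy].
  have m0 : 0 < Num.min d1 d2 by rewrite lt_min d10.
  have hm : h < Num.min d1 d2.
    apply: (@le_lt_trans _ _ (Num.min d1 d2 / 2)).
      by rewrite /h !ge_min lexx !orbT.
    by rewrite ltr_pdivrMr // ltr_pMr // ltr1n.
  move: hm; rewrite lt_min => /andP[-> ->]; split => //.
  - by apply: le_lt_trans e2; rewrite /h ge_min lexx.
  - by rewrite /h !ge_min lexx !orbT.
  - by rewrite /h !ge_min lexx !orbT.
have close u : t <= u <= s -> `|u - t| <= h.
  by move=> /andP[tu us]; rewrite ger0_norm ?subr_ge0 // lerBlDl (le_trans us).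
apply: (He t s x y t0 ts (le_trans sT T0T) _ _ _ xyt).
- by rewrite subrr normr0.
- by apply: le_lt_trans h1; apply: close; rewrite ts lexx.
- move=> u tus; have /andP[tu us] := tus.
  have uT : 0 <= u <= T0 by rewrite (le_trans t0 tu) (le_trans us).
  have uh := close u tus.
  split; [exact: xM | exact: yM | |].
    by apply: le_lt_trans e2; apply: H1 => //; apply: le_lt_trans uh _.
  by rewrite xyt; apply: le_lt_trans e2; apply: H2 => //; apply: le_lt_trans uh _.
- move=> u v tu uv vs.
  have vu : v - u <= h by rewrite lerBlDr (le_trans vs) // (le_trans sh) //
    addrC lerD2l.
  have u0 := le_trans t0 tu; have vT := le_trans vs sT.
  have w0 : 0 <= w u v ^+ 3 by rewrite exprn_ge0 ?omw_ge0.
  split.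
    apply: (le_trans (xK u v u0 uv vT (le_trans vu h4))).
    by rewrite ler_wpM2r // le_max lexx.
  apply: (le_trans (yK u v u0 uv vT (le_trans vu h5))).
  by rewrite ler_wpM2r // le_max lexx orbT.
- by rewrite ts lexx.
Qed.

(** * Bounds along a Davie path *)

Local Notation Yi i := (Y (delta_mx 0 i)).

Lemma field1_delta (f : 'I_n -> 'rV[R]_N -> 'rV[R]_N) i x :
  field1 f (delta_mx 0 i) x = f i x.
Proof.
rewrite /field1 (bigD1 i) //= mxE !eqxx scale1r big1 ?addr0 // => j ji.
by rewrite mxE eqxx (negPf ji) scale0r.
Qed.

Lemma chart_field m r C f F U i x : @adapted_chart R N n d M Y m r C f F U ->
  M x -> cball m r x -> Yi i x = f i x.
Proof. by move=> ch Mx xr; rewrite (chart_field1 ch _ Mx xr) field1_delta. Qed.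

Lemma le_sum5 (a b c e h : R) : 0 <= a -> 0 <= b -> 0 <= c -> 0 <= e -> 0 <= h ->
  [/\ 0 <= a + b + c + e + h, a <= a + b + c + e + h, b <= a + b + c + e + h,
      c <= a + b + c + e + h & e <= a + b + c + e + h] /\ h <= a + b + c + e + h.
Proof. by move=> *; split; [split|]; lra. Qed.

Lemma path_local_bounds T0 x t0 : T0 <= T -> davie_path T0 x -> 0 <= t0 <= T0 ->
  exists e B : R, [/\ 0 < e, 0 <= B & forall s t, 0 <= s -> s <= t -> t <= T0 ->
    `|s - t0| < e -> `|t - t0| < e ->
    [/\ forall i, `|Yi i (x s)| <= B, `|x t - x s| <= B * w s t,
        `|x t - x s - Y (incr Z s t) (x s)| <= B * w s t ^+ 2,
        forall i, `|Yi i (x t) - Yi i (x s)| <= B * w s t & `|x s| <= B]].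
Proof.
move=> T0T [xc xM [dl [K [dl0 K0 xK]]]] t0T.
have [r [C [f [F [U ch]]]]] := adapted_chart_exists M_submanifold Y_linear (xM t0
  t0T).
have [c [c1 drv]] := driver_bounds.
have r0 := chart_r ch; have C0 := chart_C ch.
have fC := chart_f ch; have gC := chart_deriv ch.
set A := n%:R * C + n%:R ^+ 2 * C.
have A0 : 0 <= A by exact: step_const_ge0.
have AE : A = n%:R * C + n%:R ^+ 2 * C by [].
have c0 : 0 <= c by exact: le_trans c1.
have cp : 0 < c by exact: lt_le_trans c1.
have [d1 [d10 H1]] := path_eps xc t0T r0.
have t0TT : 0 <= t0 <= T by case/andP: t0T => -> /le_trans ->.
have ci0 : 0 < c^-1 by rewrite invr_gt0.
have [d2 [d20 H2]] := omw_eps p_ge2 omega_control t0TT ci0.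
have dl20 : 0 < dl / 2 by rewrite divr_gt0.
have [] := @le_sum5 C (A * c + K) (A * c ^+ 2 + K) (C * (A * c + K)) (`|x t0| + r).
- by [].
- by rewrite addr_ge0 // mulr_ge0.
- by rewrite addr_ge0 // mulr_ge0 // exprn_ge0.
- by rewrite mulr_ge0 // addr_ge0 // mulr_ge0.
- by rewrite addr_ge0 // ltW.
set B := (_ + (_ + r)); clearbody B A => -[B0 BC B1 B2 B3] B4.
exists (Num.min d1 (Num.min d2 (dl / 2))), B.
split; [by rewrite !lt_min d10 d20| by []|].
move=> s t s0 st tT; rewrite !lt_min => /and3P[s1 s2 s3] /and3P[t1 t2 t3].
have sT : 0 <= s <= T0 by rewrite s0 (le_trans st).
have tT' : 0 <= t <= T0 by rewrite (le_trans s0).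
have xs : cball (x t0) r (x s) by apply: H1.
have xt : cball (x t0) r (x t) by apply: H1.
have Ms := xM s sT; have Mt := xM t tT'.
have w0 : 0 <= w s t by exact: omw_ge0.
have wc : c * w s t <= 1.
  by rewrite mulrC -ler_pdivlMr // mul1r; apply: H2 => //; exact: le_trans tT T0T.
have cw01 : 0 <= c * w s t <= 1 by rewrite wc mulr_ge0.
have w1 : w s t <= 1 by apply: le_trans wc; rewrite ler_peMl.
have [z1 z2] := drv s t s0 st (le_trans tT T0T).
have tsdl : t - s <= dl.
  rewrite -(subrKA t0) [dl]splitr (le_trans (ler_norm _)) //.
  by rewrite (le_trans (ler_normD _ _)) // (distrC t0) lerD // ltW.
have ek := xK s t s0 st tT tsdl.
have w3 : w s t ^+ 3 <= w s t ^+ 2 by rewrite exprS ler_piMl // exprn_ge0.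
have w2 : w s t ^+ 2 <= w s t by rewrite expr2 ler_piMr.
have xst : `|x t - x s| <= (A * c + K) * w s t.
  rewrite (err_step t ch Ms xs) (le_trans (ler_normD _ _)) // mulrDl lerD //.
    by have := step_le C0 fC gC cw01 z1 z2 xs; rewrite -AE mulrA.
  by apply: (le_trans ek); rewrite ler_wpM2l // (le_trans w3).
have Lf i : `|Yi i (x t) - Yi i (x s)| <= C * ((A * c + K) * w s t).
  rewrite (chart_field i ch Ms xs) (chart_field i ch Mt xt).
  by apply: (le_trans (C11_lip (fC i) xt xs)); rewrite ler_wpM2l.
split.
- move=> i; rewrite (chart_field i ch Ms xs); apply: le_trans BC.
  by have [_ + _ _] := fC i _ xs.
- by apply: (le_trans xst); rewrite ler_wpM2r.
- rewrite (chart_field1 ch _ Ms xs) (err_step t ch Ms xs) /davie_step.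
  rewrite addrAC [field1 _ _ _ + _]addrC addrK (le_trans (ler_normD _ _)) //.
  apply: (@le_trans _ _ ((A * c ^+ 2 + K) * w s t ^+ 2)); last first.
    by rewrite ler_wpM2r ?exprn_ge0.
  rewrite mulrDl lerD //.
    by have := field2_small C0 gC cw01 z2 xs; rewrite -AE exprMn mulrA.
  by apply: (le_trans ek); rewrite ler_wpM2l.
- move=> i; apply: (le_trans (Lf i)); rewrite mulrA ler_wpM2r //.
- rewrite -(subrK (x t0) (x s)) (le_trans (ler_normD _ _)) // addrC.
  by apply: le_trans B4; rewrite lerD2l.
Qed.

Lemma omw_le_total s t T0 : 0 <= s -> s <= t -> t <= T0 -> T0 <= T ->
  w s t <= w 0 T0.
Proof. by move=> s0 st tT TT; apply: (omw_mono p_ge2 omega_control). Qed.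

Lemma field_le x B (z : 'rV[R]_n) : M x -> (forall i, `|Yi i x| <= B) ->
  `|Y z x| <= n%:R * B * `|z|.
Proof. by move=> Mx YB; rewrite (Y_sum Y_linear z Mx); exact: row_entry_sum. Qed.

(** Near the diagonal these are the bounds in a chart; the paths and the fields
    along them being bounded, [near_diagonal_global] applies. *)
Lemma path_bounds T0 x : 0 <= T0 -> T0 <= T -> davie_path T0 x ->
  exists B : R, [/\ 0 <= B,
    forall s, 0 <= s <= T0 -> `|x s| <= B /\ forall i, `|Yi i (x s)| <= B &
    forall s t, 0 <= s -> s <= t -> t <= T0 ->
    [/\ `|x t - x s| <= B * w s t,
        `|x t - x s - Y (incr Z s t) (x s)| <= B * w s t ^+ 2 &
        forall i, `|Yi i (x t) - Yi i (x s)| <= B * w s t]].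
Proof.
move=> T00 T0T dx; have [xc xM _] := dx.
have glob (k : nat) (g : R -> R -> 'rV[R]_N) :
  (forall t0 e B, 0 < e -> 0 <= B -> (forall s t, 0 <= s -> s <= t -> t <= T0 ->
    `|s - t0| < e -> `|t - t0| < e ->
    [/\ forall i, `|Yi i (x s)| <= B, `|x t - x s| <= B * w s t,
        `|x t - x s - Y (incr Z s t) (x s)| <= B * w s t ^+ 2,
        forall i, `|Yi i (x t) - Yi i (x s)| <= B * w s t & `|x s| <= B]) ->
    forall s t, 0 <= s -> s <= t -> t <= T0 -> `|s - t0| < e -> `|t - t0| < e ->
      `|g s t| <= B * w s t ^+ k) ->
  exists d C : R, [/\ 0 < d, 0 <= C & forall s t, 0 <= s -> s <= t -> t <= T0 ->
    t - s <= d -> `|g s t| <= C * w s t ^+ k].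
  move=> H; apply: (@small_near_uniform R p omega _ T0 k g) => t0 t0T.
  have [e [B [e0 B0 HB]]] := path_local_bounds T0T dx t0T.
  by exists e, B; split => // s t s0 st tT se te; apply: (H t0 e B e0 B0 HB).
have pw (g : R -> 'rV[R]_N) : (exists d C : R, [/\ 0 < d, 0 <= C & forall s t, 0 <=
  s -> s <= t -> t <= T0 ->
    t - s <= d -> `|g s| <= C * w s t ^+ 0]) -> exists C, 0 <= C /\
      forall s, 0 <= s <= T0 -> `|g s| <= C.
  move=> [dl [C [dl0 C0 HC]]]; exists C; split => // s /andP[s0 sT].
  by have := HC s s s0 (lexx s) sT; rewrite subrr ltW // expr0 mulr1 => /(_ isT).
have [Bx [Bx0 HBx]] : exists B, 0 <= B /\ forall s, 0 <= s <= T0 -> `|x s| <= B.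
  apply: pw; apply: (glob 0%N (fun s _ => x s)) => t0 e B e0 B0 HB s t s0 st tT se te.
  by have [_ _ _ _] := HB s t s0 st tT se te; rewrite expr0 mulr1.
have [BY [? [BY0 _ HBY]]] : exists C r : R, [/\ 0 <= C, 0 < r & forall i,
    (forall s, 0 <= s <= T0 -> `|Yi i (x s)| <= C) /\
    forall s t, 0 <= s -> s <= t -> t <= T0 ->
      `|Yi i (x t) - Yi i (x s)| <= C * w s t].
  apply: (@fin_unif R n (fun i C _ => (forall s, 0 <= s <= T0 ->
    `|Yi i (x s)| <= C) /\
    forall s t, 0 <= s -> s <= t -> t <= T0 ->
      `|Yi i (x t) - Yi i (x s)| <= C * w s t)).
    move=> i C C' r r' CC' _ [H1 H2]; split => [s sT|s t s0 st tT].
      exact: le_trans (H1 s sT) CC'.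
    by apply: (le_trans (H2 s t s0 st tT)); rewrite ler_wpM2r ?omw_ge0.
  move=> i.
  have [B [B0 HB]] : exists B, 0 <= B /\ forall s, 0 <= s <= T0 -> `|Yi i (x s)| <= B.
    apply: pw; apply: (glob 0%N (fun s _ => Yi i (x s))) =>
      t0 e B e0 B0 HB s t s0 st tT se te.
    by have [+ _ _ _ _] := HB s t s0 st tT se te; rewrite expr0 mulr1.
  have [d1 [C1 [d10 C10 HC1]]] : exists d C : R, [/\ 0 < d, 0 <= C & forall s t, 0
    <= s -> s <= t -> t <= T0 ->
      t - s <= d -> `|Yi i (x t) - Yi i (x s)| <= C * w s t ^+ 1].
    apply: (glob 1%N (fun s t => Yi i (x t) - Yi i (x s))) =>
      t0 e B' e0 B0' HB' s t s0 st tT se te.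
    by have [_ _ _ + _] := HB' s t s0 st tT se te; rewrite expr1.
  have [|C [C0 HC]] := near_diagonal_global (B := B + B) p_ge2 omega_control T0T
    d10 HC1.
    move=> s t s0 st tT; apply: (le_trans (ler_normB _ _)).
    by apply: lerD; apply: HB; rewrite ?s0 ?(le_trans s0) // (le_trans st).
  exists (B + C), 1; split => //; split => [s sT|s t s0 st tT].
    by apply: (le_trans (HB s sT)); rewrite lerDl.
  by apply: (le_trans (HC s t s0 st tT)); rewrite expr1 ler_wpM2r ?omw_ge0 ?lerDr.
have [d1 [C1 [d10 C10 HC1]]] : exists d C : R, [/\ 0 < d, 0 <= C & forall s t, 0 <=
  s -> s <= t -> t <= T0 ->
      t - s <= d -> `|x t - x s| <= C * w s t ^+ 1].
  apply: (glob 1%N (fun s t => x t - x s)) => t0 e B' e0 B0' HB' s t s0 st tT se te.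
  by have [_ + _ _ _] := HB' s t s0 st tT se te; rewrite expr1.
have bx s t : 0 <= s -> s <= t -> t <= T0 -> `|x t - x s| <= Bx + Bx.
  move=> s0 st tT; apply: (le_trans (ler_normB _ _)).
  by apply: lerD; apply: HBx; rewrite ?s0 ?(le_trans s0) // (le_trans st).
have [Cx [Cx0 HCx]] := near_diagonal_global (B := Bx + Bx) p_ge2 omega_control T0T
  d10 HC1 bx.
have [d2 [C2 [d20 C20 HC2]]] : exists d C : R, [/\ 0 < d, 0 <= C & forall s t, 0 <=
  s -> s <= t -> t <= T0 ->
      t - s <= d -> `|x t - x s - Y (incr Z s t) (x s)| <= C * w s t ^+ 2].
  apply: (glob 2 (fun s t => x t - x s - Y (incr Z s t) (x s))) =>
    t0 e B' e0 B0' HB' s t s0 st tT se te.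
  by have [] := HB' s t s0 st tT se te.
have [c [c1 drv]] := driver_bounds.
have [|C [C0 HC]] := near_diagonal_global (B := Bx + Bx + n%:R * BY * (c * w 0 T0))
    p_ge2 omega_control T0T d20 HC2.
  move=> s t s0 st tT; apply: (le_trans (ler_normB _ _)); apply: lerD;
    first exact: bx.
  have sT : 0 <= s <= T0 by rewrite s0 (le_trans st).
  apply: (le_trans (field_le _ (xM s sT) (fun i => (HBY i).1 s sT))).
  have [z1 _] := drv s t s0 st (le_trans tT T0T).
  rewrite ler_wpM2l ?mulr_ge0 // (le_trans z1) // ler_wpM2l ?(le_trans _ c1) //.
  exact: omw_le_total.
have [|[B0 HxB HYB HCxB HCB] _] := @le_sum5 Bx BY Cx C 0 Bx0 BY0 Cx0 C0; first by [].
set B := (_ + 0) in B0 HxB HYB HCxB HCB; clearbody B.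
exists B; split => // [s sT|s t s0 st tT].
  split=> [|i]; first exact: le_trans (HBx s sT) HxB.
  exact: le_trans ((HBY i).1 s sT) HYB.
have w0 : 0 <= w s t by exact: omw_ge0.
split => [||i].
- by apply: (le_trans (HCx s t s0 st tT)); rewrite expr1 ler_wpM2r.
- by apply: (le_trans (HC s t s0 st tT)); rewrite ler_wpM2r // exprn_ge0.
- by apply: (le_trans ((HBY i).2 s t s0 st tT)); rewrite ler_wpM2r.
Qed.

(** [davie_existence] for the translations [y |-> y + Xi s t] of the line. *)
Lemma sewing (b B C2 : R) (Xi : R -> R -> R) : 0 <= b -> b <= T -> 0 <= C2 ->
  (forall s, 0 <= s <= b -> Xi s s = 0) ->
  (forall t, 0 <= t <= b -> `|Xi 0 t| <= B) ->
  (forall s u t, 0 <= s -> s <= u -> u <= t -> t <= b ->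
    `|Xi s t - Xi s u - Xi u t| <= C2 * w s t ^+ 3) ->
  exists A : R -> R, forall s t, 0 <= s -> s <= t -> t <= b ->
    `|A t - A s - Xi s t| <= 3 * C2 / (1 - 2 * half_factor p) * w s t ^+ 3.
Proof.
move=> b0 bT C20 Xid XiB Xidef.
have /andP[q0 q1] := two_half_factor p_ge2 p_lt3.
set K := _ / _.
have K0 : 0 <= K by rewrite /K divr_ge0 ?mulr_ge0 // subr_ge0 ltW.
have KE : K * half_factor p * (1 + 1 ^+ 2) + (1 * 0 + 1 * C2 + C2) <= K.
  rewrite expr1n mulr0 add0r mul1r.
  rewrite [leRHS](_ : K = K * (2 * half_factor p) + 3 * C2); last first.
    have q1' : 1 - 2 * half_factor p != 0 by rewrite subr_eq0 gt_eqF.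
    by rewrite -[in RHS](divfK q1' (3 * C2)) -/K -mulrDr addrC subrK mulr1.
  rewrite lerD //; last by rewrite -mulr2n -(mulr_natl C2) ler_wpM2r // ler_nat.
  by rewrite -mulrA ler_wpM2l // mulrC.
clearbody K.
pose D s t (y : R) := y + Xi s t.
pose L := B + K * w 0 b ^+ 3.
have [|||||||A [_ _ HA]] := @davie_existence_control R 0 b D `[- L, L] setT 1 0 C2 K 0
  (lexx 0) b0 bT ler01 K0 (lexx 0) C20 KE.
- by move=> s y H; rewrite /D Xid ?addr0.
- by move=> s t y y' _ _ _; rewrite /D opprD addrACA subrr addr0 mul1r.
- move=> s u t y s0 su ut tb _; rewrite /D.
  have -> : y + Xi s u + Xi u t - (y + Xi s t) = - (Xi s t - Xi s u - Xi u t) by ring.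
  by rewrite normrN; apply: Xidef.
- move=> s t y s0 st tb _; exists (D s t y); split => //.
  by rewrite subrr normr0 mul0r.
- rewrite /= in_itv /= -ler_norml normr0 addr_ge0 ?mulr_ge0 ?exprn_ge0 ?omw_ge0 //.
  by apply: le_trans (XiB 0 _); rewrite ?lexx.
- move=> t y /andP[t0 tb] _; rewrite /D add0r => H.
  rewrite /= in_itv /= -ler_norml -(subrK (Xi 0 t) y) addrC.
  apply: (le_trans (ler_normD _ _)); apply: lerD; first by apply: XiB; rewrite t0.
  apply: (le_trans H); rewrite ler_wpM2l // lerXn2r ?nnegrE ?omw_ge0 //.
  exact: omw_le_total.
- exact: segment_compact.
exists A => s t s0 st tb; have := HA s t s0 st tb; rewrite /D.
by rewrite opprD addrA.
Qed.

(** * Sewing the second level *)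

Lemma tliftD (k : nat) (V : lmodType R) (b : 'rV[R]_k -> 'rV[R]_k -> V) A A' :
  tlift b (A + A') = tlift b A + tlift b A'.
Proof.
rewrite /tlift -big_split; apply: eq_bigr => i _; rewrite -big_split.
by apply: eq_bigr => j _; rewrite mxE scalerDl.
Qed.

Lemma tliftN (k : nat) (V : lmodType R) (b : 'rV[R]_k -> 'rV[R]_k -> V) A :
  tlift b (- A) = - tlift b A.
Proof.
rewrite /tlift -sumrN; apply: eq_bigr => i _; rewrite -sumrN.
by apply: eq_bigr => j _; rewrite mxE scaleNr.
Qed.

Lemma tlift_le (k : nat) (V : normedModType R) (b : 'rV[R]_k -> 'rV[R]_k -> V) A c :
  (forall i j, `|b (delta_mx 0 i) (delta_mx 0 j)| <= c) ->
  `|tlift b A| <= k%:R ^+ 2 * c * `|A|.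
Proof. exact: coord_sum2_le. Qed.

Lemma tens_le (k : nat) (a b : 'rV[R]_k) : `|tens a b| <= `|a| * `|b|.
Proof.
apply: mx_norm_le => [|i j]; first by rewrite mulr_ge0.
rewrite /tens mxE big_ord1 mxE normrM.
by apply: ler_pM => //; apply: mx_entry_le.
Qed.

Lemma tens_diff (k : nat) (a b a' b' : 'rV[R]_k) :
  tens a b - tens a' b' = tens (a - a') b + tens a' (b - b').
Proof. by apply/matrixP => i j; rewrite !(mxE, big_ord1); ring. Qed.

Lemma tens_diff_le (k : nat) (a b a' b' : 'rV[R]_k) :
  `|tens a b - tens a' b'| <= `|a - a'| * `|b| + `|a'| * `|b - b'|.
Proof.
rewrite tens_diff; apply: (le_trans (ler_normD _ _)).
by apply: lerD; apply: tens_le.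
Qed.

Definition tensY (A : 'M[R]_n) (y : 'rV[R]_N) : 'M[R]_N :=
  tlift (fun a b => tens (Y a y) (Y b y)) A.

Lemma tensY_tens y a b : M y -> tensY (tens a b) y = tens (Y a y) (Y b y).
Proof.
move=> My; have [_ /(_ y My) Yl] := Y_linear.
rewrite /tensY tlift_tens // => [c k u v|c k u v].
  by rewrite /= Yl; apply/matrixP => i j; rewrite !(mxE, big_ord1); ring.
by rewrite /= Yl; apply/matrixP => i j; rewrite !(mxE, big_ord1); ring.
Qed.

(** For a rough path with trace [x], the sum of its second level and of
    [x_s (x) x_{s,t}] is additive by Chen's relation. The germ is what this sum has
    to be up to third order; sewing it recovers the second level. *)
Definition lift_germ (x : R -> 'rV[R]_N) s t : 'M[R]_N :=
  tens (x s) (x t - x s) + tensY (level2 Z s t) (x s).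

Lemma germ_algebra (xs xu xt : 'rV[R]_N) (a b c e h : 'M[R]_N) :
  a = b + c + e ->
  tens xs (xt - xs) + a - (tens xs (xu - xs) + b) - (tens xu (xt - xu) + h) =
  e - tens (xu - xs) (xt - xu) + (c - h).
Proof. by move=> ->; apply/matrixP => i j; rewrite !(mxE, big_ord1); ring. Qed.

Lemma lift_germ_defect x s u t : 0 <= s -> s <= u -> u <= t -> t <= T -> M (x s) ->
  lift_germ x s t - lift_germ x s u - lift_germ x u t =
  tens (Y (incr Z s u) (x s)) (Y (incr Z u t) (x s)) - tens (x u - x s) (x t - x u)
  + (tensY (level2 Z u t) (x s) - tensY (level2 Z u t) (x u)).
Proof.
move=> s0 su ut tT Ms; have [_ chen _ _ _] := Z_WG.
apply: germ_algebra; rewrite (chen s u t s0 su ut tT).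
by rewrite /tensY !tliftD -/(tensY (tens _ _) _) tensY_tens.
Qed.

Lemma tensY_diff_le A y y' B h : (forall i, `|Yi i y| <= B) ->
  (forall i, `|Yi i y'| <= B) ->
  0 <= B -> 0 <= h -> (forall i, `|Yi i y' - Yi i y| <= h) ->
  `|tensY A y - tensY A y'| <= n%:R ^+ 2 * (h * B + B * h) * `|A|.
Proof.
move=> yB yB' B0 h0 yy.
have -> : tensY A y - tensY A y' =
    \sum_i \sum_j A i j *: (tens (Yi i y) (Yi j y) - tens (Yi i y') (Yi j y')).
  rewrite /tensY /tlift -sumrB; apply: eq_bigr => i _; rewrite -sumrB.
  by apply: eq_bigr => j _; rewrite scalerBr.
apply: coord_sum2_le => i j; apply: (le_trans (tens_diff_le _ _ _ _)).
by apply: lerD; apply: ler_pM => //; rewrite distrC.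
Qed.

Lemma tensY_le A y B : 0 <= B -> (forall i, `|Yi i y| <= B) ->
  `|tensY A y| <= n%:R ^+ 2 * (B * B) * `|A|.
Proof.
move=> B0 yB; apply: tlift_le => i j; apply: (le_trans (tens_le _ _)).
exact: ler_pM.
Qed.

Lemma field_diff_le y y' h (z : 'rV[R]_n) : M y -> M y' ->
  (forall i, `|Yi i y' - Yi i y| <= h) -> `|Y z y' - Y z y| <= n%:R * h * `|z|.
Proof.
move=> My My' yy; rewrite (Y_sum Y_linear z My) (Y_sum Y_linear z My').
rewrite -sumrB (eq_bigr (fun i => z 0 i *: (Yi i y' - Yi i y))) => [|i _].
  exact: row_entry_sum.
by rewrite scalerBr.
Qed.

(** Up to second order [x_{s,u}] is [Y_z(x_s)], and [Y] is Lipschitz along the path, so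
    the differences of products in [lift_germ_defect] are of third order. *)
Lemma lift_germ_small T0 x : 0 <= T0 -> T0 <= T -> davie_path T0 x ->
  exists C : R, 0 <= C /\ forall s u t, 0 <= s -> s <= u -> u <= t -> t <= T0 ->
    `|lift_germ x s t - lift_germ x s u - lift_germ x u t| <= C * w s t ^+ 3.
Proof.
move=> T00 T0T dx; have [xc xM _] := dx.
have [B [B0 xB xw]] := path_bounds T00 T0T dx.
have [c [c1 drv]] := driver_bounds.
have c0 : 0 <= c by exact: le_trans c1.
exists (B * B + n%:R * B * c * (B + n%:R * B * c) + n%:R ^+ 2 * (B * B + B * B) * c
  ^+ 2).
split.
  by rewrite !(addr_ge0, mulr_ge0, exprn_ge0).
move=> s u t s0 su ut tT.
have uT := le_trans ut tT; have st := le_trans su ut; have u0 := le_trans s0 su.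
have sI : 0 <= s <= T0 by rewrite s0 (le_trans st).
have uI : 0 <= u <= T0 by rewrite u0.
have [_ YB] := xB s sI; have [_ YBu] := xB u uI.
have [h1 h2 h3] := xw s u s0 su uT; have [k1 k2 k3] := xw u t u0 ut tT.
have [z1 _] := drv s u s0 su (le_trans uT T0T).
have [z2 zz2] := drv u t u0 ut (le_trans tT T0T).
have Ms := xM s sI; have Mu := xM u uI.
have m1 : w s u <= w s t by apply: (omw_mono p_ge2 omega_control s0 (lexx s) su ut
  (le_trans tT T0T)).
have m2 : w u t <= w s t by apply: (omw_mono p_ge2 omega_control s0 su ut (lexx t)
  (le_trans tT T0T)).
have p1 : 0 <= w s u by exact: omw_ge0.
have p2 : 0 <= w u t by exact: omw_ge0.
have p3 : 0 <= w s t by exact: omw_ge0.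
have m11 : w s u ^+ 2 <= w s t ^+ 2 by rewrite lerXn2r.
have m22 : w u t ^+ 2 <= w s t ^+ 2 by rewrite lerXn2r.
rewrite lift_germ_defect // ?(le_trans tT) //.
apply: (le_trans (ler_normD _ _)); rewrite mulrDl; apply: lerD; last first.
  apply: (le_trans (tensY_diff_le _ YB YBu B0 (mulr_ge0 B0 p1) h3)).
  have -> : n%:R ^+ 2 * (B * B + B * B) * c ^+ 2 * w s t ^+ 3 =
    n%:R ^+ 2 * (B * w s t * B + B * (B * w s t)) * (c * w s t) ^+ 2 by ring.
  apply: ler_pM => //.
  - by rewrite !(addr_ge0, mulr_ge0, exprn_ge0).
  - rewrite ler_wpM2l ?exprn_ge0 // lerD // ?ler_wpM2r // ?ler_wpM2l //.
  - by apply: (le_trans zz2); rewrite !exprMn ler_wpM2l ?exprn_ge0.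
rewrite -normrN opprB; apply: (le_trans (tens_diff_le _ _ _ _)).
have yz : `|Y (incr Z s u) (x s)| <= n%:R * B * c * w s t.
  apply: (le_trans (field_le _ Ms YB)); rewrite -[leRHS]mulrA ler_wpM2l ?mulr_ge0 //.
  by apply: (le_trans z1); rewrite ler_wpM2l.
have dy : `|x t - x u - Y (incr Z u t) (x s)| <= (B + n%:R * B * c) * w s t ^+ 2.
  rewrite -(subrKA (Y (incr Z u t) (x u))) mulrDl (le_trans (ler_normD _ _)) //.
  apply: lerD; first by apply: (le_trans k2); rewrite ler_wpM2l.
  apply: (le_trans (field_diff_le _ Ms Mu h3)).
  have -> : n%:R * B * c * w s t ^+ 2 = n%:R * (B * w s t) * (c * w s t) by ring.
  apply: ler_pM => //; first by rewrite !mulr_ge0.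
    by rewrite ler_wpM2l // ler_wpM2l.
  by apply: (le_trans z2); rewrite ler_wpM2l.
rewrite mulrDl; apply: lerD.
  have -> : B * B * w s t ^+ 3 = (B * w s t ^+ 2) * (B * w s t) by ring.
  apply: ler_pM => //.
    by apply: (le_trans h2); rewrite ler_wpM2l.
  by apply: (le_trans k1); rewrite ler_wpM2l.
have -> : n%:R * B * c * (B + n%:R * B * c) * w s t ^+ 3 =
  n%:R * B * c * w s t * ((B + n%:R * B * c) * w s t ^+ 2) by ring.
exact: ler_pM.
Qed.

Lemma path_lift T0 x : 0 <= T0 -> T0 <= T -> davie_path T0 x ->
  exists (A : R -> 'M[R]_N) (K : R), 0 <= K /\ forall s t, 0 <= s -> s <= t ->
    t <= T0 ->
    `|A t - A s - lift_germ x s t| <= K * w s t ^+ 3.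
Proof.
move=> T00 T0T dx; have [C [C0 HC]] := lift_germ_small T00 T0T dx.
have [_ xM _] := dx.
have [B [B0 xB xw]] := path_bounds T00 T0T dx.
have [c [c1 drv]] := driver_bounds.
have c0 : 0 <= c by exact: le_trans c1.
have germ0 s : 0 <= s <= T0 -> lift_germ x s s = 0.
  move=> /andP[s0 sT]; rewrite /lift_germ subrr level2_diag ?s0 ?(le_trans sT) //.
  rewrite /tens mulmx0 add0r /tensY /tlift big1 // => i _.
  by rewrite big1 // => j _; rewrite mxE scale0r.
pose L := B * (B + B) + n%:R ^+ 2 * (B * B) * (c * w 0 T0) ^+ 2.
have germB t : 0 <= t <= T0 -> `|lift_germ x 0 t| <= L.
  move=> /andP[t0 tT]; have I0 : 0 <= (0:R) <= T0 by rewrite lexx.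
  have [x0B YB] := xB 0 I0; have [xtB _] := xB t ltac:(by rewrite t0).
  apply: (le_trans (ler_normD _ _)); apply: lerD.
    apply: (le_trans (tens_le _ _)); apply: ler_pM => //.
    by apply: (le_trans (ler_normB _ _)); apply: lerD.
  apply: (le_trans (tensY_le _ B0 YB)); rewrite ler_wpM2l ?mulr_ge0 ?exprn_ge0 //.
  have [_ z2] := drv 0 t (lexx 0) t0 (le_trans tT T0T); apply: (le_trans z2).
  rewrite lerXn2r ?nnegrE ?mulr_ge0 ?omw_ge0 // ler_wpM2l //.
  exact: (omw_le_total (lexx 0) t0 tT T0T).
have sew i j : exists a : R -> R, forall s t, 0 <= s -> s <= t -> t <= T0 ->
    `|a t - a s - lift_germ x s t i j| <= 3 * C / (1 - 2 * half_factor p) * w s t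
      ^+ 3.
  apply: (@sewing T0 L C (fun s t => lift_germ x s t i j)) => //.
  - by move=> s sT; rewrite germ0 // mxE.
  - by move=> t tT; apply: (le_trans (mx_entry_le _ _ _)); apply: germB.
  - move=> s u t s0 su ut tT; apply: le_trans (HC s u t s0 su ut tT).
    by have := mx_entry_le (lift_germ x s t - lift_germ x s u - lift_germ x u t) i
      j; rewrite !mxE.
have [a Ha] := choice (fun ij : 'I_N * 'I_N => sew ij.1 ij.2).
have /andP[q0 q1] := two_half_factor p_ge2 p_lt3.
have K0 : 0 <= 3 * C / (1 - 2 * half_factor p).
  by rewrite divr_ge0 ?mulr_ge0 // subr_ge0 ltW.
exists (fun t => \matrix_(i, j) a (i, j) t), (3 * C / (1 - 2 * half_factor p)).
split=> // s t s0 st tT; apply: mx_norm_le => [|i j].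
  by rewrite mulr_ge0 // exprn_ge0 ?omw_ge0.
have := Ha (i, j) s t s0 st tT; move: (lift_germ x s t) => L' /=.
by rewrite !mxE.
Qed.

(** * The lifted path is weakly geometric *)

(** Chen's relation holds by construction, for any function [A]. *)
Definition rough_lift (x : R -> 'rV[R]_N) (A : R -> 'M[R]_N) : rpath R N :=
  RPath x (fun s t => A t - A s - tens (x s) (x t - x s)).

Lemma lift_level2 x A s t : level2 (rough_lift x A) s t - tensY (level2 Z s t) (x s) =
  A t - A s - lift_germ x s t.
Proof. by rewrite /lift_germ opprD addrA. Qed.

Lemma lift_chen x A s u t :
  level2 (rough_lift x A) s t = level2 (rough_lift x A) s u + level2 (rough_lift x
    A) u t +
    tens (incr (rough_lift x A) s u) (incr (rough_lift x A) u t).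
Proof. by apply/matrixP => i j; rewrite !(mxE, big_ord1) /=; ring. Qed.

Lemma trmx_norm (k : nat) (A : 'M[R]_k) : `|A^T| <= `|A|.
Proof. by apply: mx_norm_le => // i j; rewrite mxE mx_entry_le. Qed.

Lemma tensY_tr A y : (tensY A y)^T = tensY A^T y.
Proof.
rewrite /tensY /tlift exchange_big /= raddf_sum; apply: eq_bigr => i _.
rewrite raddf_sum; apply: eq_bigr => j _ /=; rewrite linearZ /= mxE; congr (_ *: _).
by apply/matrixP => k l; rewrite !(mxE, big_ord1) mulrC.
Qed.

Lemma tensY_sym s t y : 0 <= s -> s <= t -> t <= T -> M y ->
  tensY (level2 Z s t) y + (tensY (level2 Z s t) y)^T =
  tens (Y (incr Z s t) y) (Y (incr Z s t) y).
Proof.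
move=> s0 st tT My; rewrite tensY_tr /tensY -tliftD -/(tensY _ y) -tensY_tens //.
congr (tensY _ y); apply/matrixP => i j.
by rewrite [LHS]mxE [X in _ + X]mxE level2_sym // [RHS]mxE big_ord1 [in RHS]mxE.
Qed.

Section lift_WG.
Variables (T0 K : R) (x : R -> 'rV[R]_N) (A : R -> 'M[R]_N).
Hypotheses (T00 : 0 <= T0) (T0T : T0 <= T) (dx : davie_path T0 x) (K0 : 0 <= K).
Hypothesis HA : forall s t, 0 <= s -> s <= t -> t <= T0 ->
  `|A t - A s - lift_germ x s t| <= K * w s t ^+ 3.

Lemma lift_constants : exists B c B2 : R, [/\ 0 <= B, 0 <= c & 0 <= B2] /\
  (forall s, 0 <= s <= T0 -> `|x s| <= B /\ forall i, `|Yi i (x s)| <= B) /\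
  forall s t, 0 <= s -> s <= t -> t <= T0 ->
    [/\ `|x t - x s| <= B * w s t,
        `|x t - x s - Y (incr Z s t) (x s)| <= B * w s t ^+ 2,
        `|incr Z s t| <= c * w s t,
        `|level2 (rough_lift x A) s t| <= B2 * w s t ^+ 2 & w s t <= w 0 T0].
Proof.
have [_ xM _] := dx; have [B [B0 xB xw]] := path_bounds T00 T0T dx.
have [c [c1 drv]] := driver_bounds; have c0 : 0 <= c by exact: le_trans c1.
have W0 : 0 <= w 0 T0 by exact: omw_ge0.
exists B, c, (K * w 0 T0 + n%:R ^+ 2 * (B * B) * c ^+ 2); split.
  by split; rewrite // addr_ge0 ?mulr_ge0 ?exprn_ge0.
split=> // s t s0 st tT.
have [h1 h2 _] := xw s t s0 st tT.
have [z1 z2] := drv s t s0 st (le_trans tT T0T).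
have wW := omw_le_total s0 st tT T0T; have w0 : 0 <= w s t by exact: omw_ge0.
have sI : 0 <= s <= T0 by rewrite s0 (le_trans st).
split => //; rewrite -(subrK (tensY (level2 Z s t) (x s)) (level2 _ s t)) lift_level2.
rewrite (le_trans (ler_normD _ _)) // mulrDl lerD //.
  apply: (le_trans (HA s0 st tT)); rewrite -mulrA ler_wpM2l // [w s t ^+ 3]exprS.
  by rewrite ler_wpM2r // exprn_ge0.
apply: (le_trans (tensY_le _ B0 (xB s sI).2)); rewrite -[leRHS]mulrA.
by rewrite ler_wpM2l ?mulr_ge0 ?exprn_ge0 // -exprMn.
Qed.

Lemma modulus_eps (k : nat) (f : R -> 'M[R]_k) (C t e : R) : 0 <= C ->
  0 <= t <= T0 -> 0 < e ->
  (forall s u, 0 <= s -> s <= u -> u <= T0 -> `|f u - f s| <= C * w s u) ->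
  exists dl, 0 < dl /\ forall u, 0 <= u <= T0 -> `|u - t| < dl -> `|f u - f t| <= e.
Proof.
move=> C0 /andP[t0 tT] e0 fC; have C1 : 0 < C + 1 by rewrite ltr_wpDl.
have tTT : 0 <= t <= T by rewrite t0 (le_trans tT).
have [dl [dl0 H]] := omw_eps p_ge2 omega_control tTT (divr_gt0 e0 C1).
exists dl; split => // u /andP[u0 uT] ut.
have tt : `|t - t| < dl by rewrite subrr normr0.
have ce v : v <= e / (C + 1) -> C * v <= e.
  move=> ve; apply: (le_trans (ler_wpM2l C0 ve)).
  by rewrite mulrCA ger_pMr // ler_pdivrMr // mul1r lerDl.
have [ut'|tu] := leP u t.
  by rewrite distrC; apply: (le_trans (fC u t u0 ut' tT)); apply: ce;
    apply: H => //; exact: le_trans T0T.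
by apply: (le_trans (fC t u t0 (ltW tu) uT)); apply: ce; apply: H => //;
  [exact: ltW | exact: le_trans T0T].
Qed.

Lemma lift_continuous :
  {within simplex T0, continuous (fun st : R * R =>
    level2 (rough_lift x A) st.1 st.2)}.
Proof.
have [B [c [B2 [[B0 c0 B20] [xB xw]]]]] := lift_constants.
have [xc _ _] := dx.
have W0 : 0 <= w 0 T0 by exact: omw_ge0.
pose B3 := B2 * w 0 T0 + B * B.
have B30 : 0 <= B3 by rewrite addr_ge0 // mulr_ge0.
have AB s u : 0 <= s -> s <= u -> u <= T0 -> `|A u - A s| <= B3 * w s u.
  move=> s0 su uT; have [h1 _ _ h4 h5] := xw s u s0 su uT.
  have sI : 0 <= s <= T0 by rewrite s0 (le_trans su).
  rewrite -(subrK (tens (x s) (x u - x s)) (A u - A s)) -/(level2 (rough_lift x A)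
    s u).
  rewrite (le_trans (ler_normD _ _)) // mulrDl lerD //.
    apply: (le_trans h4); rewrite expr2 mulrA ler_wpM2r ?omw_ge0 //.
    by rewrite ler_wpM2l.
  apply: (le_trans (tens_le _ _)); rewrite -mulrA; apply: ler_pM => //.
  by have [] := xB s sI.
apply/within_continuous_eps => -[s t] [/= s0 st tT] e e0.
have sI : 0 <= s <= T0 by rewrite s0 (le_trans st).
have tI : 0 <= t <= T0 by rewrite (le_trans s0).
pose e1 := e / (2 + 4 * B).
have D1 : 0 < 2 + 4 * B by rewrite ltr_pwDl // mulr_ge0.
have e10 : 0 < e1 by rewrite divr_gt0.
have xwB v u : 0 <= v -> v <= u -> u <= T0 -> `|x u - x v| <= B * w v u.
  by move=> v0 vu uT; have [] := xw v u v0 vu uT.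
have [d1 [d10 H1]] := modulus_eps B30 sI e10 AB.
have [d2 [d20 H2]] := modulus_eps B30 tI e10 AB.
have [d3 [d30 H3]] := path_eps xc sI e10.
have [d4 [d40 H4]] := path_eps xc tI e10.
exists (Num.min (Num.min d1 d2) (Num.min d3 d4)); split;
  first by rewrite !lt_min d10 d20 d30.
move=> [s' t'] [/= s0' st' tT'] /= st_lt.
have sI' : 0 <= s' <= T0 by rewrite s0' (le_trans st').
have tI' : 0 <= t' <= T0 by rewrite (le_trans s0').
have [sd td] : `|s' - s| < Num.min (Num.min d1 d2) (Num.min d3 d4) /\
    `|t' - t| < Num.min (Num.min d1 d2) (Num.min d3 d4).
  move: st_lt; by rewrite prod_normE /= gt_max => /andP[].
move: sd td; rewrite !lt_min =>
  /andP[/andP[sd1 _] /andP[sd3 _]] /andP[/andP[_ td2] /andP[_ td4]].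
have {}H1 := H1 s' sI' sd1; have {}H2 := H2 t' tI' td2.
have {}H3 := H3 s' sI' sd3; have {}H4 := H4 t' tI' td4.
have xsB := (xB s sI).1; have xsB' := (xB s' sI').1; have xtB' := (xB t' tI').1.
move: (A t') (A t) (A s') (A s) (x t') (x t) (x s') (x s) H1 H2 H3 H4 xsB xsB' xtB'.
move=> at' at_ as' as_ xt' xt xs' xs H1 H2 H3 H4 B1 B2' B4.
have -> : at' - as' - tens xs' (xt' - xs') - (at_ - as_ - tens xs (xt - xs)) =
    (at' - at_) - (as' - as_) - (tens xs' (xt' - xs') - tens xs (xt - xs)).
  by move: (tens _ _) (tens _ _) => P Q; apply/matrixP => i j; rewrite !mxE; ring.
have -> : e = e1 + e1 + (e1 * (B + B) + B * (e1 + e1)).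
  have D2 : 2 + 4 * B != 0 by rewrite gt_eqF.
  by rewrite /e1; field.
apply: (le_trans (ler_normB _ _)); apply: lerD.
  by apply: (le_trans (ler_normB _ _)); apply: lerD.
apply: (le_trans (tens_diff_le _ _ _ _)); apply: lerD; apply: ler_pM => //.
  by apply: (le_trans (ler_normB _ _)); apply: lerD.
have -> : xt' - xs' - (xt - xs) = (xt' - xt) - (xs' - xs).
  by apply/matrixP => i j; rewrite !mxE; ring.
by apply: (le_trans (ler_normB _ _)); apply: lerD.
Qed.

(** The difference of the two sides is additive by Chen's relation. It is of third
    order because [tensY] has the required symmetric part ([tensY_sym]). *)
Lemma lift_sym s t : 0 <= s -> s <= t -> t <= T0 ->
  level2 (rough_lift x A) s t + (level2 (rough_lift x A) s t)^T = tens (x t - x s)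
    (x t - x s).
Proof.
have [B [c [B2 [[B0 c0 B20] [xB xw]]]]] := lift_constants.
have [_ xM _] := dx.
move: s t.
pose g s t := level2 (rough_lift x A) s t + (level2 (rough_lift x A) s t)^T - tens
  (x t - x s) (x t - x s).
suff g0 s t : 0 <= s -> s <= t -> t <= T0 -> g s t = 0.
  by move=> s t s0 st tT; apply/eqP; rewrite -subr_eq0; apply/eqP; apply: g0.
apply: (additive_small_eq0 p_ge2 p_lt3 omega_control T00 T0T).
  move=> {s t} s u t _ _ _ _; rewrite /g (lift_chen x A s u t).
  by apply/matrixP => i j; rewrite !(mxE, big_ord1) /=; ring.
exists (K + K + (B * B + n%:R * B * c * B)) => {s t} s t s0 st tT.
have [h1 h2 h3 _ _] := xw s t s0 st tT.
have sI : 0 <= s <= T0 by rewrite s0 (le_trans st).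
have w0 : 0 <= w s t by exact: omw_ge0.
have HAst : `|level2 (rough_lift x A) s t - tensY (level2 Z s t) (x s)| <= K * w s
  t ^+ 3.
  by rewrite lift_level2; exact: HA.
have sy := tensY_sym s0 st (le_trans tT T0T) (xM s sI).
have YB := field_le (incr Z s t) (xM s sI) (xB s sI).2.
have -> : g s t = (level2 (rough_lift x A) s t - tensY (level2 Z s t) (x s)) +
    (level2 (rough_lift x A) s t - tensY (level2 Z s t) (x s))^T +
    (tens (Y (incr Z s t) (x s)) (Y (incr Z s t) (x s)) - tens (x t - x s) (x t - x
      s)).
  rewrite -sy /g; move: (tens _ _) (tensY _ _) (level2 (rough_lift x A) s t) => P Q L.
  by apply/matrixP => i j; rewrite !mxE; ring.
apply: (le_trans (ler_normD _ _)); rewrite mulrDl; apply: lerD.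
  apply: (le_trans (ler_normD _ _)); rewrite mulrDl; apply: lerD => //.
  by apply: (le_trans (trmx_norm _)).
apply: (le_trans (tens_diff_le _ _ _ _)); rewrite -(distrC (x t - x s)).
have yz : `|Y (incr Z s t) (x s)| <= n%:R * B * c * w s t.
  by apply: (le_trans YB); rewrite -[leRHS]mulrA ler_wpM2l // mulr_ge0.
rewrite mulrDl addrC; apply: lerD.
  have -> : B * B * w s t ^+ 3 = B * w s t * (B * w s t ^+ 2) by ring.
  exact: ler_pM.
have -> : n%:R * B * c * B * w s t ^+ 3 = B * w s t ^+ 2 * (n%:R * B * c * w s t)
  by ring.
exact: ler_pM.
Qed.

Lemma lift_WG : WG omega p T0 (rough_lift x A).
Proof.
have [B [c [B2 [[B0 c0 B20] [xB xw]]]]] := lift_constants.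
have [xc xM _] := dx.
split.
- by split => //; exact: lift_continuous.
- by move=> s u t _ _ _ _; exact: lift_chen.
- exists B => s t s0 st tT; have [h1 _ _ _ _] := xw s t s0 (ltW st) tT.
  have w0 : 0 < w s t by exact: (omw_gt0 p omega_control s0 st (le_trans tT T0T)).
  by rewrite -/(w s t) ler_pdivrMr.
- exists B2 => s t s0 st tT; have [_ _ _ h4 _] := xw s t s0 (ltW st) tT.
  have w0 : 0 < w s t by exact: (omw_gt0 p omega_control s0 st (le_trans tT T0T)).
  have om0 : 0 <= omega s t by exact: (omega_ge0 omega_control s0 (ltW st)
    (le_trans tT T0T)).
  by rewrite (powR_omw p (k:=2) isT om0) ler_pdivrMr ?exprn_gt0.
- by move=> s t s0 st tT; rewrite lift_sym.
Qed.

End lift_WG.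

(** * One-forms vanishing on tangent vectors *)

Lemma mulmx_le (k l : nat) (v : 'rV[R]_k) (A : 'M[R]_(k, l)) :
  `|v *m A| <= k%:R * `|v| * `|A|.
Proof.
apply: mx_norm_le => [|i j]; first by rewrite !mulr_ge0.
rewrite mxE; apply: (le_trans (ler_norm_sum _ _ _)).
apply: (@le_trans _ _ (\sum_(_ < k) `|v| * `|A|)).
  by apply: ler_sum => a _; rewrite normrM; apply: ler_pM => //; apply: mx_entry_le.
by rewrite sumr_const card_ord -mulrA mulr_natl.
Qed.

Lemma norm_delta_le (k l : nat) (i : 'I_k) (j : 'I_l) : `|delta_mx i j : 'M[R]_(k,
  l)| <= 1.
Proof.
apply: mx_norm_le => // a b; rewrite mxE.
by case: (_ && _); rewrite ?normr1 ?normr0.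
Qed.

Lemma derive_mulmx_entry (V : normedModType R) (k l : nat) (h : V -> 'rV[R]_k)
    (al : V -> 'M[R]_(k, l)) (y v : V) j :
  differentiable h y -> differentiable al y ->
  differentiable (fun x => (h x *m al x) 0 j : R) y /\
  'D_v (fun x => (h x *m al x) 0 j : R) y = ('D_v h y *m al y + h y *m 'D_v al y) 0 j.
Proof.
move=> dh da.
have hE : (fun x => (h x *m al x) 0 j : R) =
    \sum_(i < k) ((fun x => h x 0 i : R) * (fun x => al x i j : R)).
  by apply/funext => x; rewrite mxE fct_sumE.
have dhi i : differentiable (fun x => h x 0 i : R) y.
  apply: (@differentiable_comp _ _ _ _ h (fun u => u 0 i : R)) => //.
  exact: differentiable_coord.
have dai i : differentiable (fun x => al x i j : R) y.
  apply: (@differentiable_comp _ _ _ _ al (fun u => u i j : R)) => //.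
  exact: differentiable_coord.
rewrite hE; split; first by apply: differentiable_sum => i; apply: differentiableM.
rewrite derive_sum => [|i]; last by apply: diff_derivable; apply: differentiableM.
rewrite mxE !mxE -big_split; apply: eq_bigr => i _ /=.
rewrite deriveM; [|exact: diff_derivable..].
rewrite !derive_mx; [|exact: diff_derivable..].
by rewrite addrC; congr (_ + _); rewrite mxE // [RHS]mulrC.
Qed.

Lemma derive_linear_in (V W : normedModType R) (f : V -> W) (x : V) :
  differentiable f x -> forall a u v, 'D_(a *: u + v) f x = a *: 'D_u f x + 'D_v f x.
Proof. by move=> df a u v; rewrite !deriveE // linearP. Qed.

Lemma tlift_tensY (V : lmodType R) (b : 'rV[R]_N -> 'rV[R]_N -> V) A y :
  (forall v, linear (b ^~ v)) -> (forall v, linear (b v)) ->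
  tlift b (tensY A y) = \sum_i \sum_j A i j *: b (Yi i y) (Yi j y).
Proof.
move=> bl br.
have tZ a B : tlift b (a *: B) = a *: tlift b B.
  rewrite /tlift scaler_sumr; apply: eq_bigr => i _; rewrite scaler_sumr.
  by apply: eq_bigr => j _; rewrite mxE scalerA.
have t0 : tlift b 0 = 0 by rewrite -(scale0r 0) tZ scale0r.
rewrite /tensY {2}/tlift (big_morph (tlift b) (tliftD b) t0).
apply: eq_bigr => i _; rewrite (big_morph (tlift b) (tliftD b) t0).
by apply: eq_bigr => j _; rewrite tZ tlift_tens.
Qed.

Section one_form.
Variables (k : nat) (al : 'rV[R]_N -> 'M[R]_(N, k)).
Hypotheses (al_smooth : smooth_on setT al).
Hypothesis al_tangent : forall m v, M m -> tangent d M m v -> v *m al m = 0.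

Lemma al_differentiable y : differentiable al y.
Proof. exact: (smooth_differentiable al_smooth). Qed.

Lemma field_al a y : M y -> Y a y *m al y = 0.
Proof.
by move=> My; have [vf _] := Y_linear; have [_ tg] := vf a;
  apply: al_tangent => //; apply: tg.
Qed.

(** The product rule for the identity [alpha(Y_a) = 0] on [M]. *)
Lemma field_al_derive a v y : M y -> tangent d M y v ->
  tderiv M (Y a) v y *m al y + Y a y *m 'D_v al y = 0.
Proof.
move=> My tv; have [vf _] := Y_linear;
  have [/(_ y My)[h [U [Uo Uy sh hY]]] _] := vf a.
rewrite (local_extension_derive Y_linear Uo Uy sh (fun x Mx Ux => hY x Mx Ux) My tv).
rewrite -(hY y My Uy); apply/matrixP => i j; rewrite (ord1 i) [RHS]mxE.
have dh := smooth_differentiable sh Uy.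
have [dq <-] := derive_mulmx_entry v j dh (al_differentiable y).
apply: (tangent_vanish Uo Uy dq My _ tv) => x Mx Ux.
by rewrite (hY x Mx Ux) field_al // mxE.
Qed.

(** The coefficient of each entry of the second level of the driver is an instance
    of [field_al_derive]. *)
Lemma one_form_cancel s t y : M y ->
  davie_incr s t y *m al y +
  tlift (fun v u => u *m 'D_v al y) (tensY (level2 Z s t) y) = 0.
Proof.
move=> My; rewrite /davie_incr mulmxDl field_al // add0r.
rewrite tlift_tensY => [|v a u u'|v a u u'] /=.
- rewrite /tlift mulmx_suml -big_split big1 // => i _ /=.
  rewrite mulmx_suml -big_split big1 // => j _ /=.
  rewrite -scalemxAl -scalerDr field_al_derive ?scaler0 //.
  by have [vf _] := Y_linear; have [_ tg] := vf (delta_mx 0 i); apply: tg.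
- by rewrite (derive_linear_in (al_differentiable y)) mulmxDr scalemxAr.
- by rewrite mulmxDl scalemxAl.
Qed.

Lemma one_form_cancel2 s t y : M y ->
  tlift (fun v u => tens (v *m al y) (u *m al y)) (tensY (level2 Z s t) y) = 0.
Proof.
move=> My; rewrite tlift_tensY => [|v a u u'|v a u u'] /=.
- rewrite big1 // => i _; rewrite big1 // => j _.
  by rewrite field_al // /tens trmx0 mul0mx scaler0.
- by apply/matrixP => i j; rewrite mulmxDl -scalemxAl !(mxE, big_ord1); ring.
- by apply/matrixP => i j; rewrite mulmxDl -scalemxAl !(mxE, big_ord1); ring.
Qed.

End one_form.

Lemma approx_omw (V : normedModType R) T0 (g h : R -> R -> V) : T0 <= T ->
  Defs.approx omega p T0 g h <-> exists dl C : R, 0 < dl /\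
    forall s t, 0 <= s -> s <= t -> t <= T0 -> t - s <= dl ->
      `|g s t - h s t| <= C * w s t ^+ 3.
Proof.
move=> T0T; split => -[dl [C [dl0 H]]]; exists dl, C; split => // s t s0 st tT ts.
  have om0 : 0 <= omega s t by exact: (omega_ge0 omega_control s0 st (le_trans tT
    T0T)).
  rewrite -(powR_omw p (k:=3) isT om0); apply: H => //.
  by rewrite ger0_norm ?subr_ge0.
have om0 : 0 <= omega s t by exact: (omega_ge0 omega_control s0 st (le_trans tT T0T)).
rewrite (powR_omw p (k:=3) isT om0); apply: H => //.
by rewrite ger0_norm ?subr_ge0 // in ts.
Qed.

Lemma WG0 (k : nat) T0 : WG omega p T0 (rpath0 R k).
Proof.
split.
- by split; apply/continuous_subspaceT => z; exact: cst_continuous.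
- by move=> s u t _ _ _ _ /=; rewrite /incr /tens subrr trmx0 mul0mx !addr0.
- by exists 0 => s t _ _ _; rewrite /incr subrr normr0 mul0r.
- by exists 0 => s t _ _ _; rewrite normr0 mul0r.
- by move=> s t _ _ _ /=; rewrite /incr /tens subrr trmx0 mulmx0 addr0.
Qed.

Lemma one_form_local (k : nat) (al : 'rV[R]_N ->
  'M[R]_(N, k)) m : smooth_on setT al ->
  exists C r : R, [/\ 0 <= C, 0 < r & forall y, cball m r y ->
    [/\ `|al y| <= C, forall A, `|tlift (fun v u => u *m 'D_v al y) A| <= C * `|A| &
      forall A, `|tlift (fun v u => tens (v *m al y) (u *m al y)) A| <= C * `|A|]].
Proof.
move=> sal; have [C [r [C0 r0 H]]] := smooth_D_bounded openT I sal (x0 := m).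
pose C1 := N%:R ^+ 2 * (N%:R * C); pose C2 := N%:R ^+ 2 * ((N%:R * C) * (N%:R * C)).
have C10 : 0 <= C1 by rewrite !(mulr_ge0, exprn_ge0).
have C20 : 0 <= C2 by rewrite !(mulr_ge0, exprn_ge0).
exists (C + C1 + C2), r; split => //; first by rewrite !addr_ge0.
move=> y ym; have al_le : `|al y| <= C by have [_ + _] := H y 0 ym.
have dal v : `|v| <= 1 -> `|'D_v al y| <= C.
  move=> v1; have [_ _ h] := H y v ym; apply: (le_trans h).
  by rewrite ler_piMr.
have mul_le (v : 'rV[R]_N) (B : 'M[R]_(N, k)) : `|v| <= 1 -> `|B| <= C ->
  `|v *m B| <= N%:R * C.
  move=> v1 BC; apply: (le_trans (mulmx_le _ _)); apply: ler_pM => //.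
  by rewrite ler_piMr.
split=> [|A|A].
- by apply: (le_trans al_le); rewrite -addrA lerDl addr_ge0.
- apply: (@le_trans _ _ (C1 * `|A|));
  last by rewrite ler_wpM2r // addrAC lerDr addr_ge0.
  apply: tlift_le => i j; apply: mul_le; first exact: norm_delta_le.
  by apply: dal; exact: norm_delta_le.
- apply: (@le_trans _ _ (C2 * `|A|)); last by rewrite ler_wpM2r // lerDr addr_ge0.
  apply: tlift_le => i j; apply: (le_trans (tens_le _ _)).
  by apply: ler_pM => //; apply: mul_le => //; exact: norm_delta_le.
Qed.

(** Both germs of the rough integral of a form vanishing on tangent vectors are
    zero on the expected part of the path, so only its third-order errors remain. *)
Lemma lift_solution T0 x : 0 <= T0 -> T0 <= T -> davie_path T0 x ->
  exists X, trace X = x /\ rde_solution d omega p M Y Z (x 0) T0 X.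
Proof.
move=> T00 T0T dx; have [A [K [K0 HA]]] := path_lift T00 T0T dx.
have [xc xM [dl [K' [dl0 K'0 HK']]]] := dx.
have lev s t : 0 <= s -> s <= t -> t <= T0 ->
    `|level2 (rough_lift x A) s t - tensY (level2 Z s t) (x s)| <= K * w s t ^+ 3.
  by move=> s0 st tT; rewrite lift_level2; apply: HA.
exists (rough_lift x A); split => //; split => //.
- split => //; first exact: (lift_WG T00 T0T dx K0 HA).
  move=> k al sal tal.
  (* By [one_form_cancel] only the third-order errors of the two levels are left. *)
  have split1 s t : 0 <= s -> s <= t -> t <= T0 ->
      (x t - x s) *m al (x s) + tlift (fun v u =>
        u *m 'D_v al (x s)) (level2 (rough_lift x A) s t)
    = err x s t *m al (x s) + tlift (fun v u => u *m 'D_v al (x s))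
        (level2 (rough_lift x A) s t - tensY (level2 Z s t) (x s)).
    move=> s0 st tT; have sI : 0 <= s <= T0 by rewrite s0 (le_trans st).
    have E : err x s t *m al (x s) =
        (x t - x s) *m al (x s) - davie_incr s t (x s) *m al (x s).
      by rewrite /davie_err mulmxBl.
    have := one_form_cancel sal tal s t (xM s sI).
    rewrite E tliftD tliftN;
      move: (tlift _ (tensY _ _)) (davie_incr _ _ _ *m _) => P Q /eqP.
    rewrite addr_eq0 => /eqP ->; rewrite -addrA; congr (_ + _).
    by rewrite opprK addrCA addrN addr0.
  have split2 s t : 0 <= s -> s <= t -> t <= T0 ->
      tlift (fun v u => tens (v *m al (x s)) (u *m al (x s))) (level2 (rough_lift x
        A) s t) =
      tlift (fun v u => tens (v *m al (x s)) (u *m al (x s)))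
        (level2 (rough_lift x A) s t - tensY (level2 Z s t) (x s)).
    move=> s0 st tT; have sI : 0 <= s <= T0 by rewrite s0 (le_trans st).
    by rewrite tliftD tliftN (one_form_cancel2 tal) ?subr0 //; exact: xM.
  have loc t0 : 0 <= t0 <= T0 -> exists e C : R, [/\ 0 < e, 0 <= C & forall s t,
      0 <= s -> s <= t -> t <= T0 -> `|s - t0| < e -> `|t - t0| < e ->
      [/\ `|(x t - x s) *m al (x s) + tlift (fun v u =>
        u *m 'D_v al (x s)) (level2 (rough_lift x A) s t)| <= C * w s t ^+ 3 &
       `|tlift (fun v u => tens (v *m al (x s)) (u *m al (x s))) (level2
         (rough_lift x A) s t)| <= C * w s t ^+ 3]].
    move=> t0T; have [C [r [C0 r0 HC]]] := one_form_local (x t0) sal.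
    have [d1 [d10 H1]] := path_eps xc t0T r0.
    exists (Num.min d1 (dl / 2)), (N%:R * K' * C + C * K).
    split; [by rewrite lt_min d10 divr_gt0 | by rewrite addr_ge0 ?mulr_ge0 |].
    move=> s t s0 st tT; rewrite !lt_min => /andP[s1 s2] /andP[t1 t2].
    have sI : 0 <= s <= T0 by rewrite s0 (le_trans st).
    have w0 : 0 <= w s t ^+ 3 by rewrite exprn_ge0 ?omw_ge0.
    have [al1 al2 al3] := HC (x s) (H1 s sI s1).
    have tsdl : t - s <= dl.
      rewrite -(subrKA t0) [dl]splitr (le_trans (ler_norm _)) //.
      by rewrite (le_trans (ler_normD _ _)) // (distrC t0) lerD // ltW.
    have le2 : C * `|level2 (rough_lift x A) s t - tensY (level2 Z s t) (x s)| <= C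
      * K * w s t ^+ 3.
      by rewrite -mulrA ler_wpM2l // lev.
    split.
      rewrite split1 // (le_trans (ler_normD _ _)) // mulrDl; apply: lerD.
        apply: (le_trans (mulmx_le _ _)); rewrite [leRHS]mulrAC.
        apply: ler_pM => //.
        by rewrite -mulrA ler_wpM2l // HK'.
      exact: le_trans (al2 _) le2.
    rewrite split2 //; apply: (le_trans (le_trans (al3 _) le2)).
    by rewrite ler_wpM2r // lerDr !mulr_ge0.
  split => //; first exact: WG0.
    apply/approx_omw => //.
    have [d1 [C1 [d10 _ H1]]] := @small_near_uniform R p omega _ T0 3
      (fun s t => (x t - x s) *m al (x s) + tlift (fun v u =>
        u *m 'D_v al (x s)) (level2 (rough_lift x A) s t))
      (fun t0 H => let: ex_intro e (ex_intro C (And3 e0 _ HC)) := loc t0 H in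
         ex_intro _ e (ex_intro _ C (conj e0 (fun s t a b c f g =>
           (HC s t a b c f g).1)))).
    exists d1, C1; split => // s t s0 st tT ts.
    by rewrite /incr subrr sub0r normrN; exact: H1.
  apply/approx_omw => //.
  have [d1 [C1 [d10 _ H1]]] := @small_near_uniform R p omega _ T0 3
      (fun s t => tlift (fun v u =>
        tens (v *m al (x s)) (u *m al (x s))) (level2 (rough_lift x A) s t))
      (fun t0 H => let: ex_intro e (ex_intro C (And3 e0 _ HC)) := loc t0 H in
         ex_intro _ e (ex_intro _ C (conj e0 (fun s t a b c f g =>
           (HC s t a b c f g).2)))).
  exists d1, C1; split => // s t s0 st tT ts.
  by rewrite sub0r normrN; exact: H1.
- by apply/approx_omw => //; exists dl, K'; split => // s t s0 st tT ts; exact: HK'.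
- by apply/approx_omw => //; exists 1, K; split => // s t s0 st tT _; exact: lev.
Qed.

(** * Extension of Davie paths *)

Definition glue (a : R) (x z : R -> 'rV[R]_N) t := if t <= a then x t else z t.

Lemma glue_left a x z t : t <= a -> glue a x z t = x t.
Proof. by rewrite /glue => ->. Qed.

Lemma glue_right a x z t : x a = z a -> a <= t -> glue a x z t = z t.
Proof.
rewrite /glue => xz; rewrite le_eqVlt => /orP[/eqP <-|at_]; first by rewrite lexx.
by rewrite leNgt at_.
Qed.

Lemma davie_incr_diag s y : 0 <= s <= T -> M y -> davie_incr s s y = 0.
Proof.
move=> sT My; rewrite /davie_incr incr_diag level2_diag //.
rewrite (Y_sum Y_linear _ My) big1 => [|i _]; last by rewrite mxE scale0r.
by rewrite add0r /tlift big1 // => i _; rewrite big1 // => j _; rewrite mxE scale0r.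
Qed.

Lemma davie_path0 y : M y -> davie_path 0 (fun=> y).
Proof.
move=> My; split => //; first by apply/continuous_subspaceT => z;
  exact: cst_continuous.
exists 1, 0; split => // s t s0 st t0 _.
have tE : t = s by apply/eqP; rewrite eq_le st (le_trans t0 s0).
have sE : s = 0 by apply/eqP; rewrite eq_le s0 -tE t0.
by rewrite tE /davie_err davie_incr_diag ?subrr ?sub0r ?normrN ?normr0 ?mul0r //
  sE lexx ltW.
Qed.

Lemma davie_path_sub T0 T1 x x' : T1 <= T0 -> (forall t, 0 <= t <= T1 ->
  x t = x' t) ->
  davie_path T0 x -> davie_path T1 x'.
Proof.
move=> T10 xx' [xc xM [dl [K [dl0 K0 H]]]]; split.
- apply/within_continuous_eps => t; rewrite /= in_itv /= => /andP[t0 t1] e e0.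
  have tT : 0 <= t <= T0 by rewrite t0 (le_trans t1).
  have [d1 [d10 H1]] := path_eps xc tT e0.
  exists d1; split => // s; rewrite in_itv /= => /andP[s0 s1] st.
  by rewrite -!xx' ?s0 ?t0 //; apply: H1 => //; rewrite s0 (le_trans s1).
- by move=> t /andP[t0 t1]; rewrite -xx' ?t0 //; apply: xM; rewrite t0 (le_trans t1).
- exists dl, K; split => // s t s0 st t1 ts.
  have := H s t s0 st (le_trans t1 T10) ts.
  by rewrite /davie_err !xx' // ?s0 ?(le_trans s0) // (le_trans st).
Qed.

Lemma le_middle (a b c : R) : 0 <= a -> 0 <= c -> b <= a + (b + c).
Proof. by move=> *; lra. Qed.

Lemma norm_split3 (V : normedModType R) (a b c : V) : `|a| <= `|b| + `|c| + `|a - b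
  - c|.
Proof.
have {1}-> : a = (b + c) + (a - b - c) by rewrite -(addrA a) -opprD [RHS]addrC subrK.
by apply: (le_trans (ler_normD _ _)); rewrite lerD2r ler_normD.
Qed.

(** At a pair [s <= a <= t], [err_defect] with the intermediate time [a] writes the
    error as the sum of the errors of the two pieces and a third-order remainder. *)
Lemma davie_path_glue a b x z K : 0 <= a -> a <= b -> b <= T ->
  davie_path a x -> z a = x a -> (forall t, M (z t)) -> 0 <= K ->
  (forall s t, a <= s -> s <= t -> t <= b ->
    `|z t - z s| <= K * w s t /\ `|err z s t| <= K * w s t ^+ 3) ->
  davie_path b (glue a x z).
Proof.
move=> a0 ab bT dx zx zM K0 zK; have [xc xM [dl [K1 [dl0 K10 xK]]]] := dx.
have aI : 0 <= a <= a by rewrite a0 lexx.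
have aT : a <= T := le_trans ab bT.
have yl t : t <= a -> glue a x z t = x t by exact: glue_left.
have yr t : a <= t -> glue a x z t = z t by exact: glue_right.
set y := glue a x z in yl yr *; clearbody y.
have yM t : 0 <= t <= b -> M (y t).
  move=> /andP[t0 tb]; have [ta|/ltW ta] := leP t a; last by rewrite yr.
  by rewrite yl //; apply: xM; rewrite t0.
have [B [B0 _ xw]] := path_bounds a0 aT dx.
have yw s t : 0 <= s -> s <= t -> t <= b -> `|y t - y s| <= (B + K) * w s t.
  move=> s0 st tb; have tT := le_trans tb bT; have w0 := omw_ge0 p omega s t.
  have [ta|/ltW ta] := leP t a.
    rewrite !yl ?(le_trans st) // mulrDl; have [h _ _] := xw s t s0 st ta.
    by rewrite (le_trans h) // lerDl mulr_ge0.
  have [sa|/ltW sa] := leP s a; last first.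
    rewrite !yr // ?(le_trans sa) // mulrDl; have [h _] := zK s t sa st tb.
    by rewrite (le_trans h) // lerDr mulr_ge0.
  have [h1 _ _] := xw s a s0 sa (lexx a); have [h2 _] := zK a t (lexx a) ta tb.
  rewrite -(subrKA (y a)) addrC (yl s) // (yr t) //
    mulrDl (le_trans (ler_normD _ _)) //.
  apply: lerD.
    rewrite yl // (le_trans h1) // ler_wpM2l //.
    exact: (omw_mono p_ge2 omega_control s0 (lexx s) sa ta tT).
  rewrite yr // (le_trans h2) // ler_wpM2l //.
  exact: (omw_mono p_ge2 omega_control s0 sa ta (lexx t) tT).
have yc : {within `[0, b], continuous y}.
  apply/within_continuous_eps => t; rewrite /= in_itv /= => tI e e0.
  have BK0 : 0 <= B + K by rewrite addr_ge0.
  have tTT : 0 <= t <= T by case/andP: tI => -> /le_trans ->.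
  have [e1 [e10 He]] : exists e1, 0 < e1 /\ (B + K) * e1 <= e.
    have C1 : 0 < B + K + 1 by rewrite ltr_wpDl.
    exists (e / (B + K + 1)); split; first by rewrite divr_gt0.
    by rewrite mulrCA ger_pMr // ler_pdivrMr // mul1r lerDl.
  have [d1 [d10 H]] := omw_eps p_ge2 omega_control tTT e10.
  exists d1; split => // s; rewrite in_itv /= => sI st; have /andP[s0 sb] := sI;
    have /andP[t0 tb] := tI.
  have tt : `|t - t| < d1 by rewrite subrr normr0.
  have [st'|/ltW st'] := leP s t.
    rewrite distrC; apply: (le_trans (yw s t s0 st' tb)); apply: (le_trans _ He).
    by rewrite ler_wpM2l //; apply: H => //; exact: le_trans bT.
  apply: (le_trans (yw t s t0 st' sb)); apply: (le_trans _ He).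
  by rewrite ler_wpM2l //; apply: H => //; exact: le_trans bT.
split => //.
apply: (@small_near_uniform R p omega _ b 3 (fun s t => err y s t)) =>
  t0 /andP[t00 t0b].
have errl s t : s <= a -> t <= a -> err y s t = err x s t by move=> sa ta;
  rewrite /davie_err !yl.
have errr s t : a <= s -> a <= t -> err y s t = err z s t by move=> sa ta;
  rewrite /davie_err !yr.
have [t0a|at0|t0E] := ltgtP t0 a.
- exists (Num.min (a - t0) (dl / 2)), K1; split;
  first by rewrite lt_min subr_gt0 t0a divr_gt0.
  move=> s t s0 st tb; rewrite !lt_min => /andP[_ sd] /andP[td td'].
  have ta : t <= a.
    by rewrite -(lerD2r (- t0)) (le_trans (ler_norm _)) // ltW.
  rewrite errl //; last exact: le_trans ta.
  apply: xK => //; rewrite -(subrKA t0) [dl]splitr (le_trans (ler_norm _)) //.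
  by rewrite (le_trans (ler_normD _ _)) // (distrC t0) lerD // ltW.
- exists (t0 - a), K; split; first by rewrite subr_gt0.
  move=> s t s0 st tb sd _.
  have sa : a <= s.
    rewrite -(lerD2r (- t0)) -[leLHS]opprB lerNl.
    by apply: ltW; apply: le_lt_trans sd; rewrite -normrN ler_norm.
  by rewrite errr //; [have [] := zK s t sa st tb | exact: le_trans st].
subst t0.
have Ma : M (x a) by exact: xM.
have [r [C [f [F [U ch]]]]] := adapted_chart_exists M_submanifold Y_linear Ma.
have [c [c1 drv]] := driver_bounds.
have r0 := chart_r ch; have C0 := chart_C ch.
have fC := chart_f ch; have gC := chart_deriv ch.
have c0 : 0 <= c by exact: le_trans c1.
have cp : 0 < c by exact: lt_le_trans c1.
have aIb : 0 <= a <= b by rewrite a0.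
have [d1 [d10 H1]] := path_eps yc aIb r0.
have aTT : 0 <= a <= T by rewrite a0.
have ci0 : 0 < c^-1 by rewrite invr_gt0.
have [d2 [d20 H2]] := omw_eps p_ge2 omega_control aTT ci0.
have [A [A1 AA0 AK]] := common_bound (step_const_ge0 n C0) (addr_ge0 (addr_ge0 B0
  K0) K10).
have A0 : 0 <= A by exact: le_trans A1.
pose C3 := (n%:R * C * (A ^+ 2 + A) + n%:R ^+ 2 * C * A) * c ^+ 3.
have C30 : 0 <= C3 by rewrite /C3 !(addr_ge0, mulr_ge0, exprn_ge0).
have C3E : (n%:R * C * (A ^+ 2 + A) + n%:R ^+ 2 * C * A) * c ^+ 3 = C3 by [].
clearbody C3.
exists (Num.min (Num.min d1 d2) dl), (K1 + K + C3); split;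
  first by rewrite !lt_min d10 d20 dl0.
move=> s t s0 st tb;
  rewrite !lt_min => /andP[/andP[sd1 sd2] sdl] /andP[/andP[td1 td2] tdl].
have tT := le_trans tb bT; have w0 := omw_ge0 p omega s t.
have w30 : 0 <= w s t ^+ 3 by rewrite exprn_ge0.
have gap u v : u <= v -> v <= a -> `|u - a| < dl -> v - u <= dl.
  move=> uv va ua; apply: (@le_trans _ _ (a - u)); first by rewrite lerD2r.
  by rewrite (le_trans (ler_norm _)) // distrC ltW.
rewrite 2!mulrDl; have [ta|/ltW ta] := leP t a.
  rewrite errl //; last exact: le_trans ta.
  apply: (le_trans (xK s t s0 st ta (gap s t st ta sdl))).
  by rewrite -addrA lerDl addr_ge0 ?mulr_ge0.
have [sa|/ltW sa] := leP s a; last first.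
  rewrite errr //; have [_ h] := zK s t sa st tb.
  by apply: (le_trans h); rewrite addrAC lerDr addr_ge0 ?mulr_ge0.
have sI : 0 <= s <= b by rewrite s0 (le_trans st).
have ys : cball (x a) r (y s) by rewrite -(yl a (lexx a)); apply: H1.
have ya : cball (x a) r (y a) by rewrite yl // /cball /= subrr normr0 ltW.
have Ms := yM s sI; have Mya := yM a aIb.
have m1 := omw_mono p_ge2 omega_control s0 (lexx s) sa ta tT.
have m2 := omw_mono p_ge2 omega_control s0 sa ta (lexx t) tT.
have q1 := omw_ge0 p omega s a; have q2 := omw_ge0 p omega a t.
have [z1 z2] := drv s a s0 sa aT; have [z1' z2'] := drv a t a0 ta tT.
have wc : c * w s t <= 1.
  by rewrite mulrC -ler_pdivlMr // mul1r; apply: H2.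
have eta0 : 0 <= c * w s t by rewrite mulr_ge0.
have eta01 : 0 <= c * w s t <= 1 by rewrite eta0 wc.
have wwc : w s t <= c * w s t by rewrite ler_peMl.
have sqm v : 0 <= v -> v <= w s t -> (c * v) ^+ 2 <= (c * w s t) ^+ 2.
  by move=> v0 vw; rewrite lerXn2r ?nnegrE ?mulr_ge0 // ler_wpM2l.
have cbm v : 0 <= v -> v <= w s t -> v ^+ 3 <= w s t ^+ 3.
  by move=> v0 vw; rewrite lerXn2r.
have Zsa := le_trans z2 (sqm _ q1 m1).
have esa : `|err y s a| <= K1 * w s a ^+ 3.
  by rewrite errl //; apply: xK => //; apply: gap.
have eat : `|err y a t| <= K * w a t ^+ 3.
  by rewrite errr //; have [] := zK a t (lexx a) ta tb.
have [k1 _] := cube_small K10 q1 m1 wwc wc.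
have yas : cball (x a) r (y s + (y a - y s)) by rewrite addrC subrK.
have zat : `|incr Z a t| <= c * w s t by apply: (le_trans z1'); rewrite ler_wpM2l.
have Hh : `|y a - y s| <= A * (c * w s t).
  apply: (le_trans (yw s a s0 sa ab)); apply: ler_pM => //; first by rewrite addr_ge0.
    by apply: le_trans AK; apply: le_middle => //; exact: step_const_ge0.
  exact: le_trans wwc.
have He : `|field2 f (level2 Z s a) (y s) + err y s a| <= A * (c * w s t) ^+ 2.
  apply: (le_trans (ler_normD _ _)).
  apply: (le_trans (lerD (field2_small C0 gC eta01 Zsa ys) (le_trans esa k1))).
  rewrite -mulrDl ler_wpM2r ?exprn_ge0 // (le_trans _ AK) // lerD2l.
  by rewrite lerDr addr_ge0.
have := step_remainder_le C0 fC gC eta0 A0 zat (le_trans z2' (sqm _ q2 m2)) ys yas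
  Hh He.
rewrite -(err_defect ch s0 sa ta tT Ms Mya ys ya) exprMn mulrA C3E => Hr.
apply: (le_trans (norm_split3 (err y s t) (err y s a) (err y a t))).
apply: lerD => //; apply: lerD.
  by apply: (le_trans esa); rewrite ler_wpM2l // cbm.
by apply: (le_trans eat); rewrite ler_wpM2l // cbm.
Qed.

(** Since [e] does not depend on the path, a path which is near [m] shortly before
    [tau] can be restarted there and continued up to or past [tau]. *)
Lemma path_extend tau m : 0 <= tau <= T -> M m ->
  exists e : R, 0 < e /\ forall a b x, 0 <= a -> a <= b -> b <= T ->
    `|a - tau| < e -> `|b - tau| < e -> davie_path a x -> `|x a - m| < e ->
    exists y, davie_path b y /\ y 0 = x 0.
Proof.
move=> tauT Mm; have [e [e0 H]] := local_solution tauT Mm.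
exists e; split => // a b x a0 ab bT ae be dx xe; have [_ xM _] := dx.
have Mx : M (x a) by apply: xM; rewrite a0 lexx.
have [z [za zM [K [K0 zK]]]] := H a b (x a) a0 ab bT ae be Mx xe.
exists (glue a x z); split; first exact: (davie_path_glue a0 ab bT dx za zM K0 zK).
by rewrite glue_left.
Qed.

(** * Uniqueness and restriction of solutions *)

Local Notation solution := (rde_solution d omega p M Y Z).

Lemma solution_path T0 X x0 : 0 <= T0 -> T0 <= T -> solution x0 T0 X ->
  davie_path T0 (trace X) /\ trace X 0 = x0.
Proof.
move=> T00 T0T [[[[xc _] _ _ _ _] xM _] x0E /(approx_omw _ _ T0T)[dl [C [dl0 H]]] _].
split => //; split => //; exists dl, `|C|; split => // s t s0 st tT ts.
apply: (le_trans (H s t s0 st tT ts)).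
by rewrite ler_wpM2r ?ler_norm // exprn_ge0 ?omw_ge0.
Qed.

Lemma WG_level2_le (k : nat) T0 (X : rpath R k) : 0 <= T0 -> T0 <= T ->
  WG omega p T0 X ->
  exists C, forall s t, 0 <= s -> s <= t -> t <= T0 -> `|level2 X s t| <= C.
Proof.
move=> T00 T0T [_ chen _ [C HC] _].
have diag s : 0 <= s -> s <= T0 -> level2 X s s = 0.
  move=> s0 sT; have := chen s s s s0 (lexx s) (lexx s) sT.
  rewrite /incr subrr /tens trmx0 mul0mx addr0 => H.
  by apply: (addrI (level2 X s s)); rewrite addr0 -H.
exists (`|C| * w 0 T0 ^+ 2) => s t s0; rewrite le_eqVlt => /orP[/eqP <- sT|st tT].
  by rewrite diag // normr0 mulr_ge0 // exprn_ge0 ?omw_ge0.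
have w0 : 0 < w s t by exact: (omw_gt0 p omega_control s0 st (le_trans tT T0T)).
have om0 : 0 <= omega s t by exact: (omega_ge0 omega_control s0 (ltW st) (le_trans
  tT T0T)).
have := HC s t s0 st tT;
  rewrite (powR_omw p (k:=2) isT om0) ler_pdivrMr ?exprn_gt0 // => H.
apply: (le_trans H); apply: (@le_trans _ _ (`|C| * w s t ^+ 2)).
  by rewrite ler_wpM2r ?ler_norm // exprn_ge0 // ltW.
rewrite ler_wpM2l // lerXn2r ?nnegrE ?omw_ge0 //.
exact: (omw_le_total s0 (ltW st) tT T0T).
Qed.

(** The second levels have the same defect and the same second-order part, so
    their difference is additive and of third order. *)
Lemma solution_unique T0 X X' x0 : 0 <= T0 -> T0 <= T ->
  solution x0 T0 X -> solution x0 T0 X' -> eq_rpath T0 X X'.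
Proof.
move=> T00 T0T sX sX'.
have [dX X0] := solution_path T00 T0T sX; have [dX' X0'] := solution_path T00 T0T sX'.
have tr : forall t, 0 <= t <= T0 -> trace X t = trace X' t.
  by apply: davie_path_unique => //; rewrite X0.
split => // s t s0 st tT; apply/eqP; rewrite -subr_eq0; apply/eqP.
move: s t s0 st tT.
have [[wX _ _] _ _ /(approx_omw _ _ T0T)[d1 [C1 [d10 H1]]]] := sX.
have [[wX' _ _] _ _ /(approx_omw _ _ T0T)[d2 [C2 [d20 H2]]]] := sX'.
have [B1 HB1] := WG_level2_le T00 T0T wX; have [B2 HB2] := WG_level2_le T00 T0T wX'.
have [_ ch1 _ _ _] := wX; have [_ ch2 _ _ _] := wX'.
apply: (additive_small_eq0 p_ge2 p_lt3 omega_control T00 T0T (g := fun s t =>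
  level2 X s t - level2 X' s t)).
  move=> s u t s0 su ut tT; rewrite (ch1 s u t s0 su ut tT) (ch2 s u t s0 su ut tT).
  have uT := le_trans ut tT; have u0 := le_trans s0 su.
  rewrite /incr !tr ?s0 ?u0 ?(le_trans su uT) ?(le_trans u0 ut) ?uT ?tT //.
  by move: (tens _ _) => Q; apply/matrixP => i j; rewrite !mxE; ring.
have d120 : 0 < Num.min d1 d2 by rewrite lt_min d10.
have [s t s0 st tT ts|s t s0 st tT|C' [_ HC']] := @near_diagonal_global R T p omega
  p_ge2 omega_control _ T0
  (fun s t => level2 X s t - level2 X' s t) 3 (Num.min d1 d2) (C1 + C2) (B1 + B2)
    T0T d120.
- move: ts; rewrite le_min => /andP[t1 t2].
  have sI : 0 <= s <= T0 by rewrite s0 (le_trans st).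
  have h1 := H1 s t s0 st tT t1; have h2 := H2 s t s0 st tT t2.
  rewrite -(tr s sI) in h2.
  apply: (le_trans (ler_distD (tensY (level2 Z s t) (trace X s)) _ _)).
  by rewrite mulrDl; apply: lerD => //; rewrite distrC.
- apply: (le_trans (ler_normB _ _)); apply: lerD; [exact: HB1 | exact: HB2].
by exists C' => s t; exact: HC'.
Qed.

Lemma WG_sub (k : nat) T0 T1 (X X' : rpath R k) : T1 <= T0 -> eq_rpath T1 X X' ->
  WG omega p T0 X -> WG omega p T1 X'.
Proof.
move=> T10 [tr lv] [[xc lc] chen [C1 H1] [C2 H2] sym].
have ic s t : 0 <= s -> s <= t -> t <= T1 -> incr X' s t = incr X s t.
  by move=> s0 st tT; rewrite /incr !tr // ?s0 ?(le_trans s0) // (le_trans st).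
split.
- split.
    apply/within_continuous_eps => t; rewrite /= in_itv /= => /andP[t0 t1] e e0.
    have tT : 0 <= t <= T0 by rewrite t0 (le_trans t1).
    have /within_continuous_eps/(_ t) := xc;
      rewrite /= in_itv /= => /(_ tT e e0)[dl [dl0 H]].
    exists dl; split => // s; rewrite in_itv /= => /andP[s0 s1] st.
    by rewrite -!tr ?s0 ?t0 //; apply: H => //; rewrite in_itv /= s0 (le_trans s1).
  apply/within_continuous_eps => -[s t] [/= s0 st t1] e e0.
  have /within_continuous_eps/(_ (s, t)) := lc.
  case/(_ (And3 s0 st (le_trans t1 T10)) e e0) => dl [dl0 H].
  exists dl; split => // -[s' t'] [/= s0' st' t1'] ss.
  rewrite -!lv //; apply: (H (s', t')) => //.
  by split => //=; exact: le_trans T10.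
- move=> s u t s0 su ut t1; have u1 := le_trans ut t1; have u0 := le_trans s0 su.
  rewrite !ic // -!lv // ?(le_trans su) //.
  exact: chen s0 su ut (le_trans t1 T10).
- by exists C1 => s t s0 st t1; rewrite ic ?(ltW st) //; apply: H1 => //;
  exact: le_trans T10.
- by exists C2 => s t s0 st t1; rewrite -lv ?(ltW st) //; apply: H2 => //;
  exact: le_trans T10.
- by move=> s t s0 st t1; rewrite ic // -lv //; apply: sym => //; exact: le_trans T10.
Qed.

Lemma approx_sub (V : normedModType R) T0 T1 (g h g' h' : R -> R -> V) : T1 <= T0 ->
  (forall s t, 0 <= s -> s <= t -> t <= T1 -> g s t = g' s t /\ h s t = h' s t) ->
  Defs.approx omega p T0 g h -> Defs.approx omega p T1 g' h'.
Proof.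
move=> T10 gh [dl [C [dl0 H]]]; exists dl, C; split => // s t s0 st t1 ts.
by have [<- <-] := gh s t s0 st t1; apply: H => //; exact: le_trans T10.
Qed.

(** Covers both restriction in time and change of the representative outside of
    [0, T1]. *)
Lemma solution_sub T0 T1 X X' x0 : 0 <= T1 -> T1 <= T0 -> eq_rpath T1 X X' ->
  solution x0 T0 X -> solution x0 T1 X'.
Proof.
move=> T10 T1T XX' [[wX xM al] X0 H1 H2]; have [tr lv] := XX'.
have trs s t : 0 <= s -> s <= t -> t <= T1 -> trace X s = trace X' s.
  by move=> s0 st tT; rewrite tr // s0 (le_trans st).
have ic s t : 0 <= s -> s <= t -> t <= T1 -> incr X s t = incr X' s t.
  by move=> s0 st tT; rewrite /incr !tr // ?s0 ?(le_trans s0) // (le_trans st).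
split.
- split; first exact: WG_sub wX.
    by move=> t /andP[t0 t1]; rewrite -tr ?t0 //; apply: xM; rewrite t0 (le_trans t1).
  move=> k a sa ta; have [_ _ A1 A2] := al k a sa ta.
  split; [exact: WG0 | by [] | |].
    apply: approx_sub T1T _ A1 => s t s0 st t1.
    by rewrite (ic s t s0 st t1) (trs s t s0 st t1) lv.
  apply: approx_sub T1T _ A2 => s t s0 st t1.
  by rewrite (trs s t s0 st t1) lv.
- by rewrite -tr // lexx.
- apply: approx_sub T1T _ H1 => s t s0 st t1.
  by rewrite (ic s t s0 st t1) (trs s t s0 st t1).
- apply: approx_sub T1T _ H2 => s t s0 st t1.
  by rewrite (trs s t s0 st t1) lv.
Qed.

(** * The maximal solution *)

Section maximal.
Variable x0 : 'rV[R]_N.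
Hypothesis M_x0 : M x0.

Definition reachable : set R :=
  [set t | 0 <= t <= T /\ exists x, davie_path t x /\ x 0 = x0].

Lemma reachable0 : reachable 0.
Proof.
split; first by rewrite lexx ltW.
by exists (fun=> x0); split => //; exact: davie_path0.
Qed.

Lemma reachable_solution t : reachable t <->
  0 <= t <= T /\ exists X, solution x0 t X.
Proof.
split => -[/andP[t0 tT]] => [[x [dx xx0]]|[X sX]]; rewrite /reachable /= t0 tT;
  split => //.
  by have [X [_ sX]] := lift_solution t0 tT dx; exists X; rewrite -xx0.
by exists (trace X); exact: (solution_path t0 tT sX).
Qed.

Lemma reachable_le s t : 0 <= s -> s <= t -> reachable t -> reachable s.
Proof.
move=> s0 st [/andP[t0 tT] [x [dx xx0]]]; split; first by rewrite s0 (le_trans st).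
by exists x; split => //; exact: (davie_path_sub st _ dx).
Qed.

Definition tau := sup reachable.

Lemma reachable_has_sup : has_sup reachable.
Proof.
split; first by exists 0; exact: reachable0.
by exists T => t [/andP[]].
Qed.

Lemma tau_ge t : reachable t -> t <= tau.
Proof. exact: (sup_upper_bound reachable_has_sup). Qed.

Lemma tau_bounds : 0 <= tau <= T.
Proof.
apply/andP; split; first by apply: tau_ge; exact: reachable0.
apply: ge_sup; first by exists 0; exact: reachable0.
by move=> t [/andP[]].
Qed.

Lemma reachable_lt t : 0 <= t -> t < tau -> reachable t.
Proof.
move=> t0 tt; have e0 : 0 < tau - t by rewrite subr_gt0.
have [s rs] := sup_adherent e0 reachable_has_sup; rewrite subKr => ts.
by apply: reachable_le rs => //; exact: ltW.
Qed.

Lemma reachable_past a b m e x :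
  (forall a b x, 0 <= a -> a <= b -> b <= T ->
    `|a - tau| < e -> `|b - tau| < e -> davie_path a x -> `|x a - m| < e ->
    exists y, davie_path b y /\ y 0 = x 0) ->
  0 <= a -> a <= b -> b <= T -> `|a - tau| < e -> `|b - tau| < e ->
  davie_path a x -> x 0 = x0 -> `|x a - m| < e -> reachable b.
Proof.
move=> H a0 ab bT ae be dx xx0 xe.
have [y [dy yx]] := H a b x a0 ab bT ae be dx xe.
split; first by rewrite (le_trans a0 ab).
by exists y; rewrite yx.
Qed.

Lemma reachable_tau : reachable tau -> tau = T.
Proof.
move=> rt; have [tI [x [dx xx0]]] := rt; have [_ xM _] := dx.
have /andP[t0 tT] := tI; have Mx : M (x tau) by apply: xM; rewrite t0 lexx.
have [e [e0 He]] := path_extend tI Mx.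
apply/eqP; rewrite eq_le tT leNgt; apply/negP => tltT.
pose b := Num.min T (tau + e / 2).
have e20 : 0 < e / 2 by rewrite divr_gt0.
have tb : tau < b by rewrite lt_min tltT ltrDl e20.
have bT : b <= T by rewrite ge_min lexx.
have : reachable b.
  apply: (reachable_past He t0 (ltW tb) bT _ _ dx xx0).
  - by rewrite subrr normr0.
  - rewrite gtr0_norm ?subr_gt0 // ltrBlDl (@le_lt_trans _ _ (tau + e / 2)) //.
      by rewrite ge_min lexx orbT.
    by rewrite ltrD2l ltr_pdivrMr // ltr_pMr // ltr1n.
  - by rewrite subrr normr0.
by move/tau_ge; rewrite leNgt tb.
Qed.

(** The solutions on the intervals [0, t] agree where they are both defined, so
    evaluating the one for [t] at time [t] gives a solution on all of them. *)
Lemma solution_upto : exists X, rde_solution_before d omega p M Y Z x0 tau X.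
Proof.
have /choice[X HX] : forall t, exists X, 0 <= t < tau -> solution x0 t X.
  move=> t; have [tI|tI] := boolP (0 <= t < tau); last by exists (rpath0 R N).
  have /andP[t0 tt] := tI.
  by have /reachable_solution[_ [X sX]] := reachable_lt t0 tt; exists X.
exists (RPath (fun t => trace (X t) t) (fun s t => level2 (X t) s t)) => T0 T0I.
have /andP[T00 T0t] := T0I; have /andP[_ tT] := tau_bounds.
have agree t : 0 <= t <= T0 -> eq_rpath t (X T0) (X t).
  move=> /andP[t0 tT0].
  apply: (solution_unique (x0 := x0) t0 (le_trans tT0 (le_trans (ltW T0t) tT))).
    by apply: (solution_sub t0 tT0 _ (HX T0 T0I)); split.
  by apply: HX; rewrite t0 (le_lt_trans tT0).
apply: (solution_sub T00 (lexx T0) _ (HX T0 T0I)); split => [t tI|s t s0 st tT0] /=.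
  by have [H _] := agree t tI; apply: H; case/andP: tI => ->; rewrite lexx.
have tI : 0 <= t <= T0 by rewrite (le_trans s0).
by have [_ H] := agree t tI; apply: H.
Qed.

(** Were the closure compact, the trace would have a cluster point [m] in [M] as [t]
    increases to [tau], and [path_extend] at [(tau, m)] would reach [tau]. *)
Lemma solution_explodes X : ~ reachable tau ->
  rde_solution_before d omega p M Y Z x0 tau X -> explodes M tau X.
Proof.
move=> not_reachable HX; have /andP[t0 tT] := tau_bounds.
have tau0 : 0 < tau.
  rewrite lt_neqAle t0 andbT; apply/eqP => t0E.
  by apply: not_reachable; rewrite -t0E; exact: reachable0.
have dX t : 0 <= t < tau -> davie_path t (trace X) /\ trace X 0 = x0.
  move=> tI; have /andP[tge tlt] := tI.
  exact: (solution_path tge (le_trans (ltW tlt) tT) (HX t tI)).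
move=> cpt; set A := (_ `&` M) in cpt.
have FA : \forall t \near tau^'-, A (trace X t).
  near=> t.
  have tI : 0 <= t < tau.
    by apply/andP; split; near: t; [apply: nbhs_left_ge | apply: nbhs_left_lt].
  split; last by have [[_ xM _] _] := dX t tI; apply: xM; case/andP: tI => ->;
    rewrite lexx.
  by apply: subset_closure; exists t => //=; rewrite in_itv.
have [m [[_ Mm] cl]] := cpt (trace X @ tau^'-) _ FA.
have [e [e0 He]] := path_extend tau_bounds Mm.
have e20 : 0 < e / 2 by rewrite divr_gt0.
have e2e : e / 2 < e by rewrite ltr_pdivrMr // ltr_pMr // ltr1n.
have late : \forall t \near tau^'-,
    [set trace X t | t in [set t | 0 <= t < tau /\ tau - t < e]] (trace X t).
  near=> t; exists t => //=; split.
    by apply/andP; split; near: t; [apply: nbhs_left_ge | apply: nbhs_left_lt].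
  rewrite ltrBlDr -ltrBlDl; near: t; apply: nbhs_left_gt.
  by rewrite gtrBl.
have [_ [[t [tI te] <-] /= tm]] := cl _ _ late (nbhsx_ballx m e e0).
have [dx xx0] := dX t tI; have /andP[tge tlt] := tI.
apply: not_reachable.
apply: (reachable_past He tge (ltW tlt) tT _ _ dx xx0).
- by rewrite distrC ger0_norm // subr_ge0 ltW.
- by rewrite subrr normr0.
- by move: tm; rewrite -ball_normE /= distrC.
Unshelve. all: by end_near. Qed.

Lemma maximal_solution : exists X : rpath R N,
    (solution x0 T X \/
     exists tau : R, [/\ 0 <= tau <= T,
       rde_solution_before d omega p M Y Z x0 tau X & explodes M tau X]) /\
    (forall (T0 : R) (X' : rpath R N), 0 <= T0 <= T ->
       solution x0 T0 X' -> solution x0 T0 X /\ eq_rpath T0 X' X).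
Proof.
suff [X HX Hlt] : exists2 X, solution x0 T X \/
    exists tau : R, [/\ 0 <= tau <= T,
       rde_solution_before d omega p M Y Z x0 tau X & explodes M tau X] &
    forall T0, reachable T0 -> solution x0 T0 X.
  exists X; split => // T0 X' T0I sX'; have /andP[T00 T0T] := T0I.
  have sX : solution x0 T0 X by apply: Hlt; apply/reachable_solution; split => //;
    exists X'.
  by split => //; exact: (solution_unique T00 T0T sX' sX).
have [rt|nrt] := pselect (reachable tau).
  have tE := reachable_tau rt; move: rt; rewrite tE => /reachable_solution[_ [X sX]].
  exists X; first by left.
  by move=> T0 [/andP[T00 T0T] _]; apply: (solution_sub T00 T0T _ sX); split.
have [X HX] := solution_upto; exists X.
  by right; exists tau; split => //; [exact: tau_bounds | exact: solution_explodes].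
move=> T0 rT0; have [/andP[T00 T0T] _] := rT0.
apply: HX; rewrite T00 lt_neqAle tau_ge // andbT.
by apply/eqP => tE; apply: nrt; rewrite -tE.
Qed.

End maximal.

End rde.

Theorem theorem4p2 (R : realType) (T p : R) (omega : R -> R -> R)
    (n N d : nat) (M : set 'rV[R]_N) (x0 : 'rV[R]_N)
    (Y : 'rV[R]_n -> 'rV[R]_N -> 'rV[R]_N) (Z : rpath R n)
    (T_gt0 : 0 < T) (p_ge2 : 2 <= p) (p_lt3 : p < 3)
    (omega_control : control T omega)
    (M_submanifold : submanifold d M)
    (M_x0 : M x0)
    (Y_linear : linear_vector_fields d M Y)
    (Z_WG : WG omega p T Z) :
  exists X : rpath R N,
    (rde_solution d omega p M Y Z x0 T X \/
     exists tau : R, [/\ 0 <= tau <= T,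
       rde_solution_before d omega p M Y Z x0 tau X &
       explodes M tau X]) /\
    (forall (T0 : R) (X' : rpath R N), 0 <= T0 <= T ->
       rde_solution d omega p M Y Z x0 T0 X' ->
       rde_solution d omega p M Y Z x0 T0 X /\ eq_rpath T0 X' X).
Proof.
exact: (maximal_solution T_gt0 p_ge2 p_lt3 omega_control M_submanifold Y_linear
  Z_WG M_x0).
Qed.
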